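(* Let $m,n\ge1$, let $T=(T_1,\dots,T_n)$ be a pure $m$-hypercontraction on a Hilbert space $\mathcal{H}$, and let $(\mathcal{E},B,D)$ be a characteristic triple of $T$. Let $$\Phi_T(\mathbf{z})=\sum_{\mathbf{k}\in\mathbb{Z}_+^n}\sqrt{\rho_{m-1}(\mathbf{k})}\,D_{\mathbf{k}}\,z^{\mathbf{k}}+D_{m,T^*}(I_{\mathcal{H}}-ZT^* )^{-m}ZB\qquad(\mathbf{z}\in\mathbb{B}^n)$$ be the characteristic function of $T$ corresponding to $(\mathcal{E},B,D)$. Then $\Phi_T$ is a multiplier from $H^2_n(\mathcal{E})$ to $\mathbb{H}_m(\mathbb{B}^n,\mathcal{D}_{m,T^*})$ which is partially isometric (i.e. the multiplication operator $M_{\Phi_T}$ is a partial isometry), and $$\mathcal{S}_{m,T}=\Phi_T\,H^2_n(\mathcal{E}),$$ where $\mathcal{S}_{m,T}=\mathbb{H}_m(\mathbb{B}^n,\mathcal{D}_{m,T^*})\ominus\Pi_m\mathcal{H}$ is the canonical invariant subspace corresponding to $T$.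
   Context: All Hilbert spaces are complex and separable. $\mathbb{B}^n$ is the open unit ball of $\mathbb{C}^n$. $T=(T_1,\dots,T_n)$ is a commuting $n$-tuple of bounded operators on $\mathcal{H}$; $T$ also denotes the row operator $\mathcal{H}^n\to\mathcal{H}$, $(h_1,\dots,h_n)\mapsto\sum_i T_ih_i$, so $T^*:\mathcal{H}\to\mathcal{H}^n$ is $h\mapsto(T_1^*h,\dots,T_n^*h)$. For $\mathbf{k}\in\mathbb{Z}_+^n$ ($\mathbb{Z}_+$ = non-negative integers), $T^{*\mathbf{k}}=T_1^{*k_1}\cdots T_n^{*k_n}$, $z^{\mathbf{k}}=z_1^{k_1}\cdots z_n^{k_n}$. Set $\rho_p(\mathbf{k})=\frac{(p+|\mathbf{k}|-1)!}{\mathbf{k}!\,(p-1)!}$ for integers $p\ge1$, and $\rho_0(\mathbf{k})=1$ if $\mathbf{k}=0$, $\rho_0(\mathbf{k})=0$ otherwise. Let $\sigma_T(X)=\sum_{i=1}^nT_iXT_i^*$ for $X\in\mathcal{B}(\mathcal{H})$. $T$ is an $m$-hypercontraction if $(I-\sigma_T)^p(I_{\mathcal{H}})\ge0$ for $p=1$ and $p=m$; it is pure if $\sigma_T^p(I_{\mathcal{H}})\to0$ in the strong operator topology as $p\to\infty$. The defect operator is $D_{m,T^*}=[(I-\sigma_T)^m(I_{\mathcal{H}})]^{1/2}$ and $\mathcal{D}_{m,T^*}=\overline{\mathrm{ran}}\,D_{m,T^*}$. Define the contraction $C_{m,T}:\mathcal{H}\to l^2(\mathbb{Z}_+^n,\mathcal{D}_{m,T^*})$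 by $C_{m,T}h=(\sqrt{\rho_{m-1}(\mathbf{k})}D_{m,T^*}T^{*\mathbf{k}}h)_{\mathbf{k}}$. A characteristic triple of $T$ is a triple $(\mathcal{E},B,D)$ with $\mathcal{E}$ a Hilbert space, $B\in\mathcal{B}(\mathcal{E},\mathcal{H}^n)$, $D\in\mathcal{B}(\mathcal{E},l^2(\mathbb{Z}_+^n,\mathcal{D}_{m,T^*}))$ such that $\begin{bmatrix}T^*&B\\ C_{m,T}&D\end{bmatrix}:\mathcal{H}\oplus\mathcal{E}\to\mathcal{H}^n\oplus l^2(\mathbb{Z}_+^n,\mathcal{D}_{m,T^*})$ is unitary. $D_{\mathbf{k}}\in\mathcal{B}(\mathcal{E},\mathcal{D}_{m,T^*})$ denotes the $\mathbf{k}$-th entry of $D$, i.e. $D\eta=(D_{\mathbf{k}}\eta)_{\mathbf{k}}$. For $\mathbf{z}\in\mathbb{B}^n$, $Z=(z_1I_{\mathcal{H}},\dots,z_nI_{\mathcal{H}}):\mathcal{H}^n\to\mathcal{H}$, so $ZT^*=\sum_iz_iT_i^*$. For $p\ge1$ and a Hilbert space $\mathcal{F}$, $\mathbb{H}_p(\mathbb{B}^n,\mathcal{F})$ is the reproducing kernel Hilbert space of $\mathcal{F}$-valued analytic functions on $\mathbb{B}^n$ with kernel $(1-\langle\mathbf{z},\mathbf{w}\rangle)^{-p}I_{\mathcal{F}}$, where $\langle\mathbf{z},\mathbf{w}\rangle=\sum_iz_i\bar w_i$; equivalently, $\|\sum a_{\mathbf{k}}z^{\mathbf{k}}\|^2=\sum\|a_{\mathbf{k}}\|^2/\rho_p(\mathbf{k})$.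 $H^2_n(\mathcal{F}):=\mathbb{H}_1(\mathbb{B}^n,\mathcal{F})$ (Drury–Arveson space). A multiplier from $H^2_n(\mathcal{E}_1)$ to $\mathbb{H}_m(\mathbb{B}^n,\mathcal{E}_2)$ is an analytic $\Phi:\mathbb{B}^n\to\mathcal{B}(\mathcal{E}_1,\mathcal{E}_2)$ with $\Phi f\in\mathbb{H}_m(\mathbb{B}^n,\mathcal{E}_2)$ for all $f\in H^2_n(\mathcal{E}_1)$; $M_\Phi f=\Phi f$ is then bounded. The canonical dilation map $\Pi_m:\mathcal{H}\to\mathbb{H}_m(\mathbb{B}^n,\mathcal{D}_{m,T^*})$, $(\Pi_mh)(\mathbf{z})=D_{m,T^*}(I_{\mathcal{H}}-ZT^* )^{-m}h$, is (known to be) an isometry with $\Pi_mT_i^*=M_{z_i}^*\Pi_m$ for all $i$. *)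

(* Defs.v *)
From HB Require Import structures.
From mathcomp Require Import all_boot all_order all_algebra.
From mathcomp Require Import finmap complex.
From mathcomp Require Import all_classical all_reals all_analysis.
From mathcomp Require summability.

Set Implicit Arguments.
Unset Strict Implicit.
Unset Printing Implicit Defensive.

Import Order.TTheory GRing.Theory Num.Theory.

Local Open Scope classical_set_scope.
Local Open Scope complex_scope.
Local Open Scope ring_scope.

(* Separable complex Hilbert spaces. The inner product is linear in its first
   argument. *)
HB.mixin Record CompleteNormedModule_isHilbert (R : realType) H
    & CompleteNormedModule R[i] H := {
  dot : H -> H -> R[i] ;
  dotPl : forall (a : R[i]) (x y z : H),
    dot (a *: x + y) z = a * dot x z + dot y z ;
  dotC : forall x y : H, dot y x = Num.conj (dot x y) ;
  dot_norm : forall x : H, dot x x = `|x| ^+ 2 ;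
  hilbert_separable : exists2 A : set H, countable A & dense A
}.

#[short(type="hilbertType")]
HB.structure Definition Hilbert (R : realType) :=
  {H of CompleteNormedModule_isHilbert R H & CompleteNormedModule R[i] H}.

(* Unordered sums, i.e. limits along the net of finite subsets of the index
   set. *)
Section UnorderedSums.
Variables (R : realType) (I : choiceType).

Definition has_sum (V : normedModType R[i]) (x : I -> V) (s : V) : Prop :=
  summability.partial_sum x @ summability.totally --> s.

Definition csum (x : I -> R[i]) : R[i] := @summability.sum I R[i] R[i]^o x.

End UnorderedSums.

(* A Hilbert space given as a linear subspace [carrier] of a vector space
   [amb], with inner product [ip]. This lets sequence and function spaces be
   sets of plain functions; [amb] plays no other role, and [ip] is meaningful
   on [carrier] only. *)
Record ipspace (R : realType) := IPSpace {
  amb :> lmodType R[i] ;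
  carrier : set amb ;
  ip : amb -> amb -> R[i]
}.

Section Operators.
Variable R : realType.
Implicit Types S : ipspace R.

Definition linear_op S1 S2 (f : S1 -> S2) : Prop :=
  (forall x, carrier x -> carrier (f x)) /\
  (forall (a : R[i]) x y, carrier x -> carrier y ->
     f (a *: x + y) = a *: f x + f y).

Definition bounded_op S1 S2 (f : S1 -> S2) : Prop :=
  linear_op f /\
  exists M : R, forall x, carrier x -> ip (f x) (f x) <= (M ^+ 2)%:C * ip x x.

Definition unitary_op S1 S2 (f : S1 -> S2) : Prop :=
  [/\ linear_op f,
      forall x y, carrier x -> carrier y -> ip (f x) (f y) = ip x y
    & forall y, carrier y -> exists2 x, carrier x & f x = y].

Definition partial_isometry S1 S2 (f : S1 -> S2) : Prop :=
  bounded_op f /\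
  forall x, carrier x ->
    (forall y, carrier y -> f y = 0 -> ip x y = 0) ->
    ip (f x) (f x) = ip x x.

Definition orthominus S (X : set S) : set S :=
  [set f | carrier f /\ forall g, X g -> ip f g = 0].

Definition dsum S1 S2 : ipspace R :=
  @IPSpace R (S1 * S2)%type
    [set u | carrier u.1 /\ carrier u.2]
    (fun u v => ip u.1 v.1 + ip u.2 v.2).

Definition hpow (n : nat) S : ipspace R :=
  @IPSpace R ('I_n -> S)
    [set u | forall i, carrier (u i)]
    (fun u v => \sum_i ip (u i) (v i)).

(* [F] is meant to be a closed linear subspace. *)
Definition subsp (H : hilbertType R) (F : set H) : ipspace R :=
  @IPSpace R H F (@dot R H).

Definition whole (H : hilbertType R) : ipspace R := subsp [set: H].

End Operators.

Section MultiIndices.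
Variable n : nat.

Definition mindex := {ffun 'I_n -> nat}.

Definition mdegree (k : mindex) : nat := (\sum_i k i)%N.

Definition mfact (k : mindex) : nat := (\prod_i (k i)`!)%N.

Definition rho (R : realType) (p : nat) (k : mindex) : R :=
  if p is 0%N then (k == [ffun=> 0%N])%:R
  else (((p + mdegree k).-1)`!)%N%:R / (mfact k * (p.-1)`!)%N%:R.

Definition ball_pred (R : realType) : pred 'rV[R[i]]_n :=
  fun z => \sum_i `|z 0 i| ^+ 2 < 1.

Definition cball (R : realType) : Type := {z : 'rV[R[i]]_n | ball_pred z}.

Definition coor (R : realType) (z : cball R) (i : 'I_n) : R[i] := val z 0 i.

Definition monom (R : realType) (z : cball R) (k : mindex) : R[i] :=
  \prod_i coor z i ^+ k i.

End MultiIndices.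

Section FunctionSpaces.
Variables (R : realType) (n : nat).

Definition sqnorm (H : hilbertType R) (x : H) : R := complex.Re (dot x x).

Definition l2 (H : hilbertType R) (F : set H) : ipspace R :=
  @IPSpace R (mindex n -> H)
    [set a | (forall k, F (a k)) /\
             esum.summable [set: mindex n] (fun k => (sqnorm (a k))%:E)]
    (fun a b => csum (fun k => dot (a k) (b k))).

Definition is_power_series (H : hilbertType R) (a : mindex n -> H)
    (f : cball n R -> H) : Prop :=
  forall z, has_sum (fun k => monom z k *: a k) (f z).

(* The coefficients are unique when they exist. *)
Definition coefs (H : hilbertType R) (f : cball n R -> H) : mindex n -> H :=
  xget 0 [set a | is_power_series a f].

Definition Hp (p : nat) (H : hilbertType R) (F : set H) : ipspace R :=
  @IPSpace R (cball n R -> H)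
    [set f | exists a : mindex n -> H,
       [/\ forall k, F (a k), is_power_series a f
         & esum.summable [set: mindex n]
             (fun k => (sqnorm (a k) / rho R p k)%:E)]]
    (fun f g => csum (fun k =>
       ((rho R p k)^-1)%:C * dot (coefs f k) (coefs g k))).

(* Power series with bounded operator coefficients, convergent in operator
   norm at every point of the ball. *)
Definition analytic_op (S1 S2 : ipspace R) (Phi : cball n R -> S1 -> S2) :=
  exists2 A : mindex n -> S1 -> S2,
    forall k, bounded_op (A k) &
    forall z (e : R), 0 < e -> \forall J \near @summability.totally (mindex n),
      forall x, carrier x ->
        let y := Phi z x - summability.partial_sum (fun k => monom z k *: A k x) J in
        ip y y <= (e ^+ 2)%:C * ip x x.

Definition mulop (H1 H2 : hilbertType R) (Phi : cball n R -> H1 -> H2)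
    (f : cball n R -> H1) : cball n R -> H2 :=
  fun z => Phi z (f z).

Definition multiplier (m : nat) (H1 H2 : hilbertType R)
    (F1 : set H1) (F2 : set H2) (Phi : cball n R -> H1 -> H2) : Prop :=
  [/\ forall z, @bounded_op R (subsp F1) (subsp F2) (Phi z),
      @analytic_op (subsp F1) (subsp F2) Phi
    & forall f, @carrier R (Hp 1 F1) f -> @carrier R (Hp m F2) (mulop Phi f)].

End FunctionSpaces.

Section OperatorTheory.
Variables (R : realType) (H : hilbertType R).
Implicit Types A : H -> H.

Definition bounded A : Prop := @bounded_op R (whole H) (whole H) A.

(* For bounded [A] the adjoint exists and is unique (Riesz). *)
Definition adj A : H -> H :=
  xget 0 [set A' : H -> H | forall x y, dot (A x) y = dot x (A' y)].

Definition psd A : Prop := forall x, 0 <= dot (A x) x.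

(* For bounded positive [A] the positive square root exists and is unique. *)
Definition opsqrt A : H -> H :=
  xget 0 [set S : H -> H | [/\ bounded S, psd S & S \o S = A]].

Definition opinv A : H -> H :=
  xget 0 [set A' : H -> H | cancel A A' /\ cancel A' A].

Section Tuple.
Variables (n : nat) (T : 'I_n -> H -> H).

Definition commuting_tuple : Prop :=
  (forall i, bounded (T i)) /\ (forall i j, T i \o T j = T j \o T i).

Definition sigma (X : H -> H) : H -> H :=
  fun h => \sum_i T i (X (adj (T i) h)).

(* (I - sigma_T)^p (I_H) *)
Definition defect_pow (p : nat) : H -> H :=
  iter p (fun X h => X h - sigma X h) id.

Definition hypercontraction (m : nat) : Prop :=
  [/\ commuting_tuple, psd (defect_pow 1) & psd (defect_pow m)].

Definition pure : Prop :=
  forall h, (fun p => iter p sigma id h) @ \oo --> (0 : H).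

Definition defect (m : nat) : H -> H := opsqrt (defect_pow m).

Definition defect_space (m : nat) : set H := closure (range (defect m)).

(* T_1^{*k_1} \o ... \o T_n^{*k_n} *)
Definition adj_pow (k : mindex n) : H -> H :=
  \big[(fun f g : H -> H => f \o g)/id]_(i < n) iter (k i) (adj (T i)).

Definition row_adj (h : H) : 'I_n -> H := fun i => adj (T i) h.

Definition Cmap (m : nat) (h : H) : mindex n -> H :=
  fun k => (Num.sqrt (rho R m.-1 k))%:C *: defect m (adj_pow k h).

(* The row operator Z : H^n -> H. *)
Definition Zrow (z : cball n R) (u : 'I_n -> H) : H := \sum_i coor z i *: u i.

(* D_{m,T^*} (I - Z T^* )^{-m} *)
Definition defect_resolvent (m : nat) (z : cball n R) (h : H) : H :=
  defect m (iter m (opinv (fun x => x - Zrow z (row_adj x))) h).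

Definition Pi_dil (m : nat) (h : H) : cball n R -> H :=
  fun z => defect_resolvent m z h.

Definition canonical_subspace (m : nat) : set (cball n R -> H) :=
  @orthominus R (Hp n m (defect_space m)) (range (Pi_dil m)).

Section Triple.
Variables (m : nat) (E : hilbertType R).
Variables (B : E -> 'I_n -> H) (D : E -> mindex n -> H).

Definition block_op (u : H * E) : ('I_n -> H) * (mindex n -> H) :=
  (row_adj u.1 + B u.2, Cmap m u.1 + D u.2).

Definition characteristic_triple : Prop :=
  [/\ @bounded_op R (whole E) (hpow n (whole H)) B,
      @bounded_op R (whole E) (l2 n (defect_space m)) D
    & @unitary_op R (dsum (whole H) (whole E))
        (dsum (hpow n (whole H)) (l2 n (defect_space m))) block_op].

Definition Phi_char (z : cball n R) (eta : E) : H :=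
  summability.sum (fun k =>
    ((Num.sqrt (rho R m.-1 k))%:C * monom z k) *: D eta k)
  + defect_resolvent m z (Zrow z (B eta)).

End Triple.
End Tuple.
End OperatorTheory.

(* Main.v *)
(* Let U(x, e) = (T^* x + B e, C x + D e) be the unitary of the characteristic
   triple. For h in H and f = \sum_l f_l z^l in H^2_n(E), define states by
   x_0 = h and x_k = \sum_i (U(x_{k-e_i}, f_{k-e_i}))_i, and let G_l be the
   l^2-component of U(x_l, f_l). Since \rho_1(k) = \sum_i \rho_1(k - e_i), unitarity
   and Cauchy-Schwarz give the energy estimate
   \sum_l |G_l|^2 / \rho_1(l) <= |h|^2 + |f|^2. As \rho_m is the convolution of
   \rho_1 and \rho_{m-1}, the sequence
   g_K = \sum_{l <= K} sqrt(\rho_{m-1}(K-l)) (G_l)_{K-l} satisfies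
   |g|^2_{H_m} <= |h|^2 + |f|^2, and summing the recursion in the ball shows
   \sum_K g_K z^K = (\Pi_m h + \Phi_T f)(z). Running the recursion
   backwards with U^{-1}, from a suitable lift of g, represents every g in H_m
   in this way without increasing the norm. So (h, f) |-> \Pi_m h + \Phi_T f is a
   coisometry; as \Pi_m is isometric by purity, the two blocks have orthogonal
   ranges and \Phi_T is a partial isometry onto the complement of \Pi_m H.
   Unitarity of U already makes the maps T_i^* and D_{m,T^*} linear and bounded,
   so neither the Riesz theorem nor operator square roots are needed. *)

Require Import Defs.
From mathcomp Require Import all_boot all_order all_algebra.
From mathcomp Require Import finmap complex.
From mathcomp Require Import all_classical all_reals all_analysis.
From mathcomp Require Import ring lra.
From mathcomp Require summability.

Set Implicit Arguments.
Unset Strict Implicit.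
Unset Printing Implicit Defensive.

Import Order.TTheory GRing.Theory Num.Theory.
Import numFieldNormedType.Exports.

Local Open Scope classical_set_scope.
Local Open Scope complex_scope.
Local Open Scope ring_scope.

Arguments Defs.rho : simpl never.
#[local] Existing Instance summability.totally_filter.

(** * Multi-indices and the coefficients rho *)

(** A backward step finds the state at l from the states at the higher indices l + e_i, so the
    recursion has a starting point only when all data vanish above some degree. Hence g is truncated
    first. The energy identity is exact, not just an inequality, because the backward solution is
    the equality case of the Cauchy-Schwarz estimates used forwards; applied to differences of
    truncations, it makes the solutions converge. Two further obstacles shape the text. The inner
    product of H_m is read off coefficients picked by choice, so uniqueness of power series
    coefficients must come first; in several variables it is reduced to one variable along a curve
    that isolates a single coefficient. And the spaces are plain sets of functions, so the closing
    Hilbert space argument avoids adjoints: the relation V^* V u = u, for a contraction V preserving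
    the norm of u, is obtained by varying the norm inequality at u. *)

Section MultiIndexCombinatorics.
Variable n : nat.
Local Notation mi := (mindex n).

Definition mi0 : mi := [ffun=> 0%N].
Definition munit (i : 'I_n) : mi := [ffun j => (j == i) : nat].
Definition madd (k l : mi) : mi := [ffun i => (k i + l i)%N].
Definition msub (k l : mi) : mi := [ffun i => (k i - l i)%N].
Definition mleq (k l : mi) : bool := [forall i, (k i <= l i)%N].

(** These truncations by degree are cofinal among the finite sets of multi-indices, so unordered
    sums can be evaluated as limits along d. *)
Definition mle (d : nat) : seq mi :=
  [seq k <- undup (codom (fun t : {ffun 'I_n -> 'I_d.+1} =>
     [ffun i => val (t i)] : mi)) | (mdegree k <= d)%N].

Lemma uniq_mle d : uniq (mle d).
Proof. exact: filter_uniq (undup_uniq _). Qed.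

Lemma le_mdegree (k : mi) i : (k i <= mdegree k)%N.
Proof. by rewrite /mdegree (bigD1 i) //= leq_addr. Qed.

Lemma mem_mle d k : (k \in mle d) = (mdegree k <= d)%N.
Proof.
rewrite mem_filter; have [kd|//] := leqP (mdegree k) d; rewrite mem_undup /=.
apply/codomP; exists [ffun i => inord (k i)].
apply/ffunP => i; rewrite !ffunE /= inordK // ltnS.
exact: leq_trans (le_mdegree k i) kd.
Qed.

Lemma mdegree0 : mdegree mi0 = 0%N.
Proof. by rewrite /mdegree big1 // => i _; rewrite ffunE. Qed.

Lemma mdegree_unit i : mdegree (munit i) = 1%N.
Proof.
rewrite /mdegree (bigD1 i) //= ffunE eqxx big1 // => j /negPf ji.
by rewrite ffunE ji.
Qed.

Lemma mdegreeD k l : mdegree (madd k l) = (mdegree k + mdegree l)%N.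
Proof. by rewrite /mdegree -big_split; apply: eq_bigr => i _; rewrite ffunE. Qed.

Lemma mdegree_eq0 k : (mdegree k == 0%N) = (k == mi0).
Proof.
apply/idP/eqP => [|->]; last by rewrite mdegree0.
move=> /eqP k0; apply/ffunP => i; rewrite ffunE.
by apply/eqP; rewrite -leqn0 -k0 le_mdegree.
Qed.

Lemma maddC k l : madd k l = madd l k.
Proof. by apply/ffunP => i; rewrite !ffunE addnC. Qed.

Lemma maddA k l p : madd k (madd l p) = madd (madd k l) p.
Proof. by apply/ffunP => i; rewrite !ffunE addnA. Qed.

Lemma madd0 k : madd k mi0 = k.
Proof. by apply/ffunP => i; rewrite !ffunE addn0. Qed.

Lemma mleqP (k l : mi) : reflect (forall i, k i <= l i)%N (mleq k l).
Proof. exact: forallP. Qed.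

Lemma mleq_addr k l : mleq k (madd k l).
Proof. by apply/mleqP => i; rewrite ffunE leq_addr. Qed.

Lemma mleq0 k : mleq mi0 k.
Proof. by apply/mleqP => i; rewrite ffunE. Qed.

Lemma maddK k l : msub (madd k l) k = l.
Proof. by apply/ffunP => i; rewrite !ffunE addKn. Qed.

Lemma msubK k l : mleq k l -> madd k (msub l k) = l.
Proof. by move=> /mleqP kl; apply/ffunP => i; rewrite !ffunE subnKC. Qed.

Lemma mleq_degree k l : mleq k l -> (mdegree k <= mdegree l)%N.
Proof. by move=> /msubK <-; rewrite mdegreeD leq_addr. Qed.

Lemma mdegreeB k l : mleq k l -> mdegree (msub l k) = (mdegree l - mdegree k)%N.
Proof. by move=> /msubK {2}<-; rewrite mdegreeD addKn. Qed.

Lemma mleq_unit i k : mleq (munit i) k = (0 < k i)%N.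
Proof.
apply/mleqP/idP => [/(_ i)|ki j]; first by rewrite ffunE eqxx.
by rewrite ffunE; case: eqP => // ->.
Qed.

Lemma mindex_unit_ind (P : mi -> Prop) :
  P mi0 -> (forall k i, P k -> P (madd (munit i) k)) -> forall k, P k.
Proof.
move=> P0 PS k; have [d] := ubnP (mdegree k); elim: d k => // d IH k kd.
have [/forallP k0|k0] := boolP [forall i, k i == 0%N].
  suff -> : k = mi0 by [].
  by apply/ffunP => i; rewrite ffunE; apply/eqP.
have [i ik] : exists i, mleq (munit i) k.
  apply: contrapT => kN; case/negP: k0; apply/forallP => i.
  rewrite -leqn0 leqNgt -mleq_unit; apply/negP => ik; apply: kN; by exists i.
rewrite -(msubK ik); apply/PS/IH; rewrite mdegreeB // mdegree_unit.
move: kd (mleq_degree ik); rewrite mdegree_unit.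
by case: (mdegree k) => // j; rewrite subn1 ltnS.
Qed.

Lemma big_mle_shift (V : nmodType) d l (G : mi -> V) : (mdegree l <= d)%N ->
  \sum_(k <- mle d | mleq l k) G (msub k l)
    = \sum_(k <- mle (d - mdegree l)) G k.
Proof.
move=> ld; rewrite -big_filter.
rewrite (perm_big [seq madd l k | k <- mle (d - mdegree l)]).
  by rewrite big_map; apply: eq_bigr => k _; rewrite maddK.
apply: uniq_perm; first exact: filter_uniq (uniq_mle _).
  rewrite map_inj_uniq ?uniq_mle // => k k' e.
  by rewrite -(maddK l k) e maddK.
move=> k; rewrite mem_filter mem_mle; apply/andP/mapP => [[lk kd]|[k' + ->]].
  by exists (msub k l); rewrite ?msubK // mem_mle mdegreeB // leq_sub2r.
by rewrite mem_mle mleq_addr mdegreeD -leq_subRL.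
Qed.

(** Both sides range over the pairs (i, k) with k of degree at most d; on the left such a pair sits
    at the index k + e_i. This resums one step of a recursion over lower degrees. *)
Lemma big_mle_unit (V : nmodType) d (F : 'I_n -> mi -> V) :
  \sum_(k <- mle d.+1) \sum_(i | mleq (munit i) k) F i (msub k (munit i))
    = \sum_(k <- mle d) \sum_i F i k.
Proof.
under eq_bigr do rewrite big_mkcond.
rewrite exchange_big /= [RHS]exchange_big; apply: eq_bigr => i _.
by rewrite -big_mkcond big_mle_shift mdegree_unit // subn1.
Qed.

Lemma big_mle0 (V : nmodType) d (v : V) :
  \sum_(k <- mle d) (if k == mi0 then v else 0) = v.
Proof.
rewrite -big_mkcond /= -big_filter filter_pred1_uniq; last 2 first.
- exact: uniq_mle.
- by rewrite mem_mle mdegree0.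
by rewrite big_seq1.
Qed.

Definition below (K : mi) : seq mi := [seq l <- mle (mdegree K) | mleq l K].

Lemma mem_below l K : (l \in below K) = mleq l K.
Proof.
by rewrite /below mem_filter mem_mle; case: (boolP (mleq l K)) => // /mleq_degree ->.
Qed.

Lemma big_below (V : nmodType) d (F : mi -> V) K : (mdegree K <= d)%N ->
  \sum_(l <- below K) F l = \sum_(l <- mle d | mleq l K) F l.
Proof.
move=> Kd; rewrite -[RHS]big_filter; apply: perm_big; apply: uniq_perm.
- exact: filter_uniq (uniq_mle _).
- exact: filter_uniq (uniq_mle _).
move=> l; rewrite mem_below mem_filter mem_mle.
case: (boolP (mleq l K)) => //= /mleq_degree lK; exact/esym/(leq_trans lK).
Qed.

(** Pairs (l, k) of total degree at most d, grouped on the left by their sum K and on the right by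
    l. *)
Lemma big_mle_conv (V : nmodType) d (F : mi -> mi -> V) :
  \sum_(K <- mle d) \sum_(l <- below K) F l (msub K l)
    = \sum_(l <- mle d) \sum_(k <- mle (d - mdegree l)) F l k.
Proof.
rewrite (eq_big_seq (fun K => \sum_(l <- mle d | mleq l K) F l (msub K l))).
  under eq_bigr do rewrite big_mkcond.
  rewrite exchange_big /=; apply: eq_big_seq => l; rewrite mem_mle => ld.
  by rewrite -big_mkcond big_mle_shift.
by move=> K; rewrite mem_mle => Kd; apply: big_below.
Qed.

Lemma sub_mle d e : (d <= e)%N -> {subset mle d <= mle e}.
Proof. by move=> de k; rewrite !mem_mle => /leq_trans; apply. Qed.

End MultiIndexCombinatorics.

(** * The weights rho and geometric series bounds *)

Section Rho.
Variables (R : realType) (n : nat).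
Local Notation mi := (mindex n).
Local Notation rho := (@rho n R).

Lemma mfact_gt0 (k : mi) : (0 < mfact k)%N.
Proof. by rewrite prodn_gt0 // => i; rewrite fact_gt0. Qed.

Lemma rho_gt0 p (k : mi) : 0 < rho p.+1 k.
Proof. by rewrite divr_gt0 ?ltr0n ?muln_gt0 ?fact_gt0 ?mfact_gt0. Qed.

Lemma rho_ge0 p (k : mi) : 0 <= rho p k.
Proof. by case: p => [|p]; [exact: ler0n|exact/ltW/rho_gt0]. Qed.

Lemma mfact0 : mfact (mi0 n) = 1%N.
Proof. by rewrite /mfact big1 // => i _; rewrite ffunE. Qed.

Lemma rho_mi0 p : rho p (mi0 n) = 1.
Proof.
case: p => [|p]; first by rewrite /rho eqxx.
by rewrite /Defs.rho mdegree0 mfact0 addn0 mul1n divff // pnatr_eq0 -lt0n fact_gt0.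
Qed.

Lemma rho0E (k : mi) : rho 0 k = (k == mi0 n)%:R.
Proof. by []. Qed.

Lemma mfact_unit i (k : mi) : mfact (madd (munit i) k) = ((k i).+1 * mfact k)%N.
Proof.
rewrite /mfact (bigD1 i) //= [in RHS](bigD1 i) //= !ffunE eqxx add1n factS mulnA.
by congr muln; apply: eq_bigr => j /negPf ji; rewrite !ffunE ji.
Qed.

Lemma rho_unit p i (K : mi) : mleq (munit i) K ->
  rho p.+1 (msub K (munit i))
    = (K i)%:R * ((p + mdegree K).-1`!%:R / (mfact K * p`!)%:R).
Proof.
move=> iK; have := msubK iK; move: (msub K _) => k <-.
rewrite mdegreeD mdegree_unit mfact_unit !ffunE eqxx add1n /Defs.rho /=.
rewrite add1n addnS /= !natrM; field.
by rewrite nat1r !pnatr_eq0 -!lt0n mfact_gt0 fact_gt0.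
Qed.

(** Coefficientwise this is (1 - x)^{-(p+1)} (1 - x) = (1 - x)^{-p} with x = <z, w>. By [rho_unit]
    the summands share a factor independent of i, and the remaining factors K i add up to the
    degree. *)
Lemma rho_pascal p (K : mi) :
  rho p.+1 K
    = rho p K + \sum_(i | mleq (munit i) K) rho p.+1 (msub K (munit i)).
Proof.
rewrite (eq_bigr _ (fun i => @rho_unit p i K)) big_mkcond /=.
rewrite (eq_bigr (fun i => (K i)%:R * ((p + mdegree K).-1`!%:R / (mfact K * p`!)%:R))); last first.
  by move=> i _; rewrite mleq_unit; case: posnP => // ->; rewrite mul0r.
rewrite -mulr_suml -natr_sum -/(mdegree K).
have M0 : (mfact K)%:R != 0 :> R by rewrite pnatr_eq0 -lt0n mfact_gt0.
case: p => [|p].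
  rewrite rho0E -mdegree_eq0 /Defs.rho /= !muln1 ?add0n.
  case: (mdegree K) (mdegree_eq0 K) => [|d] /=; last first.
    by rewrite add0r mulrA -natrM -factS.
  by move/esym/eqP ->; rewrite mul0r addr0 mfact0 divr1.
have F0 : (p`!)%:R != 0 :> R by rewrite pnatr_eq0 -lt0n fact_gt0.
rewrite /Defs.rho /= !addSn /= !factS !natrM.
have S0 : (p.+1)%:R != 0 :> R by rewrite pnatr_eq0.
by rewrite -addSn natrD; field; rewrite M0 F0 nat1r S0.
Qed.

(** Coefficientwise, (1 - x)^{-(p+1)} = (1 - x)^{-1} (1 - x)^{-p}. Applying [rho_pascal] to both
    sides leaves the same relation at the indices K - e_i, which have smaller degree. *)
Lemma rho_conv p (K : mi) :
  rho p.+1 K = \sum_(l <- below K) rho 1 l * rho p (msub K l).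
Proof.
have [d] := ubnP (mdegree K); elim: d K => // d IH K; rewrite ltnS => Kd.
rewrite (@big_below _ _ d) //.
under eq_bigr do rewrite rho_pascal mulrDl.
rewrite big_split [LHS]rho_pascal; congr (_ + _).
  under eq_bigr do rewrite rho0E mulr_natl mulrb.
  rewrite -big_mkcondr /= (eq_bigl (eq_op^~ (mi0 n))); last first.
    by move=> l /=; case: eqP => [->|]; rewrite ?mleq0 ?andbF.
  rewrite -big_filter filter_pred1_uniq ?uniq_mle ?mem_mle ?mdegree0 //.
  by rewrite big_seq1; congr Defs.rho; apply/ffunP => i; rewrite !ffunE subn0.
case: d IH Kd => [|d] IH Kd.
  have /eqP -> : K == mi0 n by rewrite -mdegree_eq0 -leqn0.
  rewrite [LHS]big1 => [|i]; last by rewrite mleq_unit ffunE.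
  rewrite big1 // => l lK.
  rewrite big1 ?mul0r // => i; rewrite mleq_unit.
  by move/mleqP: lK => /(_ i); rewrite ffunE leqn0 => /eqP ->.
(* The guards discard the pairs for which the truncated subtraction in [msub] is not a true
   difference, since [big_mle_unit] sums over all i and l. *)
pose F i l := if mleq l (msub K (munit i)) && mleq (munit i) K
  then rho 1 l * rho p (msub (msub K (munit i)) l) else 0.
transitivity (\sum_(k <- mle n d.+1)
  \sum_(i | mleq (munit i) k) F i (msub k (munit i))).
  rewrite big_mle_unit exchange_big /= [LHS]big_mkcond; apply: eq_bigr => i _.
  rewrite /F; case: (boolP (mleq _ K)) => iK; last by rewrite big1 // => ? _; rewrite andbF.
  have Ki : (mdegree (msub K (munit i)) <= d)%N.
    by rewrite mdegreeB // mdegree_unit leq_subLR add1n.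
  rewrite IH ?ltnS // (big_below _ Ki) big_mkcond.
  by apply: eq_bigr => l _; rewrite andbT.
rewrite [RHS]big_mkcond; apply: eq_bigr => l _.
case: ifPn => lK.
  rewrite mulr_suml; apply: eq_bigr => i il; rewrite /F.
  have e : mleq (msub l (munit i)) (msub K (munit i)).
    by apply/mleqP => j; rewrite !ffunE leq_sub2r //; move/mleqP: lK.
  have iK : mleq (munit i) K.
    by apply/mleqP => j; apply: leq_trans (mleqP _ _ lK j); move/mleqP: il.
  rewrite e iK /=; congr (_ * Defs.rho _ _ _).
  apply/ffunP => j; rewrite !ffunE.
  move/mleqP: il => /(_ j); move/mleqP: iK => /(_ j); rewrite !ffunE => eK el.
  by rewrite subnBA // subnK.
rewrite big1 // => i il; rewrite /F; case: ifP => // /andP[e iK].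
case/negP: lK; rewrite -(msubK il) -(msubK iK).
apply/mleqP => j; move/mleqP: e => /(_ j); rewrite !ffunE => e.
by rewrite leq_add2l.
Qed.

(** [phi] is any additive function of the weight, because the relation serves both real sums and the
    vector-valued series of the resolvent. *)
Lemma big_rho_pascal (V : nmodType) d p (phi : R -> mi -> V) :
  (forall k, {morph phi^~ k : a b / a + b}) -> (forall k, phi 0 k = 0) ->
  \sum_(k <- mle n d.+1) phi (rho p.+1 k) k
    = \sum_(k <- mle n d.+1) phi (rho p k) k
      + \sum_(k <- mle n d) \sum_i phi (rho p.+1 k) (madd (munit i) k).
Proof.
move=> phiD phi0; rewrite -big_mle_unit -big_split; apply: eq_bigr => K _ /=.
rewrite [in LHS]rho_pascal phiD (big_morph _ (phiD K) (phi0 K)).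
by congr (_ + _); apply: eq_bigr => i /msubK iK; rewrite iK.
Qed.

(** One application of the weighted row contracts s by r, so the sum is dominated by the expansion
    of (1 - r)^{-p}. It is used for the adjoints acting on H, with t_i = |z_i|, and for the trivial
    action on a point, with t_i = |z_i|^2. *)
Lemma big_rho_bound (X : Type) (s : X -> R) (a : 'I_n -> X -> X)
    (apow : mi -> X -> X) (t : 'I_n -> R) (r : R) :
  (forall x, 0 <= s x) -> (forall x, apow (mi0 n) x = x) ->
  (forall k i x, apow (madd (munit i) k) x = apow k (a i x)) ->
  (forall i, 0 <= t i) -> 0 <= r < 1 ->
  (forall x, \sum_i t i * s (a i x) <= r * s x) ->
  forall p d x,
    \sum_(k <- mle n d) rho p k * ((\prod_i t i ^+ k i) * s (apow k x))
      <= (1 - r)^-1 ^+ p * s x.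
Proof.
move=> s0 a0 aS t0 /andP[r0 r1] sa p; elim: p => [|p IHp] d x.
  under eq_bigr do rewrite rho0E mulr_natl mulrb.
  rewrite -big_mkcond -big_filter filter_pred1_uniq ?uniq_mle ?mem_mle ?mdegree0 //.
  rewrite big_seq1 a0 big1 ?mul1r ?expr0 ?mul1r // => i _.
  by rewrite ffunE expr0.
have r1' : 0 < 1 - r by rewrite subr_gt0.
elim: d x => [|d IHd] x.
  rewrite (eq_big_seq (fun k => rho p k * ((\prod_i t i ^+ k i) * s (apow k x)))).
    apply: (le_trans (IHp 0%N x)); rewrite ler_wpM2r // exprS ler_peMl //.
      by rewrite exprn_ge0 // invr_ge0 ltW.
    by rewrite invf_ge1 // lerBlDr lerDl.
  move=> k; rewrite mem_mle leqn0 mdegree_eq0 => /eqP ->.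
  by rewrite !rho_mi0.
rewrite (@big_rho_pascal _ d p (fun c k => c * ((\prod_i t i ^+ k i) * s (apow k x))));
  [|by move=> k u v; rewrite mulrDl|by move=> k; rewrite mul0r].
apply: (@le_trans _ _ ((1 - r)^-1 ^+ p * s x + r * ((1 - r)^-1 ^+ p.+1 * s x))).
  apply: lerD; first exact: IHp.
  rewrite exchange_big /=.
  apply: (@le_trans _ _ (\sum_i t i * ((1 - r)^-1 ^+ p.+1 * s (a i x)))).
    apply: ler_sum => i _.
    apply: (@le_trans _ _ (t i * \sum_(k <- mle n d)
        rho p.+1 k * ((\prod_i t i ^+ k i) * s (apow k (a i x))))).
      rewrite mulr_sumr le_eqVlt; apply/orP; left; apply/eqP; apply: eq_bigr => k _.
      rewrite aS (bigD1 i) //= !ffunE eqxx [in RHS](bigD1 i) //= exprS.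
      rewrite (eq_bigr (fun j => t j ^+ k j)) ?add1n; last first.
        by move=> j /negPf ji; rewrite !ffunE ji.
      by ring.
    exact: ler_wpM2l (IHd _).
  have -> : \sum_i t i * ((1 - r)^-1 ^+ p.+1 * s (a i x))
      = (1 - r)^-1 ^+ p.+1 * \sum_i t i * s (a i x).
    by rewrite mulr_sumr; apply: eq_bigr => i _; rewrite mulrCA.
  by rewrite [leRHS]mulrCA ler_wpM2l // exprn_ge0 // invr_ge0 ltW.
(* With c = 1 / (1 - r) this is the identity c^p + r c^(p+1) = c^(p+1). *)
rewrite le_eqVlt; apply/orP; left; apply/eqP.
by rewrite exprS; field; rewrite gt_eqF.
Qed.

End Rho.

(** * Unordered sums over multi-indices *)

Lemma sum_mul_le_sqr (R : realFieldType) (I : Type) (r : seq I) (P : pred I)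
    (a b : I -> R) :
  (\sum_(i <- r | P i) a i * b i) ^+ 2
    <= (\sum_(i <- r | P i) a i ^+ 2) * (\sum_(i <- r | P i) b i ^+ 2).
Proof.
set A := \sum_(i <- r | P i) a i ^+ 2; set B := \sum_(i <- r | P i) b i ^+ 2.
set S := \sum_(i <- r | P i) a i * b i.
have quad t : 0 <= A - 2 * t * S + t ^+ 2 * B.
  rewrite (_ : _ + _ = \sum_(i <- r | P i) (a i - t * b i) ^+ 2).
    by apply: sumr_ge0 => i _; apply: sqr_ge0.
  rewrite /A /S /B !mulr_sumr -sumrB -big_split.
  by apply: eq_bigr => i _ /=; ring.
have B0 : 0 <= B by apply: sumr_ge0 => i _; apply: sqr_ge0.
have [B00|Bn0] := eqVneq B 0.
  have [-> |S0] := eqVneq S 0; first by rewrite expr0n /= B00 mulr0.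
  (* For B = 0 the expression is affine in t, and this t gives it the value -1. *)
  have := quad ((A + 1) / (2 * S)); rewrite B00 mulr0 addr0.
  rewrite (_ : A - _ = -1) ?ler0N1 //.
  by field.
have Bp : 0 < B by rewrite lt_neqAle eq_sym Bn0.
have := quad (S / B); rewrite (_ : _ + _ = (A * B - S ^+ 2) / B); last by field.
by rewrite pmulr_lge0 ?invr_gt0 // subr_ge0.
Qed.

Section RealNorm.
Variable R : realType.

(* Norms of a [normedModType R[i]] are themselves complex numbers; [nm] and
   [rabs] are their real values. *)
Definition nm (V : normedModType R[i]) (x : V) : R := complex.Re `|x|.
Definition rabs (a : R[i]) : R := complex.Re `|a|.

Lemma rcD (a b : R) : (a + b)%:C = a%:C + b%:C.
Proof. exact: rmorphD. Qed.

Lemma rcB (a b : R) : (a - b)%:C = a%:C - b%:C.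
Proof. exact: rmorphB. Qed.

Lemma rcM (a b : R) : (a * b)%:C = a%:C * b%:C.
Proof. exact: rmorphM. Qed.

Lemma rcX (a : R) d : (a ^+ d)%:C = a%:C ^+ d.
Proof. exact: rmorphXn. Qed.

Lemma rcV (a : R) : (a^-1)%:C = a%:C^-1.
Proof. exact: fmorphV. Qed.

Lemma rc_sum (I : Type) (r : seq I) (P : pred I) (F : I -> R) :
  (\sum_(i <- r | P i) F i)%:C = \sum_(i <- r | P i) (F i)%:C.
Proof. exact: rmorph_sum. Qed.

Lemma rabsE (a : R[i]) : `|a| = (rabs a)%:C.
Proof. by rewrite RRe_real // normr_real. Qed.

Section Norm.
Variable V : normedModType R[i].
Implicit Types x y : V.

Lemma nmE x : `|x| = (nm x)%:C.
Proof. by rewrite RRe_real // normr_real. Qed.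

Lemma nm_ge0 x : 0 <= nm x.
Proof. by rewrite -lecR -nmE normr_ge0. Qed.

Lemma ler_nmD x y : nm (x + y) <= nm x + nm y.
Proof. by rewrite -lecR rcD -!nmE ler_normD. Qed.

Lemma nmZ a x : nm (a *: x) = rabs a * nm x.
Proof. by apply: (@complexI R); rewrite rcM -!nmE -rabsE normrZ. Qed.

Lemma nmN x : nm (- x) = nm x.
Proof. by rewrite /nm normrN. Qed.

Lemma nm0 : nm (0 : V) = 0.
Proof. by rewrite /nm normr0. Qed.

Lemma nm_eq0 x : (nm x == 0) = (x == 0).
Proof. by rewrite -(inj_eq (@complexI R)) -nmE normr_eq0. Qed.

Lemma ler_nm_sum (I : Type) (r : seq I) (P : pred I) (F : I -> V) :
  nm (\sum_(i <- r | P i) F i) <= \sum_(i <- r | P i) nm (F i).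
Proof.
apply: (big_ind2 (fun v (c : R) => nm v <= c)) => //; first by rewrite nm0.
by move=> u a v b ua vb; apply: le_trans (ler_nmD _ _) (lerD ua vb).
Qed.

Lemma nm_distC x y : nm (x - y) = nm (y - x).
Proof. by rewrite -nmN opprB. Qed.

Lemma nm_cvgP (T : Type) (F : set_system T) (FF : Filter F) (f : T -> V) s :
  f @ F --> s <-> forall e : R, 0 < e -> \forall t \near F, nm (s - f t) < e.
Proof.
split=> [/cvgrPdist_lt fs e e0|fs].
  have /fs : 0 < e%:C :> R[i] by rewrite (ltcR 0).
  by apply: filterS => t; rewrite nmE ltcR.
apply/cvgrPdist_lt => e e0.
have eE : e = (complex.Re e)%:C by rewrite RRe_real // ger0_real // ltW.
have /fs : 0 < complex.Re e by rewrite -ltcR -eE.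
by apply: filterS => t; rewrite nmE eE ltcR.
Qed.

Lemma nm_le_lim (T : Type) (F : set_system T) (FF : ProperFilter F)
    (f : T -> V) s (c : R) :
  f @ F --> s -> (\forall t \near F, nm (f t) <= c) -> nm s <= c.
Proof.
move=> /nm_cvgP fs fc; apply/ler_addgt0Pr => e e0.
have [t [te tc]] := filter_ex (filterI (fs _ e0) fc).
rewrite -(subrK (f t) s) (le_trans (ler_nmD _ _)) // addrC lerD //.
exact: ltW.
Qed.

End Norm.

Lemma ler_rabsD (a b : R[i]) : rabs (a + b) <= rabs a + rabs b.
Proof. exact: (@ler_nmD R[i]^o). Qed.

Lemma rabsM (a b : R[i]) : rabs (a * b) = rabs a * rabs b.
Proof. exact: (@nmZ R[i]^o). Qed.

Lemma rabs_ge0 a : 0 <= rabs a.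
Proof. exact: (@nm_ge0 R[i]^o). Qed.

Lemma rabsr (a : R) : rabs a%:C = `|a|.
Proof.
apply: (@complexI R); rewrite -rabsE normc_def /=.
by rewrite expr0n addr0 sqrtr_sqr.
Qed.

Lemma rabs1 : rabs (1 : R[i]) = 1.
Proof. by rewrite -[RHS]normr1 -rabsr. Qed.

Lemma rabs_prod (I : Type) (r : seq I) (P : pred I) (F : I -> R[i]) :
  rabs (\prod_(i <- r | P i) F i) = \prod_(i <- r | P i) rabs (F i).
Proof.
exact: (big_morph rabs rabsM rabs1).
Qed.

Lemma rabsX a d : rabs (a ^+ d) = rabs a ^+ d.
Proof.
by elim: d => [|d IH]; rewrite ?expr0 ?rabs1 // !exprS rabsM IH.
Qed.

End RealNorm.

Lemma ler_big_subset (R : numDomainType) (I : eqType) (s s' : seq I) (w : I -> R) :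
  uniq s -> uniq s' -> {subset s <= s'} -> (forall i, 0 <= w i) ->
  \sum_(i <- s) w i <= \sum_(i <- s') w i.
Proof.
move=> us us' ss' w0; rewrite [leRHS](bigID (mem s)) /=.
rewrite -[X in _ <= X + _]big_filter [X in _ <= X + _](perm_big s) /=.
  by rewrite lerDl; apply: sumr_ge0.
apply: uniq_perm => //; first exact: filter_uniq.
by move=> i; rewrite mem_filter; case: (boolP (i \in s)) => //= /ss'.
Qed.


Section HasSum.
Variables (R : realType) (n : nat).
Local Notation mi := (mindex n).
Local Notation mle := (@mle n).
Implicit Types (V : normedModType R[i]) (J : {fset mi}).

Lemma partial_sumE V (x : mi -> V) J :
  summability.partial_sum x J = \sum_(k <- J) x k.
Proof. exact/esym/(big_seq_fsetE _ J predT). Qed.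

Lemma fset_sub_mle J : exists d, {subset J <= mle d}.
Proof.
exists (\max_(k <- J) mdegree k)%N => k kJ.
by rewrite mem_mle (big_rem k kJ) /= leq_maxl.
Qed.

Lemma big_fset_mle (W : nmodType) d (F : mi -> W) :
  \sum_(k <- [fset k in mle d]%fset) F k = \sum_(k <- mle d) F k.
Proof.
apply: perm_big; apply: uniq_perm; rewrite ?fset_uniq ?uniq_mle // => k.
by rewrite inE.
Qed.

Lemma has_sumP V (x : mi -> V) s :
  has_sum x s <-> forall e : R, 0 < e -> exists d, forall J : {fset mi},
    {subset mle d <= J} -> nm (s - \sum_(k <- J) x k) < e.
Proof.
split=> [/nm_cvgP xs e /xs[A _ Ae]|xs].
  have [d Ad] := fset_sub_mle A; exists d => J dJ; rewrite -partial_sumE.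
  by apply: Ae => /=; apply/fsubsetP => k /Ad /dJ.
apply/nm_cvgP => e /xs[d de]; exists [fset k in mle d]%fset => // J /= dJ.
rewrite partial_sumE; apply: de => k kd; apply: (fsubsetP dJ).
by rewrite inE.
Qed.

Lemma has_sum_cvg_mle V (x : mi -> V) s :
  has_sum x s -> (fun d => \sum_(k <- mle d) x k) @ \oo --> s.
Proof.
move=> /has_sumP xs; apply/nm_cvgP => e /xs[d de].
exists d => // d' /= dd'; rewrite -big_fset_mle; apply: de => k /(sub_mle dd').
by rewrite inE.
Qed.

Lemma has_sum_unique V (x : mi -> V) s s' :
  has_sum x s -> has_sum x s' -> s = s'.
Proof. exact: (cvg_unique (@norm_hausdorff _ V)). Qed.

Lemma has_sum_lim V (x : mi -> V) s : has_sum x s -> summability.sum x = s.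
Proof. exact: (cvg_lim (@norm_hausdorff _ V)). Qed.

Lemma has_sumD V (x y : mi -> V) s t :
  has_sum x s -> has_sum y t -> has_sum (fun k => x k + y k) (s + t).
Proof.
move=> xs yt; rewrite /has_sum.
rewrite (_ : summability.partial_sum _
  = summability.partial_sum x + summability.partial_sum y); first exact: cvgD.
by apply/funext => J; rewrite [RHS]/GRing.add /= !partial_sumE big_split.
Qed.

Lemma has_sumZ V (x : mi -> V) s (c : R[i]) :
  has_sum x s -> has_sum (fun k => c *: x k) (c *: s).
Proof.
move=> xs; rewrite /has_sum.
rewrite (_ : summability.partial_sum _
  = fun J => c *: summability.partial_sum x J); first exact: cvgZr.
by apply/funext => J; rewrite !partial_sumE scaler_sumr.
Qed.

(** For a nonnegative family with bounded truncations this supremum is the full sum, since every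
    finite set of indices lies in some truncation. *)
Definition msup (w : mi -> R) : R := sup (range (fun d => \sum_(k <- mle d) w k)).

Section Msup.
Variables (w : mi -> R) (C : R).
Hypotheses (w0 : forall k, 0 <= w k) (wC : forall d, \sum_(k <- mle d) w k <= C).

Lemma ler_msup d : \sum_(k <- mle d) w k <= msup w.
Proof.
apply: ub_le_sup; last by exists d.
by exists C => _ [d' _ <-].
Qed.

Lemma msup_le : msup w <= C.
Proof.
apply: ge_sup; first by exists (\sum_(k <- mle 0) w k), 0%N.
by move=> _ [d _ <-].
Qed.

Lemma msup_adherent e : 0 < e -> exists d, msup w - e < \sum_(k <- mle d) w k.
Proof.
move=> e0; suff /(sup_adherent e0)[_ [d _ <-] de] :
  has_sup (range (fun d => \sum_(k <- mle d) w k)) by exists d.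
by split; [exists (\sum_(k <- mle 0) w k), 0%N|exists C => _ [d' _ <-]].
Qed.

Lemma msup_ge0 : 0 <= msup w.
Proof. exact: le_trans (sumr_ge0 _ (fun k _ => w0 k)) (ler_msup 0). Qed.

Lemma ler_fset_msup (s : seq mi) : uniq s -> \sum_(k <- s) w k <= msup w.
Proof.
move=> us; have [d sd] := fset_sub_mle [fset k in s]%fset.
apply: le_trans (ler_msup d); apply: ler_big_subset => //; first exact: uniq_mle.
by move=> k ks; apply: sd; rewrite inE.
Qed.

Lemma tail_msup d (s : seq mi) : uniq s -> {in s, forall k, k \notin mle d} ->
  \sum_(k <- s) w k <= msup w - \sum_(k <- mle d) w k.
Proof.
move=> us sd; rewrite lerBrDr -big_cat; apply: ler_fset_msup.
rewrite cat_uniq us uniq_mle andbT /=; apply/hasPn => k kd.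
by apply/negP => /sd; rewrite kd.
Qed.

Lemma has_sum_msup : @has_sum R mi R[i]^o (fun k => (w k)%:C) (msup w)%:C.
Proof.
apply/has_sumP => e e0; have [d de] := msup_adherent e0; exists d => J dJ.
rewrite -rc_sum -rmorphB [nm _]rabsr ger0_norm ?subr_ge0 ?ler_fset_msup ?fset_uniq //.
rewrite ltrBlDr -ltrBlDl; apply: (lt_le_trans de).
by apply: ler_big_subset; rewrite ?uniq_mle ?fset_uniq.
Qed.

End Msup.

Lemma eq_msup (w w' : mi -> R) : w =1 w' -> msup w = msup w'.
Proof. by move=> /funext ->. Qed.

Lemma cvg_msup (w : mi -> R) C : (forall k, 0 <= w k) ->
  (forall d, \sum_(k <- mle d) w k <= C) ->
  (fun d => \sum_(k <- mle d) w k) @ \oo --> msup w.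
Proof.
move=> w0 wC; apply: nondecreasing_cvgn.
  move=> d d' dd'; apply: ler_big_subset; rewrite ?uniq_mle //.
  exact: sub_mle.
by exists C => _ [d _ <-].
Qed.

Lemma has_sum_exists (V : completeNormedModType R[i]) (x : mi -> V) (C : R) :
  (forall d, \sum_(k <- mle d) nm (x k) <= C) -> exists s, has_sum x s.
Proof.
move=> xC; suff : cvg (summability.partial_sum x @ summability.totally).
  by move=> /cvg_ex[s]; exists s.
apply: cauchy_cvg; apply: cauchy_exP => e e0.
have eE : e = (complex.Re e)%:C by rewrite RRe_real // ger0_real // ltW.
have e0' : 0 < complex.Re e by rewrite -ltcR -eE.
have [d de] := msup_adherent xC e0'.
exists (\sum_(k <- mle d) x k); exists [fset k in mle d]%fset => // J /= dJ.
rewrite -ball_normE /= nmE eE ltcR partial_sumE nm_distC.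
have -> : \sum_(k <- J) x k - \sum_(k <- mle d) x k
    = \sum_(k <- J | k \notin mle d) x k.
  rewrite (bigID (mem (mle d))) /= -big_filter (perm_big (mle d)).
    by rewrite addrAC subrr add0r.
  apply: uniq_perm; rewrite ?uniq_mle ?filter_uniq ?fset_uniq // => k.
  rewrite mem_filter; case: (boolP (k \in mle d)) => //= kd.
  by apply: (fsubsetP dJ); rewrite inE.
apply: le_lt_trans (ler_nm_sum _ _ _) _; rewrite -big_filter.
apply: le_lt_trans (_ : msup (fun k => nm (x k)) - _ < _).
  apply: (tail_msup (d := d) _ xC); rewrite ?filter_uniq ?fset_uniq //.
    by move=> k; apply: nm_ge0.
  by move=> k; rewrite mem_filter => /andP[].
by rewrite ltrBlDr -ltrBlDl.
Qed.

(** x is a combination of the nonnegative families |x|, |x| + Re x and |x| + Im x, whose sums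
    [has_sum_msup] provides. Absolute summability thus turns the chosen value [csum] into a genuine
    limit. *)
Lemma has_csum (x : mi -> R[i]) (C : R) :
  (forall d, \sum_(k <- mle d) rabs (x k) <= C) ->
  @has_sum R mi R[i]^o x (csum x).
Proof.
move=> xC.
have absle k : `|complex.Re (x k)| <= rabs (x k) /\ `|complex.Im (x k)| <= rabs (x k).
  have e : rabs (x k) = Num.sqrt (complex.Re (x k) ^+ 2 + complex.Im (x k) ^+ 2).
    by apply: (@complexI R); rewrite -rabsE normc_def.
  by rewrite e -!sqrtr_sqr !ler_sqrt ?lerDl ?lerDr ?sqr_ge0 // addr_ge0 // sqr_ge0.
have C2 (f : mi -> R) : (forall k, `|f k| <= rabs (x k)) ->
    forall d, \sum_(k <- mle d) (rabs (x k) + f k) <= C + C.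
  move=> fx d; rewrite big_split lerD //; apply: le_trans (xC d).
  by apply: ler_sum => k _; apply: le_trans (fx k); apply: ler_norm.
have nn (f : mi -> R) : (forall k, `|f k| <= rabs (x k)) -> forall k, 0 <= rabs (x k) + f k.
  by move=> fx k; rewrite -lerBlDr sub0r (le_trans _ (fx k)) // -normrN ler_norm.
have re k := (absle k).1; have im k := (absle k).2.
have s1 := has_sum_msup (nn _ re) (C2 _ re).
have s2 := has_sum_msup (nn _ im) (C2 _ im).
have s0 := has_sum_msup (fun k => rabs_ge0 (x k)) xC.
have s3 := has_sumD (has_sumD s1 (has_sumZ (c := -1) s0))
  (has_sumZ (c := 'i%C) (has_sumD s2 (has_sumZ (c := -1) s0))).
have e : x = fun k => (rabs (x k) + complex.Re (x k))%:C + -1 * (rabs (x k))%:C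
    + 'i%C * ((rabs (x k) + complex.Im (x k))%:C + -1 * (rabs (x k))%:C).
  by apply/funext => k; rewrite [LHS]complexE !rcD; ring.
have xs := eq_ind_r (fun y => @has_sum R mi R[i]^o y _) s3 e.
by rewrite /csum (has_sum_lim xs).
Qed.

End HasSum.

(** Cauchy-Schwarz after inserting sqrt(w i) and its inverse; in the applications the weights are
    values of [rho]. *)
Lemma nm_sum_sqr_le (R : realType) (V : normedModType R[i]) (I : Type)
    (r : seq I) (P : pred I) (c : I -> R[i]) (w : I -> R) (v : I -> V) :
  (forall i, 0 < w i) ->
  nm (\sum_(i <- r | P i) c i *: v i) ^+ 2
    <= (\sum_(i <- r | P i) rabs (c i) ^+ 2 * w i)
       * (\sum_(i <- r | P i) nm (v i) ^+ 2 / w i).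
Proof.
move=> w0.
have -> : \sum_(i <- r | P i) rabs (c i) ^+ 2 * w i
    = \sum_(i <- r | P i) (rabs (c i) * Num.sqrt (w i)) ^+ 2.
  by apply: eq_bigr => i _; rewrite exprMn sqr_sqrtr // ltW.
have -> : \sum_(i <- r | P i) nm (v i) ^+ 2 / w i
    = \sum_(i <- r | P i) (nm (v i) / Num.sqrt (w i)) ^+ 2.
  by apply: eq_bigr => i _; rewrite exprMn exprVn sqr_sqrtr // ltW.
apply: le_trans (sum_mul_le_sqr _ _ _ _); rewrite lerXn2r ?nnegrE ?nm_ge0 //.
  by apply: sumr_ge0 => i _; rewrite !mulr_ge0 ?rabs_ge0 ?invr_ge0 ?sqrtr_ge0 ?nm_ge0.
apply: le_trans (ler_nm_sum _ _ _) _; apply: ler_sum => i _.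
rewrite nmZ mulrACA divff ?mulr1 //.
by rewrite gt_eqF // sqrtr_gt0.
Qed.

Section FiniteSums.
Variables (R : realType) (n : nat).
Local Notation mi := (mindex n).
Local Notation rho := (@rho n R).

Lemma big_mle_vanish (V : nmodType) d d' (F : mi -> V) : (d <= d')%N ->
  (forall k, (d < mdegree k)%N -> F k = 0) ->
  \sum_(k <- mle n d') F k = \sum_(k <- mle n d) F k.
Proof.
move=> dd' F0; rewrite (bigID (mem (mle n d))) /= addrC big1 ?add0r; last first.
  by move=> k; rewrite mem_mle -ltnNge => /F0.
rewrite -big_filter; apply: perm_big; apply: uniq_perm => [||k].
- exact/filter_uniq/uniq_mle.
- exact: uniq_mle.
rewrite mem_filter; case: (boolP (k \in mle n d)) => //= kd.
exact: (sub_mle dd' kd).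
Qed.

Lemma msup_fin d (w : mi -> R) : (forall k, 0 <= w k) ->
  (forall k, (d < mdegree k)%N -> w k = 0) -> msup w = \sum_(k <- mle n d) w k.
Proof.
move=> w0 wd; have b d' : \sum_(k <- mle n d') w k <= \sum_(k <- mle n d) w k.
  have [dd'|/ltnW dd'] := leqP d d'; first by rewrite (big_mle_vanish dd').
  by apply: ler_big_subset; rewrite ?uniq_mle //; apply: sub_mle.
apply/eqP; rewrite eq_le (msup_le b) /=; exact: ler_msup b d.
Qed.

(** The case p = 0 of the Pascal relation, where rho_0 leaves only the index 0. Under a shift the
    sum against rho_1 loses just its initial term, which makes energies telescope. *)
Lemma big_rho1 (Z : mi -> R) d :
  \sum_(k <- mle n d.+1) rho 1 k * Z k
    = Z (mi0 n) + \sum_(l <- mle n d) rho 1 l * \sum_i Z (madd (munit i) l).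
Proof.
rewrite (@big_rho_pascal R n _ d 0 (fun c k => c * Z k));
  [|by move=> k u v; rewrite mulrDl|by move=> k; rewrite mul0r].
congr (_ + _); last by apply: eq_bigr => l _; rewrite mulr_sumr.
rewrite -[RHS](big_mle0 n d.+1); apply: eq_bigr => k _.
by rewrite rho0E; case: eqP => [->|_]; rewrite ?mul1r ?mul0r.
Qed.

End FiniteSums.

(** * The recursions attached to a unitary colligation *)

Section Colligation.
Variables (R : realType) (n p : nat) (H E : hilbertType R) (F : set H).
Local Notation mi := (mindex n).
Local Notation rho := (@rho n R).
Local Notation mle := (@mle n).
Variable U : H * E -> ('I_n -> H) * (mi -> H).

Definition colligation_linear := forall (a : R[i]) u v, U (a *: u + v) = a *: U u + U v.

(* The first conjunct makes the [msup] of the second one meaningful: [sup] is 0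
   on unbounded sets. *)
Definition colligation_isometric := forall u,
  (forall d, \sum_(k <- mle d) nm ((U u).2 k) ^+ 2 <= nm u.1 ^+ 2 + nm u.2 ^+ 2)
  /\ \sum_i nm ((U u).1 i) ^+ 2 + msup (fun k => nm ((U u).2 k) ^+ 2)
     = nm u.1 ^+ 2 + nm u.2 ^+ 2.

Hypotheses (UL : colligation_linear) (UI : colligation_isometric).

Lemma collig1L i a u v : (U (a *: u + v)).1 i = a *: (U u).1 i + (U v).1 i.
Proof. by rewrite UL. Qed.

Lemma collig2L k a u v : (U (a *: u + v)).2 k = a *: (U u).2 k + (U v).2 k.
Proof. by rewrite UL. Qed.

Lemma collig0 : U 0 = 0.
Proof. by have := UL (-1) 0 0; rewrite scaler0 add0r scaleN1r addNr. Qed.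

Lemma collig1Z i a u : (U (a *: u)).1 i = a *: (U u).1 i.
Proof. by rewrite -[a *: u]addr0 collig1L collig0 addr0. Qed.

Lemma collig2Z k a u : (U (a *: u)).2 k = a *: (U u).2 k.
Proof. by rewrite -[a *: u]addr0 collig2L collig0 addr0. Qed.

(** The argument d is fuel. Each step lowers the degree by one, so with d = |k| + 1 the sum over
    predecessors is empty before the fuel runs out. *)
Fixpoint state_rec (h : H) (f : mi -> E) (d : nat) (k : mi) : H :=
  if d is d'.+1 then (if k == mi0 n then h else 0)
    + \sum_(i | mleq (munit i) k)
        (U (state_rec h f d' (msub k (munit i)), f (msub k (munit i)))).1 i
  else 0.

(* The coefficients of the power series X(z) solving
   X(z) = h + \sum_i z_i (U (X(z), f(z))).1_i. *)
Definition state (h : H) (f : mi -> E) (k : mi) : H :=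
  state_rec h f (mdegree k).+1 k.

Lemma stateE h f k :
  state h f k = (if k == mi0 n then h else 0)
    + \sum_(i | mleq (munit i) k)
        (U (state h f (msub k (munit i)), f (msub k (munit i)))).1 i.
Proof.
rewrite [LHS]/state /=; congr (_ + _); apply: eq_bigr => i ik.
by rewrite /state -[in LHS](msubK ik) mdegreeD mdegree_unit (msubK ik).
Qed.

(** Linearity of the state, the trajectory built backwards and the zero-input formula are all
    obtained from this uniqueness, by exhibiting a solution. *)
Lemma state_unique h f x :
  (forall k, x k = (if k == mi0 n then h else 0)
    + \sum_(i | mleq (munit i) k) (U (x (msub k (munit i)), f (msub k (munit i)))).1 i) ->
  x = state h f.
Proof.
move=> xE; apply/funext => k; have [d] := ubnP (mdegree k).
elim: d k => // d IH k kd; rewrite xE stateE; congr (_ + _).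
apply: eq_bigr => i ik; rewrite IH // mdegreeB // mdegree_unit.
by rewrite ltn_subLR ?(leq_trans _ (mleq_degree ik)) ?mdegree_unit.
Qed.

Lemma state_linear a h f h' f' k :
  state (a *: h + h') (fun l => a *: f l + f' l) k
    = a *: state h f k + state h' f' k.
Proof.
suff <- : (fun k => a *: state h f k + state h' f' k)
  = state (a *: h + h') (fun l => a *: f l + f' l) by [].
apply: state_unique => l; rewrite [in LHS]stateE [X in _ + X]stateE.
rewrite scalerDr addrACA scaler_sumr -big_split; congr (_ + _).
  by case: ifP => // _; rewrite scaler0 addr0.
by apply: eq_bigr => i _ /=; rewrite -collig1L.
Qed.

Definition output (h : H) (f : mi -> E) (K : mi) : H :=
  \sum_(l <- below K)
    (Num.sqrt (rho p (msub K l)))%:C *: (U (state h f l, f l)).2 (msub K l).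

Lemma output_linear a h f h' f' K :
  output (a *: h + h') (fun l => a *: f l + f' l) K
    = a *: output h f K + output h' f' K.
Proof.
rewrite /output scaler_sumr -big_split; apply: eq_bigr => l _ /=.
rewrite state_linear [in RHS]scalerA [a * _]mulrC -scalerA -scalerDr; congr (_ *: _).
exact: (collig2L _ _ (_, _) (_, _)).
Qed.

Lemma output_sub h f h' f' K :
  output (h - h') (fun l => f l - f' l) K = output h f K - output h' f' K.
Proof.
have := output_linear (-1) h' f' h f K; rewrite !scaleN1r [RHS]addrC => <-.
congr output; first by rewrite addrC.
by apply/funext => l; rewrite scaleN1r addrC.
Qed.

(** The state energy q is at most |h|^2 plus the energy of the first components of U. The isometry
    identity, weighted by 1 / rho_1, expresses the latter through q itself, so q cancels. *)
Lemma state_energy h f d :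
  \sum_(l <- mle d) msup (fun k => nm ((U (state h f l, f l)).2 k) ^+ 2) / rho 1 l
    <= nm h ^+ 2 + \sum_(l <- mle d) nm (f l) ^+ 2 / rho 1 l.
Proof.
set x := state h f.
pose q d := \sum_(k <- mle d) nm (x k) ^+ 2 / rho 1 k.
have xq : q d <= nm h ^+ 2
    + \sum_(l <- mle d) \sum_i nm ((U (x l, f l)).1 i) ^+ 2 / rho 1 l.
  (* The successors l + e_i of indices of degree at most d have degree up to d + 1. *)
  apply: (@le_trans _ _ (q d.+1)).
    apply: ler_big_subset; rewrite ?uniq_mle //; first exact/sub_mle/leqnSn.
    by move=> k; rewrite divr_ge0 ?sqr_ge0 ?rho_ge0.
  rewrite -(big_mle0 n d.+1 (nm h ^+ 2)).
  rewrite -(big_mle_unit d (fun i l => nm ((U (x l, f l)).1 i) ^+ 2 / rho 1 l)).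
  rewrite -big_split; apply: ler_sum => k _; rewrite /x stateE /= -/x.
  (* The index 0 has no predecessors and every other index receives no h, so no cross terms
     arise. *)
  case: eqP => [->|/eqP k0].
    rewrite rho_mi0 divr1 big_pred0 => [|i]; last by rewrite mleq_unit ffunE.
    by rewrite addr0 lerDl; apply: sumr_ge0 => i _; rewrite divr_ge0 ?sqr_ge0 ?rho_ge0.
  rewrite !add0r ler_pdivrMr ?rho_gt0 // mulrC.
  under eq_bigr do rewrite -[(U _).1 _]scale1r.
  apply: le_trans (nm_sum_sqr_le (w := fun i => rho 1 (msub k (munit i))) _ _ _ _ _) _.
    by move=> i; apply: rho_gt0.
  rewrite [in leRHS]rho_pascal rho0E (negPf k0) add0r.
  rewrite le_eqVlt; apply/orP; left; apply/eqP; congr (_ * _).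
  by apply: eq_bigr => i _; rewrite rabs1 expr1n mul1r.
have : \sum_(l <- mle d) (\sum_i nm ((U (x l, f l)).1 i) ^+ 2 / rho 1 l)
   + \sum_(l <- mle d) msup (fun k => nm ((U (x l, f l)).2 k) ^+ 2) / rho 1 l
   = q d + \sum_(l <- mle d) nm (f l) ^+ 2 / rho 1 l.
  rewrite -!big_split; apply: eq_bigr => l _ /=.
  by rewrite -mulr_suml -!mulrDl (UI (x l, f l)).2.
by move: xq; lra.
Qed.

(** In Cauchy-Schwarz with the weights rho_1(l), the first factor is the convolution giving
    rho_{p+1}(K), which cancels the denominator. *)
Lemma output_contraction h f d :
  \sum_(K <- mle d) nm (output h f K) ^+ 2 / rho p.+1 K
    <= nm h ^+ 2 + \sum_(l <- mle d) nm (f l) ^+ 2 / rho 1 l.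
Proof.
apply: le_trans (state_energy h f d).
pose G l k := nm ((U (state h f l, f l)).2 k) ^+ 2 / rho 1 l.
apply: (@le_trans _ _ (\sum_(K <- mle d) \sum_(l <- below K) G l (msub K l))).
  apply: ler_sum => K _; rewrite ler_pdivrMr ?rho_gt0 // mulrC.
  apply: le_trans (nm_sum_sqr_le (w := fun l => rho 1 l) _ _ _ _ _) _.
    by move=> l; apply: rho_gt0.
  rewrite [in leRHS]rho_conv le_eqVlt; apply/orP; left; apply/eqP.
  congr (_ * _); apply: eq_bigr => l _.
  by rewrite rabsr ger0_norm ?sqrtr_ge0 // sqr_sqrtr ?rho_ge0 // mulrC.
rewrite big_mle_conv; apply: ler_sum => l _; rewrite -mulr_suml.
rewrite ler_wpM2r ?invr_ge0 ?rho_ge0 //.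
have [Ub _] := UI (state h f l, f l).
exact: ler_msup Ub (d - mdegree l)%N.
Qed.

End Colligation.

(** * The backward recursion and its energy identity *)

Section Backward.
Variables (R : realType) (n p : nat) (H E : hilbertType R) (F : set H).
Local Notation mi := (mindex n).
Local Notation rho := (@rho n R).
Local Notation mle := (@mle n).
Variable U : H * E -> ('I_n -> H) * (mi -> H).
Hypotheses (UL : colligation_linear U) (UI : colligation_isometric U).

(* Distributes [g] over the pairs (l, k) with l + k = K, proportionally to
   \rho_1(l)\rho_p(k); this is the adjoint of the summation in [output]. *)
Definition spread (g : mi -> H) (l k : mi) : H :=
  (Num.sqrt (rho p k) / rho p.+1 (madd l k))%:C *: g (madd l k).

(** Every predecessor of an index hands it the same vector. This is the equality case of the
    Cauchy-Schwarz estimate in [state_energy]; multiplication by rho_1 turns a solution into a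
    forward trajectory. *)
Definition backward (g : mi -> H) (x : mi -> H) (e : mi -> E) : Prop :=
  forall l, U (x l, e l) = (fun i => x (madd (munit i) l), spread g l).

Definition vanishes (V : nmodType) (N : nat) (g : mi -> V) : Prop :=
  forall k, (N < mdegree k)%N -> g k = 0.

(** For k other than 0 the predecessors contribute rho_1(k - e_i) x_k, and these weights add up to
    rho_1(k) by [rho_pascal]. Likewise the pieces of [spread] reassemble g by [rho_conv]. *)
Lemma backward_output g x e : backward g x e ->
  output p U (x (mi0 n)) (fun l => (rho 1 l)%:C *: e l) = g.
Proof.
move=> bk.
have xE : (fun l => (rho 1 l)%:C *: x l)
    = state U (x (mi0 n)) (fun l => (rho 1 l)%:C *: e l).
  apply: state_unique => k; rewrite {1}rho_pascal rho0E.
  rewrite rcD scalerDl; congr (_ + _).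
    by case: eqP => [->|_]; rewrite ?scale1r ?scale0r.
  rewrite rc_sum scaler_suml; apply: eq_bigr => i ik.
  set j := msub k (munit i).
  rewrite -[RHS]/((U ((rho 1 j)%:C *: (x j, e j))).1 i) (collig1Z UL) bk /=.
  by rewrite msubK.
apply/funext => K; rewrite /output -xE.
transitivity (\sum_(l <- below K)
    ((rho 1 l * rho p (msub K l)) / rho p.+1 K)%:C *: g K).
  apply: eq_big_seq => l; rewrite mem_below => lK.
  rewrite -[(_ *: _, _ *: _)]/((rho 1 l)%:C *: (x l, e l)) (collig2Z UL) bk /= /spread msubK //.
  rewrite !scalerA -!rcM; congr (_%:C *: _).
  set s := Num.sqrt _; have <- : s ^+ 2 = rho p (msub K l).
    by rewrite sqr_sqrtr ?rho_ge0.
  by field; rewrite gt_eqF ?rho_gt0.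
rewrite -scaler_suml -rc_sum -mulr_suml -rho_conv divff ?scale1r //.
by rewrite gt_eqF ?rho_gt0.
Qed.

(** Summed with the weights rho_1, the isometry identities telescope in x by [big_rho1], leaving the
    term at 0, and the norms of [spread] recombine by [rho_conv]. *)
Lemma backward_norm N g x e : backward g x e ->
  vanishes N g -> vanishes N x ->
  nm (x (mi0 n)) ^+ 2 + \sum_(l <- mle N) rho 1 l * nm (e l) ^+ 2
    = \sum_(K <- mle N) nm (g K) ^+ 2 / rho p.+1 K.
Proof.
move=> bk gN xN.
have spreadE l : (mdegree l <= N)%N -> msup (fun k => nm (spread g l k) ^+ 2)
    = \sum_(k <- mle (N - mdegree l)) nm (spread g l k) ^+ 2.
  move=> lN; apply: msup_fin => [k|k]; first exact: sqr_ge0.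
  rewrite ltn_subLR // => kN.
  by rewrite /spread gN ?mdegreeD // scaler0 nm0 expr0n.
have iso : \sum_(l <- mle N) rho 1 l * \sum_i nm (x (madd (munit i) l)) ^+ 2
    + \sum_(l <- mle N) rho 1 l * msup (fun k => nm (spread g l k) ^+ 2)
    = \sum_(l <- mle N) rho 1 l * nm (x l) ^+ 2
      + \sum_(l <- mle N) rho 1 l * nm (e l) ^+ 2.
  rewrite -!big_split; apply: eq_bigr => l _ /=.
  by rewrite -!mulrDr; have [_ /= <-] := UI (x l, e l); rewrite bk.
have := big_rho1 (fun k => nm (x k) ^+ 2) N.
(* States of degree N + 1 vanish, which closes the telescoping. *)
rewrite (big_mle_vanish (leqnSn N)) => [xS|k kN]; last first.
  by rewrite xN // nm0 expr0n mulr0.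
have spreadS : \sum_(l <- mle N) rho 1 l * msup (fun k => nm (spread g l k) ^+ 2)
    = \sum_(K <- mle N) nm (g K) ^+ 2 / rho p.+1 K.
  pose G l k := rho 1 l * (rho p k / rho p.+1 (madd l k) ^+ 2 * nm (g (madd l k)) ^+ 2).
  transitivity (\sum_(l <- mle N) \sum_(k <- mle (N - mdegree l)) G l k).
    apply: eq_big_seq => l; rewrite mem_mle => /spreadE ->; rewrite mulr_sumr.
    apply: eq_bigr => k _; rewrite /G /spread nmZ exprMn rabsr real_normK ?num_real //.
    by rewrite exprMn exprVn sqr_sqrtr ?rho_ge0.
  rewrite -big_mle_conv; apply: eq_bigr => K _.
  transitivity (\sum_(l <- below K) (rho 1 l * rho p (msub K l)) *
      (nm (g K) ^+ 2 / rho p.+1 K ^+ 2)).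
    apply: eq_big_seq => l; rewrite mem_below => lK; rewrite /G msubK //.
    by ring.
  by rewrite -mulr_suml -rho_conv; field; rewrite gt_eqF ?rho_gt0.
by move: iso xS spreadS; lra.
Qed.

Lemma backward_sub g x e g' x' e' : backward g x e -> backward g' x' e' ->
  backward (fun k => g k - g' k) (fun k => x k - x' k) (fun k => e k - e' k).
Proof.
move=> bk bk' l.
have := UL (-1) (x' l, e' l) (x l, e l); rewrite bk bk'.
rewrite -[-1 *: (x' l, e' l) + _]/(-1 *: x' l + x l, -1 *: e' l + e l).
rewrite !scaleN1r !(addrC (- _ l)) => ->; congr pair; apply/funext => i.
  by rewrite [LHS]addrC.
by rewrite [LHS]addrC /spread scalerBr.
Qed.

Hypothesis FL : forall (a : R[i]) x y, F x -> F y -> F (a *: x + y).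
Hypothesis F0 : F 0.
Hypothesis US : forall y (a : mi -> H) C, (forall k, F (a k)) ->
  (forall d, \sum_(k <- mle d) nm (a k) ^+ 2 <= C) -> exists u, U u = (y, a).

(** The fuel d counts the degrees from |l| up to the truncation; past it the zero pair is the
    correct value, and below it [xget] selects a preimage under U. *)
Fixpoint backward_rec (g : mi -> H) (d : nat) (l : mi) : H * E :=
  if d is d'.+1 then
    xget 0 [set u | U u = (fun i => (backward_rec g d' (madd (munit i) l)).1, spread g l)]
  else 0.

Lemma backward_exists N g : vanishes N g -> (forall k, F (g k)) ->
  exists x e, [/\ backward g x e, vanishes N x & vanishes N e].
Proof.
move=> gN gF; pose u l := backward_rec g (N.+1 - mdegree l) l.
(* Above degree N the truncated subtraction leaves no fuel, so the value is 0. *)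
have uN : vanishes N u by move=> l lN; rewrite /u (eqP lN).
exists (fun l => (u l).1), (fun l => (u l).2); split; last 2 first.
- by move=> l /uN ->.
- by move=> l /uN ->.
move=> l; have [lN|lN] := ltnP N (mdegree l).
  rewrite uN // (collig0 UL); congr pair; apply/funext => k.
    by rewrite uN // mdegreeD ltn_addl.
  by rewrite /spread gN ?mdegreeD ?ltn_addr // scaler0.
rewrite -surjective_pairing {1}/u subSn //=.
have lF k : F (spread g l k) by rewrite -[spread g l k]addr0; apply: FL.
have lb d : \sum_(k <- mle d) nm (spread g l k) ^+ 2
    <= \sum_(k <- mle N) nm (spread g l k) ^+ 2.
  have vl k : (N < mdegree k)%N -> nm (spread g l k) ^+ 2 = 0.
    by move=> kN; rewrite /spread gN ?mdegreeD ?ltn_addl // scaler0 nm0 expr0n.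
  have [dN|/ltnW dN] := leqP N d; first by rewrite (big_mle_vanish dN).
  apply: ler_big_subset; rewrite ?uniq_mle //; first exact: sub_mle.
  by move=> k; apply: sqr_ge0.
have [v Uv] := US (fun i => (u (madd (munit i) l)).1) lF lb.
set A := [set _ | _]; have : A (xget 0 A).
  apply: xgetPex; exists v; rewrite /A /= Uv; congr pair; apply/funext => i.
  by rewrite /u mdegreeD mdegree_unit add1n subSS.
rewrite /A /= => ->; congr pair; apply/funext => i.
by rewrite /u mdegreeD mdegree_unit add1n subSS.
Qed.

End Backward.

Lemma cvg_sum_seq (K : numFieldType) (V : pseudoMetricNormedZmodType K)
    (I T : Type) (r : seq I) (F : set_system T) (FF : Filter F)
    (f : I -> T -> V) (a : I -> V) :
  (forall i, f i x @[x --> F] --> a i) ->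
  \sum_(i <- r) f i x @[x --> F] --> \sum_(i <- r) a i.
Proof.
move=> fa; apply: cvg_big => [|i _]; last exact: fa.
exact: pseudometric_normed_Zmodule.add_continuous.
Qed.

Section Limits.
Variable R : realType.

Lemma cvg_nm (V : normedModType R[i]) (T : Type) (F : set_system T)
    (FF : Filter F) (f : T -> V) s : f @ F --> s -> nm (f x) @[x --> F] --> nm s.
Proof.
move=> /nm_cvgP fs; apply/cvgrPdist_lt => e /fs.
apply: filterS => t; apply: le_lt_trans.
have l1 := ler_nmD (s - f t) (f t); have l2 := ler_nmD (f t - s) s.
move: l1 l2; rewrite !subrK (nm_distC (f t)) => l1 l2.
by rewrite ler_norml lerBrDr lerBlDr; apply/andP; split; move: l1 l2; lra.
Qed.

(** The first hypothesis makes q nondecreasing, so past an index where q is close to its supremum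
    all increments of u are small. *)
Lemma cvg_of_increments (V : completeNormedModType R[i]) (u : nat -> V)
    (q : nat -> R) (C : R) :
  (forall N N', (N <= N')%N -> nm (u N' - u N) ^+ 2 <= q N' - q N) ->
  (forall N, q N <= C) -> exists s : V, u @ \oo --> s.
Proof.
move=> uq qC; suff : cvg (u @ \oo) by move=> /cvg_ex[s]; exists s.
apply: cauchy_cvg; apply: cauchy_exP => e e0.
have eE : e = (complex.Re e)%:C by rewrite RRe_real // ger0_real // ltW.
have e0' : 0 < complex.Re e by rewrite -ltcR -eE.
have hs : has_sup (range q) by split; [exists (q 0%N), 0%N|exists C => _ [N _ <-]].
have [_ [N _ <-] Ne] := sup_adherent (exprn_gt0 2 e0') hs.
exists (u N); exists N => // N' /= NN'.
rewrite -ball_normE /= nmE eE ltcR nm_distC -(@ltr_pXn2r _ 2) ?nnegrE ?nm_ge0 ?ltW //.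
apply: le_lt_trans (uq _ _ NN') _.
have : q N' <= sup (range q) by apply: ub_le_sup; [exists C => _ [M _ <-]|exists N'].
by move: Ne; lra.
Qed.

End Limits.

(** * Surjectivity of the output map with norm control *)

Section Onto.
Variables (R : realType) (n p : nat) (H E : hilbertType R) (F : set H).
Local Notation mi := (mindex n).
Local Notation rho := (@rho n R).
Local Notation mle := (@mle n).
Variable U : H * E -> ('I_n -> H) * (mi -> H).
Hypotheses (UL : colligation_linear U) (UI : colligation_isometric U).
Hypothesis FL : forall (a : R[i]) x y, F x -> F y -> F (a *: x + y).
Hypothesis F0 : F 0.
Hypothesis US : forall y (a : mi -> H) C, (forall k, F (a k)) ->
  (forall d, \sum_(k <- mle d) nm (a k) ^+ 2 <= C) -> exists u, U u = (y, a).

(* The solutions of the backward recursion for the truncations of [g] form a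
   Cauchy sequence, by the energy identity [backward_norm] for differences. *)
Lemma output_onto (g : mi -> H) (C : R) : (forall k, F (g k)) ->
  (forall d, \sum_(K <- mle d) nm (g K) ^+ 2 / rho p.+1 K <= C) ->
  exists h f, output p U h f = g /\
    forall d, nm h ^+ 2 + \sum_(l <- mle d) nm (f l) ^+ 2 / rho 1 l <= C.
Proof.
move=> gF gC; pose gN N k := if (mdegree k <= N)%N then g k else 0.
pose q N := \sum_(K <- mle N) nm (g K) ^+ 2 / rho p.+1 K.
have gNv N : vanishes N (gN N) by move=> k; rewrite /gN ltnNge => /negPf ->.
have gNF N k : F (gN N k) by rewrite /gN; case: ifP.
have /choice[xe xeP] : forall N, exists xe : (mi -> H) * (mi -> E),
    [/\ backward p U (gN N) xe.1 xe.2, vanishes N xe.1 & vanishes N xe.2].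
  move=> N; have [x [e xeP]] := backward_exists p UL FL F0 US (gNv N) (gNF N).
  by exists (x, e).
pose x N := (xe N).1; pose e N := (xe N).2.
have bk N : backward p U (gN N) (x N) (e N) by case: (xeP N).
have xv N : vanishes N (x N) by case: (xeP N).
have ev N : vanishes N (e N) by case: (xeP N).
have gNE N N' : (N <= N')%N ->
    \sum_(K <- mle N') nm (gN N K) ^+ 2 / rho p.+1 K = q N.
  move=> NN'; rewrite (big_mle_vanish NN') => [|k /gNv ->]; last first.
    by rewrite nm0 expr0n mul0r.
  by apply: eq_big_seq => k; rewrite mem_mle /gN => ->.
have energy N N' : (N <= N')%N ->
    nm (x N' (mi0 n) - x N (mi0 n)) ^+ 2
      + \sum_(l <- mle N') rho 1 l * nm (e N' l - e N l) ^+ 2 = q N' - q N.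
  move=> NN'; have bks := backward_sub UL (bk N') (bk N).
  rewrite (backward_norm UI (N := N') bks).
  - rewrite -(gNE _ _ (leqnn N')) -(gNE _ _ NN') -sumrB; apply: eq_bigr => K _.
    rewrite -mulrBl /gN; case: (leqP (mdegree K) N) => [KN|_]; last first.
      by rewrite subr0 nm0 expr0n subr0.
    by rewrite (leq_trans KN NN') !subrr nm0 expr0n.
  - by move=> k kN; rewrite !gNv ?subrr // (leq_ltn_trans NN').
  - by move=> k kN; rewrite !xv ?subrr // (leq_ltn_trans NN').
have rnm_ge0 (f : mi -> E) l : 0 <= rho 1 l * nm (f l) ^+ 2.
  by rewrite mulr_ge0 ?rho_ge0 ?sqr_ge0.
have [h xh] : exists h : H, (fun N => x N (mi0 n)) @ \oo --> h.
  apply: (@cvg_of_increments R _ _ q C) => // N N' /energy <-.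
  by rewrite lerDl; apply: sumr_ge0 => l _; apply: (rnm_ge0 (fun l => e N' l - e N l)).
have /choice[f0 ef0] : forall l, exists s : E, (fun N => e N l) @ \oo --> s.
  move=> l; apply: (@cvg_of_increments R _ _ (fun N => q N / rho 1 l) (C / rho 1 l)).
    move=> N N' NN'; rewrite -mulrBl ler_pdivlMr ?rho_gt0 // -energy // mulrC.
    apply: (@le_trans _ _ (\sum_(l <- mle N') rho 1 l * nm (e N' l - e N l) ^+ 2)).
      have [lN|lN] := leqP (mdegree l) N'; last first.
        rewrite !ev ?(leq_ltn_trans NN') // subrr nm0 expr0n mulr0.
        by apply: sumr_ge0 => k _; apply: (rnm_ge0 (fun l => e N' l - e N l)).
      rewrite (big_rem l) ?mem_mle //= lerDl.
      by apply: sumr_ge0 => k _; apply: (rnm_ge0 (fun l => e N' l - e N l)).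
    by rewrite lerDr sqr_ge0.
  by move=> N; rewrite ler_pM2r ?invr_gt0 ?rho_gt0 //; apply: gC.
(* The target (s, t) is left free: the limit itself is used to identify the output, and 0 for the
   norm bound. *)
have cvg_energy d (s : H) (t : mi -> E) :
    nm (s - x N (mi0 n)) ^+ 2 + \sum_(l <- mle d) rho 1 l * nm (t l - e N l) ^+ 2
      @[N --> \oo] -->
    nm (s - h) ^+ 2 + \sum_(l <- mle d) rho 1 l * nm (t l - f0 l) ^+ 2.
  have sqc (V : normedModType R[i]) (v : nat -> V) w a : v @ \oo --> w ->
      nm (a - v N) ^+ 2 @[N --> \oo] --> nm (a - w) ^+ 2.
    move=> vw; have vwn : nm (a - v N) @[N --> \oo] --> nm (a - w).
      by apply: cvg_nm; apply: cvgB => //; apply: cvg_cst.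
    rewrite (_ : (fun N => _ ^+ 2) = fun N => nm (a - v N) * nm (a - v N)).
      by rewrite expr2; apply: cvgM.
    by apply/funext => N; rewrite expr2.
  apply: cvgD; first exact: sqc.
  apply: cvg_sum_seq => l; apply: cvgMr; exact: sqc.
have fE (f : mi -> E) l : nm ((rho 1 l)%:C *: f l) ^+ 2 / rho 1 l = rho 1 l * nm (f l) ^+ 2.
  rewrite nmZ rabsr ger0_norm ?rho_ge0 //.
  by field; rewrite gt_eqF ?rho_gt0.
exists h, (fun l => (rho 1 l)%:C *: f0 l); split.
  apply/funext => K; apply/eqP; rewrite -subr_eq0 -nm_eq0 -sqrf_eq0.
  (* Once N >= |K|, the K-th entry of g is an output of the N-th solution. The contraction bounds
     the difference by the distance of that solution to its limit, which tends to 0. *)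
  suff : nm (output p U h (fun l => (rho 1 l)%:C *: f0 l) K - g K) ^+ 2 / rho p.+1 K <= 0.
    by rewrite pmulr_lle0 ?invr_gt0 ?rho_gt0 // => ?; rewrite eq_le sqr_ge0 andbT.
  have := cvg_energy (mdegree K) h f0; rewrite subrr nm0 expr0n add0r.
  rewrite big1 => [cv|l _]; last by rewrite subrr nm0 expr0n mulr0.
  apply: (cvgr_to_ge cv); near=> N.
  have KN : (mdegree K <= N)%N by near: N; exists (mdegree K).
  rewrite (_ : g K = gN N K); last by rewrite /gN KN.
  rewrite -(backward_output UL (bk N)) -output_sub //.
  have := output_contraction p UI (h - x N (mi0 n))
    (fun l => (rho 1 l)%:C *: f0 l - (rho 1 l)%:C *: e N l) (mdegree K).
  rewrite (big_rem K) ?mem_mle //=; set s := \sum_(_ <- rem _ _) _.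
  have : 0 <= s by apply: sumr_ge0 => k _; rewrite divr_ge0 ?sqr_ge0 ?rho_ge0.
  under [in X in _ -> _ <= _ + X -> _]eq_bigr do
    rewrite -scalerBr (fE (fun l => f0 l - e N l)).
  by lra.
move=> d; under eq_bigr do rewrite fE.
have zE (s : H) (t : mi -> E) :
    nm (0 - s) ^+ 2 + \sum_(l <- mle d) rho 1 l * nm (0 - t l) ^+ 2
    = nm s ^+ 2 + \sum_(l <- mle d) rho 1 l * nm (t l) ^+ 2.
  by rewrite sub0r nmN; congr (_ + _); apply: eq_bigr => l _; rewrite sub0r nmN.
have := cvg_energy d 0 (fun=> 0); rewrite zE => cv.
apply: (cvgr_to_le cv); near=> N; rewrite zE.
have dN : (d <= N)%N by near: N; exists d.
apply: (@le_trans _ _ (q N)); last exact: gC.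
rewrite -(gNE _ _ (leqnn N)).
rewrite -(backward_norm UI (bk N) (gNv N) (xv N)) lerD2l.
apply: ler_big_subset; rewrite ?uniq_mle //; first exact: sub_mle.
Unshelve. all: by end_near. Qed.

End Onto.

(** * The colligation of a characteristic triple *)

Section Summable.
Variables (R : realType) (n : nat).
Local Notation mi := (mindex n).
Local Notation mle := (@mle n).

Lemma summableP (w : mi -> R) : (forall k, 0 <= w k) ->
  esum.summable [set: mi] (fun k => (w k)%:E) <->
  exists C, forall d, \sum_(k <- mle d) w k <= C.
Proof.
move=> w0; have absE : (fun k => `|(w k)%:E|%E) = (fun k => (w k)%:E).
  by apply/funext => k; rewrite gee0_abs // lee_fin.
rewrite /esum.summable absE; split=> [wfin|[C wC]].
  have fin : esum [set: mi] (fun k => (w k)%:E) \is a fin_num.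
    by rewrite ge0_fin_numE // esum_ge0 // => k _; rewrite lee_fin.
  exists (fine (esum [set: mi] (fun k => (w k)%:E))) => d.
  rewrite -lee_fin fineK // -sumEFin (fsbig_seq _ _ (uniq_mle n d)).
  apply: ereal_sup_ubound; exists [set` mle d] => //; split=> //.
  exact: finite_seq.
apply: (@le_lt_trans _ _ C%:E); last exact: ltry.
apply: ge_ereal_sup => _ [A [finA _] <-].
rewrite fsbig_finite //= sumEFin lee_fin.
exact: le_trans (ler_fset_msup w0 wC (fset_uniq _)) (msup_le wC).
Qed.

End Summable.

Section HilbertBasics.
Variables (R : realType) (H : hilbertType R).
Implicit Types x y : H.

Lemma dot_sqr x : dot x x = (nm x ^+ 2)%:C.
Proof. by rewrite dot_norm nmE rcX. Qed.

Lemma sqnormE x : sqnorm x = nm x ^+ 2.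
Proof. by rewrite /sqnorm dot_sqr. Qed.

End HilbertBasics.

Section IterComp.
Variables (X : Type) (n : nat) (a : 'I_n -> X -> X).
Hypothesis aC : forall i j x, a i (a j x) = a j (a i x).
Local Notation mi := (mindex n).

Definition comp_pow (k : mi) (s : seq 'I_n) : X -> X :=
  \big[(fun f g : X -> X => f \o g)/id]_(i <- s) iter (k i) (a i).

Lemma comp_pow_comm j k s x : a j (comp_pow k s x) = comp_pow k s (a j x).
Proof.
elim: s x => [|i s IH] x; first by rewrite /comp_pow !big_nil.
rewrite /comp_pow !big_cons /= -!/(comp_pow _ _) -IH.
by elim: (k i) (comp_pow k s x) => //= d IHd y; rewrite aC IHd.
Qed.

Lemma comp_pow_unit j k s x : uniq s ->
  comp_pow (madd (munit j) k) s x = comp_pow k s (if j \in s then a j x else x).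
Proof.
elim: s x => [|i s IH] x; first by rewrite /comp_pow !big_nil.
move=> /= /andP[iNs us]; rewrite /comp_pow !big_cons /= -!/(comp_pow _ _) IH //.
rewrite !ffunE inE; have [ij|ij] := eqVneq i j; last by rewrite add0n.
by rewrite -ij (negPf iNs) add1n /= -comp_pow_comm -iterS iterSr.
Qed.

Lemma comp_pow_mi0 s x : comp_pow (mi0 n) s x = x.
Proof.
elim: s x => [|i s IH] x; first by rewrite /comp_pow big_nil.
by rewrite /comp_pow big_cons /= -/(comp_pow _ _) IH ffunE.
Qed.

End IterComp.

Lemma closure_nmP (R : realType) (V : normedModType R[i]) (A : set V) x :
  closure A x <-> forall e : R, 0 < e -> exists2 y, A y & nm (x - y) < e.
Proof.
split=> [clx e e0|xA].
  have [y [Ay xy]] : A `&` ball x e%:C !=set0.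
    by apply: clx; apply: nbhsx_ballx; rewrite (ltcR 0).
  by exists y => //; move: xy; rewrite -ball_normE /= nmE ltcR.
move=> B /nbhs_ballP[e /= e0 xB].
have eE : e = (complex.Re e)%:C by rewrite RRe_real // ger0_real // ltW.
have /xA[y Ay xy] : 0 < complex.Re e by rewrite -ltcR -eE.
by exists y; split=> //; apply: xB; rewrite -ball_normE /= nmE eE ltcR.
Qed.

Section Adjoint.
Variables (R : realType) (n : nat) (H : hilbertType R) (T : 'I_n -> H -> H).
Hypothesis hT : commuting_tuple T.

Lemma dot0l (x : H) : dot 0 x = 0.
Proof. by have := dotPl (-1) (0 : H) 0 x; rewrite scaler0 add0r mulN1r addNr. Qed.

Lemma dotDl (x y z : H) : dot (x + y) z = dot x z + dot y z.
Proof. by rewrite -[x in LHS]scale1r dotPl mul1r. Qed.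

Lemma dotZl a (x y : H) : dot (a *: x) y = a * dot x y.
Proof. by rewrite -[a *: x]addr0 dotPl dot0l addr0. Qed.

Lemma dotBl (x y z : H) : dot (x - y) z = dot x z - dot y z.
Proof. by rewrite dotDl -scaleN1r dotZl mulN1r. Qed.

Lemma dot_suml (I : Type) (r : seq I) (f : I -> H) z :
  dot (\sum_(i <- r) f i) z = \sum_(i <- r) dot (f i) z.
Proof. exact: (big_morph (fun x => dot x z) (fun x y => dotDl x y z) (dot0l z)). Qed.

Lemma dot0r (x : H) : dot x 0 = 0.
Proof. by rewrite dotC dot0l rmorph0. Qed.

Lemma dotBr (x y z : H) : dot x (y - z) = dot x y - dot x z.
Proof. by rewrite dotC dotBl rmorphB /= -!dotC. Qed.

Lemma dot_inj (x y : H) : (forall z, dot z x = dot z y) -> x = y.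
Proof.
move=> xy; apply/eqP; rewrite -subr_eq0 -nm_eq0 -sqrf_eq0; apply/eqP.
by apply: (@complexI R); rewrite -dot_sqr dotBr xy subrr.
Qed.

Lemma tuple_op_linear i a x y : T i (a *: x + y) = a *: T i x + T i y.
Proof. by have [/(_ i)[[_ TL] _] _] := hT; apply: TL. Qed.

Lemma tuple_op0 i : T i 0 = 0.
Proof. by have := tuple_op_linear i (-1) 0 0; rewrite scaler0 add0r scaleN1r addNr. Qed.

(* [adj] is defined by choice with default value the zero map, so the two
   cases can be treated alike without proving that adjoints exist. *)
Lemma adjP i : (forall x y, dot (T i x) y = dot x (adj (T i) y)) \/
  adj (T i) = (fun=> 0).
Proof.
rewrite /adj; case: xgetP => [A _ AP|]; first by left.
by right.
Qed.

Lemma dot_tuple_adj i x y : dot (T i (adj (T i) x)) y = dot (adj (T i) x) (adj (T i) y).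
Proof.
case: (adjP i) => [-> //|->].
by rewrite tuple_op0 dot0l dot0r.
Qed.

Lemma dot_tuple_adj2 i (S : H -> H) x y : S 0 = 0 ->
  dot (T i (S (adj (T i) x))) y = dot (S (adj (T i) x)) (adj (T i) y).
Proof.
move=> S0; case: (adjP i) => [-> //|->].
by rewrite S0 tuple_op0 !dot0l.
Qed.

End Adjoint.

Section TripleFacts.
Variables (R : realType) (m n : nat) (H E : hilbertType R) (T : 'I_n -> H -> H).
Variables (B : E -> 'I_n -> H) (D : E -> mindex n -> H).
Hypotheses (hT : commuting_tuple T) (triple : characteristic_triple T m B D).
Local Notation mi := (mindex n).
Local Notation rho := (@rho n R).
Local Notation mle := (@mle n).
Local Notation U := (block_op T m B D).
Local Notation F := (defect_space T m).
Local Notation A i := (adj (T i)).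
Local Notation p := m.-1.

Lemma block_linear : colligation_linear U.
Proof. by have [_ _ [[_ UL] _ _]] := triple; move=> a u v; apply: UL. Qed.

Lemma block_range u k : F ((U u).2 k).
Proof.
have [_ _ [[UF _] _ _]] := triple.
by have [_ [UF2 _]] := UF u (conj I I); apply: UF2.
Qed.

Lemma block_isometric : colligation_isometric U.
Proof.
move=> u; have [_ _ [[UF _] UI _]] := triple.
have [_ [_]] := UF u (conj I I).
set v := (U u).2; rewrite (_ : (fun k => _) = fun k => (nm (v k) ^+ 2)%:E); last first.
  by apply/funext => k; rewrite sqnormE.
move=> /summableP[k|C vC]; first exact: sqr_ge0.
have vsum := has_sum_msup (fun k => sqr_ge0 (nm (v k))) vC.
have := UI u u (conj I I) (conj I I); rewrite /= !dot_sqr.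
rewrite (_ : csum _ = (msup (fun k => nm (v k) ^+ 2))%:C); last first.
  rewrite /csum (_ : (fun k => _) = fun k => (nm (v k) ^+ 2)%:C) ?(has_sum_lim vsum) //.
  by apply/funext => k; rewrite -dot_sqr.
under eq_bigr do rewrite dot_sqr.
rewrite -rc_sum -!rcD => /complexI iso; split=> // d; rewrite -iso.
apply: le_trans (ler_msup vC d) _; rewrite lerDr.
by apply: sumr_ge0 => i _; apply: sqr_ge0.
Qed.

Lemma block_surjective y (a : mi -> H) C : (forall k, F (a k)) ->
  (forall d, \sum_(k <- mle d) nm (a k) ^+ 2 <= C) -> exists u, U u = (y, a).
Proof.
move=> aF aC; have [_ _ [_ _ US]] := triple.
have [|u _ uE] := US (y, a); last by exists u.
split; first by [].
split; first exact: aF.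
rewrite (_ : (fun k => _) = fun k => (nm (a k) ^+ 2)%:E); last first.
  by apply/funext => k; rewrite sqnormE.
by apply/summableP => [k|]; [exact: sqr_ge0|exists C].
Qed.

Lemma B0 i : B 0 i = 0.
Proof.
have [[[_ BL] _] _ _] := triple; have := BL (-1) 0 0 I I.
by rewrite scaler0 add0r scaleN1r addNr => ->.
Qed.

Lemma D0 k : D 0 k = 0.
Proof.
have [_ [[_ DL] _] _] := triple; have := DL (-1) 0 0 I I.
by rewrite scaler0 add0r scaleN1r addNr => ->.
Qed.

Lemma block1E x e i : (U (x, e)).1 i = A i x + B e i. Proof. by []. Qed.
Lemma block2E x e k : (U (x, e)).2 k = Cmap T m x k + D e k. Proof. by []. Qed.

Lemma block1H x i : (U (x, 0)).1 i = A i x.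
Proof. by rewrite block1E B0 addr0. Qed.

Lemma block2H x k : (U (x, 0)).2 k = Cmap T m x k.
Proof. by rewrite block2E D0 addr0. Qed.

Lemma adj_linear i a x y : A i (a *: x + y) = a *: A i x + A i y.
Proof.
rewrite -!block1H -(collig1L block_linear); rewrite [_ + (y, 0)](_ : _ = (a *: x + y, 0)) //.
by rewrite -[LHS]/(a *: x + y, a *: 0 + 0) scaler0 addr0.
Qed.

Lemma adj_comm i j x : A i (A j x) = A j (A i x).
Proof.
have A0 k : A k 0 = 0.
  by have := adj_linear k (-1) 0 0; rewrite scaler0 add0r scaleN1r addNr.
have [_ TC] := hT.
case: (adjP T i) => [iP|->]; last by rewrite A0.
case: (adjP T j) => [jP|->]; last by rewrite A0.
apply: dot_inj => z; rewrite -iP -jP -jP -iP.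
by have /(congr1 (@^~ z)) /= -> := TC i j.
Qed.

Lemma adj_pow0 x : adj_pow T (mi0 n) x = x.
Proof. exact: comp_pow_mi0. Qed.

Lemma adj_powE k i x : adj_pow T (madd (munit i) k) x = adj_pow T k (A i x).
Proof.
have := @comp_pow_unit H n (fun i => A i) adj_comm i k (index_enum 'I_n) x (index_enum_uniq _).
by rewrite mem_index_enum.
Qed.

Lemma adj_pow_comm k i x : A i (adj_pow T k x) = adj_pow T k (A i x).
Proof. exact: (@comp_pow_comm H n (fun i => A i) adj_comm). Qed.

Lemma adj_powS k i x : adj_pow T (madd (munit i) k) x = A i (adj_pow T k x).
Proof. by rewrite adj_powE adj_pow_comm. Qed.

Lemma adj_powD k l x : adj_pow T (madd k l) x = adj_pow T k (adj_pow T l x).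
Proof.
elim/mindex_unit_ind: k => [|k i IH]; last by rewrite -maddA !adj_powS IH.
by rewrite maddC madd0 adj_pow0.
Qed.

(** The defect operator is the entry of C at the index 0, where rho equals 1; in this way it
    inherits linearity and the bound 1 from the unitary. *)
Lemma defectE x : defect T m x = Cmap T m x (mi0 n).
Proof. by rewrite /Cmap rho_mi0 sqrtr1 scale1r adj_pow0. Qed.

Lemma Cmap_linear a x y k : Cmap T m (a *: x + y) k = a *: Cmap T m x k + Cmap T m y k.
Proof.
rewrite -!block2H -(collig2L block_linear); rewrite [_ + (y, 0)](_ : _ = (a *: x + y, 0)) //.
by rewrite -[LHS]/(a *: x + y, a *: 0 + 0) scaler0 addr0.
Qed.

Lemma defect_linear a x y : defect T m (a *: x + y) = a *: defect T m x + defect T m y.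
Proof. by rewrite !defectE Cmap_linear. Qed.

Lemma Cmap_norm x : \sum_i nm (A i x) ^+ 2 + msup (fun k => nm (Cmap T m x k) ^+ 2)
  = nm x ^+ 2.
Proof.
have [_] := block_isometric (x, 0); rewrite /= nm0 expr0n addr0 => <-.
congr (_ + _); first by apply: eq_bigr => i _; rewrite -block1H.
by apply: eq_msup => k; rewrite -block2H.
Qed.

Lemma Cmap_bound x d : \sum_(k <- mle d) nm (Cmap T m x k) ^+ 2 <= nm x ^+ 2.
Proof.
have [/(_ d)+ _] := block_isometric (x, 0); rewrite /= nm0 expr0n addr0.
by apply: le_trans; apply: ler_sum => k _; rewrite -block2H.
Qed.

Lemma adj_contraction x : \sum_i nm (A i x) ^+ 2 <= nm x ^+ 2.
Proof.
by rewrite -Cmap_norm lerDl (msup_ge0 (fun k => sqr_ge0 _) (Cmap_bound x)).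
Qed.

Lemma defect_contraction x : nm (defect T m x) <= nm x.
Proof.
rewrite defectE -(@ler_pXn2r _ 2) ?nnegrE ?nm_ge0 //.
apply: le_trans (Cmap_bound x 0); rewrite (big_rem (mi0 n)) ?mem_mle ?mdegree0 //=.
by rewrite lerDl; apply: sumr_ge0 => k _; apply: sqr_ge0.
Qed.

Lemma defect_space_linear (a : R[i]) x y : F x -> F y -> F (a *: x + y).
Proof.
move=> /closure_nmP Fx /closure_nmP Fy; apply/closure_nmP => e e0.
have c0 : 0 < rabs a + 1 by rewrite (le_lt_trans (rabs_ge0 a)) // ltrDl.
have /Fx[_ [u _ <-] xu] : 0 < e / 2 / (rabs a + 1) by rewrite !divr_gt0.
have /Fy[_ [v _ <-] yv] : 0 < e / 2 by rewrite divr_gt0.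
exists (defect T m (a *: u + v)); first by exists (a *: u + v).
rewrite defect_linear opprD addrACA -scalerBr.
apply: le_lt_trans (ler_nmD _ _) _; rewrite nmZ.
have : rabs a * nm (x - defect T m u) <= e / 2.
  apply: (@le_trans _ _ ((rabs a + 1) * nm (x - defect T m u))).
    by rewrite ler_wpM2r ?nm_ge0 // lerDl.
  by move: (ltW xu); rewrite ler_pdivlMr // mulrC.
by move: yv; lra.
Qed.

Lemma defect_space0 : F 0.
Proof.
apply: subset_closure; exists 0 => //.
by have := defect_linear (-1) 0 0; rewrite scaler0 add0r scaleN1r addNr.
Qed.

Lemma defect_space_sum (I : Type) (r : seq I) (c : I -> R[i]) (f : I -> H) :
  (forall i, F (f i)) -> F (\sum_(i <- r) c i *: f i).
Proof.
move=> fF; elim: r => [|i r IH]; first by rewrite big_nil; apply: defect_space0.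
by rewrite big_cons; apply: defect_space_linear.
Qed.

Lemma defect_space_lim (f : nat -> H) s : (forall d, F (f d)) -> f @ \oo --> s -> F s.
Proof.
move=> fF fs; apply: (@closed_cvg _ _ _ _ f F _ _ s fs); first exact: closed_closure.
exact: nearW.
Qed.

Lemma block_output_range h f K : F (output p U h f K).
Proof. by apply: defect_space_sum => l; apply: block_range. Qed.

End TripleFacts.

(** * Evaluation in the ball *)

Section LipschitzMaps.
Variables (R : realType) (V W : normedModType R[i]) (f : V -> W) (c : R).
Hypothesis fL : forall (a : R[i]) x y, f (a *: x + y) = a *: f x + f y.
Hypothesis fc : forall x, nm (f x) <= c * nm x.

Lemma linear_map0 : f 0 = 0.
Proof. by have := fL (-1) 0 0; rewrite scaler0 add0r scaleN1r addNr. Qed.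

Lemma linear_mapB x y : f (x - y) = f x - f y.
Proof. by rewrite addrC -scaleN1r fL scaleN1r addrC. Qed.

Lemma linear_map_sum (I : Type) (r : seq I) (a : I -> R[i]) (x : I -> V) :
  f (\sum_(i <- r) a i *: x i) = \sum_(i <- r) a i *: f (x i).
Proof.
elim: r => [|i r IH]; first by rewrite !big_nil linear_map0.
by rewrite !big_cons fL IH.
Qed.

Lemma linear_map_cvg (T : Type) (G : set_system T) {FG : Filter G} (u : T -> V) s :
  u @ G --> s -> f (u x) @[x --> G] --> f s.
Proof.
move=> /nm_cvgP us; apply/nm_cvgP => e e0.
have c0 : 0 < `|c| + 1 by rewrite ltr_wpDl.
have /us : 0 < e / (`|c| + 1) by rewrite divr_gt0.
apply: filterS => t; rewrite ltr_pdivlMr // -linear_mapB => te.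
apply: le_lt_trans (fc _) _; apply: le_lt_trans te.
rewrite mulrC ler_wpM2l ?nm_ge0 //.
by rewrite (le_trans (ler_norm c)) // lerDl.
Qed.

Lemma linear_has_sum n (x : mindex n -> V) s (a : mindex n -> R[i]) :
  has_sum (fun k => a k *: x k) s -> has_sum (fun k => a k *: f (x k)) (f s).
Proof.
move=> xs; rewrite /has_sum (_ : summability.partial_sum _
  = fun J => f (summability.partial_sum (fun k => a k *: x k) J)).
  exact: linear_map_cvg.
by apply/funext => J; rewrite !partial_sumE linear_map_sum.
Qed.

End LipschitzMaps.

(** For l of low degree, d - |l| is large and tau is small; the other l carry only a small part of
    the mass of w, where tau <= M suffices. *)
Lemma cvg_conv0 (R : realType) n (w : mindex n -> R) (tau : nat -> R) (C M : R) :
  (forall k, 0 <= w k) -> (forall d, \sum_(k <- mle n d) w k <= C) ->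
  (forall j, 0 <= tau j <= M) ->
  (forall e, 0 < e -> exists j0, forall j, (j0 <= j)%N -> tau j < e) ->
  forall e, 0 < e -> exists d0, forall d, (d0 <= d)%N ->
    \sum_(l <- mle n d) w l * tau (d - mdegree l)%N < e.
Proof.
move=> w0 wC tauM tau0 e e0.
have C0 : 0 <= C by apply: le_trans (wC 0%N); apply: sumr_ge0.
have M0 : 0 <= M by have /andP[/le_trans h /h] := tauM 0%N.
(* The denominators C + 1 and M + 1 allow for C = 0 and M = 0. *)
have eC : 0 < e / 2 / (C + 1) by rewrite !divr_gt0 // ltr_wpDl.
have [j0 j0P] := tau0 _ eC.
have eM : 0 < e / 2 / (M + 1) by rewrite !divr_gt0 // ltr_wpDl.
have [d0 d0P] := msup_adherent wC eM.
exists (d0 + j0)%N => d dd; rewrite (bigID (mem (mle n d0))) /=.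
have h1 : \sum_(l <- mle n d | l \in mle n d0) w l * tau (d - mdegree l)%N
    <= C * (e / 2 / (C + 1)).
  apply: (@le_trans _ _ (\sum_(l <- mle n d | l \in mle n d0) w l * (e / 2 / (C + 1)))).
    apply: ler_sum => l; rewrite mem_mle => ld; rewrite ler_wpM2l //.
    apply/ltW/j0P; apply: leq_trans (leq_sub2l d ld).
    by rewrite leq_subRL // (leq_trans (leq_addr _ _) dd).
  rewrite -mulr_suml; apply: ler_wpM2r; first exact: ltW.
  apply: le_trans (wC d); rewrite [leRHS](bigID (mem (mle n d0))) /= lerDl.
  exact: sumr_ge0.
have h2 : \sum_(l <- mle n d | l \notin mle n d0) w l * tau (d - mdegree l)%N
    <= (e / 2 / (M + 1)) * M.
  apply: (@le_trans _ _ (\sum_(l <- mle n d | l \notin mle n d0) w l * M)).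
    by apply: ler_sum => l _; rewrite ler_wpM2l //; case/andP: (tauM (d - mdegree l)%N).
  rewrite -mulr_suml ler_wpM2r // -big_filter.
  apply: le_trans (tail_msup (d := d0) w0 wC _ _) _.
  - exact/filter_uniq/uniq_mle.
  - by move=> l; rewrite mem_filter => /andP[].
  - by rewrite lerBlDr addrC -lerBlDr ltW.
have e2 : 0 < e / 2 by rewrite divr_gt0.
have q1 : C * (e / 2 / (C + 1)) < e / 2.
  by rewrite mulrA ltr_pdivrMr ?ltr_wpDl // mulrC ltr_pM2l // ltrDl.
have q2 : e / 2 / (M + 1) * M <= e / 2.
  by rewrite mulrAC ler_pdivrMr ?ltr_wpDl // ler_pM2l // lerDl.
by move: h1 h2 q1 q2; lra.
Qed.

Section Ball.
Variables (R : realType) (n : nat) (z : cball n R).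
Local Notation mi := (mindex n).
Local Notation rho := (@rho n R).
Local Notation mle := (@mle n).

Lemma monom0 : monom z (mi0 n) = 1.
Proof. by rewrite /monom big1 // => i _; rewrite ffunE expr0. Qed.

Lemma monomD k l : monom z (madd k l) = monom z k * monom z l.
Proof.
by rewrite /monom -big_split; apply: eq_bigr => i _; rewrite ffunE exprD.
Qed.

Lemma monom_unit i : monom z (munit i) = coor z i.
Proof.
rewrite /monom (bigD1 i) //= ffunE eqxx expr1 big1 ?mulr1 // => j /negPf ji.
by rewrite ffunE ji expr0.
Qed.

Lemma rabs_monom k : rabs (monom z k) = \prod_i rabs (coor z i) ^+ k i.
Proof. by rewrite rabs_prod; apply: eq_bigr => i _; rewrite rabsX. Qed.

Definition znorm : R := Num.sqrt (\sum_i rabs (coor z i) ^+ 2).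

Lemma znorm_sqr : znorm ^+ 2 = \sum_i rabs (coor z i) ^+ 2.
Proof. by rewrite sqr_sqrtr //; apply: sumr_ge0 => i _; apply: sqr_ge0. Qed.

Lemma znorm_ge0 : 0 <= znorm. Proof. exact: sqrtr_ge0. Qed.

Lemma znorm_lt1 : znorm < 1.
Proof.
rewrite -(@ltr_pXn2r _ 2) ?nnegrE ?znorm_ge0 // expr1n znorm_sqr.
have := valP z; rewrite /ball_pred; under eq_bigr do rewrite rabsE -rcX.
by rewrite -rc_sum (ltcR _ 1).
Qed.

Lemma row_bound_real (a : 'I_n -> R) (c : R) : 0 <= c ->
  \sum_i a i ^+ 2 <= c ^+ 2 -> \sum_i rabs (coor z i) * a i <= znorm * c.
Proof.
move=> c0 ac; apply: le_trans (ler_norm _) _.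
rewrite -(@ler_pXn2r _ 2) ?nnegrE ?mulr_ge0 ?znorm_ge0 //.
rewrite real_normK ?num_real // exprMn znorm_sqr.
apply: le_trans (sum_mul_le_sqr _ _ _ _) _; apply: ler_wpM2l => //.
by apply: sumr_ge0 => i _; apply: sqr_ge0.
Qed.

Lemma row_bound (V : normedModType R[i]) (v : 'I_n -> V) (c : R) : 0 <= c ->
  \sum_i nm (v i) ^+ 2 <= c ^+ 2 -> nm (\sum_i coor z i *: v i) <= znorm * c.
Proof.
move=> c0 /(row_bound_real c0); apply: le_trans.
by apply: le_trans (ler_nm_sum _ _ _) _; apply: ler_sum => i _; rewrite nmZ.
Qed.

(** The full sum is the reproducing kernel of exponent q on the diagonal. The bound is
    [big_rho_bound] on a one-point space. *)
Lemma rho_monom_bound q d :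
  \sum_(k <- mle d) rho q k * rabs (monom z k) ^+ 2 <= (1 - znorm ^+ 2)^-1 ^+ q.
Proof.
have r1 : 0 <= znorm ^+ 2 < 1.
  by rewrite sqr_ge0 /= expr_lt1 // ?znorm_ge0 ?znorm_lt1.
have tr (x : unit) : \sum_i rabs (coor z i) ^+ 2 * 1 <= znorm ^+ 2 * 1.
  by rewrite znorm_sqr mulr1; under eq_bigr do rewrite mulr1.
have := @big_rho_bound R n unit (fun=> 1) (fun=> id) (fun=> id)
  (fun i => rabs (coor z i) ^+ 2) (znorm ^+ 2) (fun=> ler01) (fun=> erefl)
  (fun _ _ _ => erefl) (fun i => sqr_ge0 _) r1 tr q d tt.
rewrite mulr1; apply: le_trans.
rewrite le_eqVlt; apply/orP; left; apply/eqP; apply: eq_bigr => k _.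
rewrite mulr1 rabs_monom -prodrXl; congr (_ * _).
by apply: eq_bigr => i _; rewrite exprAC.
Qed.

Lemma rho_monom_ge0 q k : 0 <= rho q k * rabs (monom z k) ^+ 2.
Proof. by rewrite mulr_ge0 ?rho_ge0 ?sqr_ge0. Qed.

Lemma eval_sqr_bound (V : normedModType R[i]) q (a : mi -> V) (s : seq mi) :
  nm (\sum_(k <- s) monom z k *: a k) ^+ 2
   <= (\sum_(k <- s) rho q.+1 k * rabs (monom z k) ^+ 2)
      * \sum_(k <- s) nm (a k) ^+ 2 / rho q.+1 k.
Proof.
apply: le_trans (nm_sum_sqr_le (w := fun k => rho q.+1 k) _ _ _ _ _) _.
  by move=> k; apply: rho_gt0.
by under eq_bigr do rewrite mulrC.
Qed.

Lemma eval_abs_bound (V : normedModType R[i]) q (a : mi -> V) (C : R) :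
  (forall d, \sum_(k <- mle d) nm (a k) ^+ 2 / rho q.+1 k <= C) ->
  forall d, \sum_(k <- mle d) nm (monom z k *: a k)
    <= Num.sqrt ((1 - znorm ^+ 2)^-1 ^+ q.+1 * C).
Proof.
move=> aC d.
have C0 : 0 <= C.
  apply: le_trans (aC 0%N); apply: sumr_ge0 => k _.
  by rewrite divr_ge0 ?sqr_ge0 ?rho_ge0.
have c0 : 0 <= (1 - znorm ^+ 2)^-1 ^+ q.+1.
  by rewrite exprn_ge0 // invr_ge0 subr_ge0 expr_le1 ?znorm_ge0 // ltW // znorm_lt1.
rewrite -(@ler_pXn2r _ 2) ?nnegrE ?sqrtr_ge0 //; last by apply: sumr_ge0 => k _; apply: nm_ge0.
rewrite sqr_sqrtr ?mulr_ge0 //.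
rewrite (eq_bigr (fun k => (Num.sqrt (rho q.+1 k) * rabs (monom z k))
    * (nm (a k) / Num.sqrt (rho q.+1 k)))); last first.
  move=> k _; rewrite nmZ; field.
  by rewrite gt_eqF // sqrtr_gt0 rho_gt0.
apply: le_trans (sum_mul_le_sqr _ _ _ _) _; apply: ler_pM.
- by apply: sumr_ge0 => k _; apply: sqr_ge0.
- by apply: sumr_ge0 => k _; apply: sqr_ge0.
- under eq_bigr do rewrite exprMn sqr_sqrtr ?rho_ge0 //.
  exact: rho_monom_bound.
- under eq_bigr do rewrite exprMn exprVn sqr_sqrtr ?rho_ge0 //.
  exact: aC.
Qed.

Lemma eval_exists (V : completeNormedModType R[i]) q (a : mi -> V) (C : R) :
  (forall d, \sum_(k <- mle d) nm (a k) ^+ 2 / rho q.+1 k <= C) ->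
  exists s, has_sum (fun k => monom z k *: a k) s.
Proof. by move=> /eval_abs_bound aC; apply: has_sum_exists aC. Qed.

End Ball.

(** * The resolvent and the transfer function at a point of the ball *)

Section Evaluation.
Variables (R : realType) (m n : nat) (H E : hilbertType R) (T : 'I_n -> H -> H).
Variables (B : E -> 'I_n -> H) (D : E -> mindex n -> H).
Hypotheses (m0 : (0 < m)%N).
Hypotheses (hT : commuting_tuple T) (triple : characteristic_triple T m B D).
Variable z : cball n R.
Local Notation mi := (mindex n).
Local Notation rho := (@rho n R).
Local Notation mle := (@mle n).
Local Notation U := (block_op T m B D).
Local Notation F := (defect_space T m).
Local Notation A i := (adj (T i)).
Local Notation p := m.-1.

Let UL := block_linear triple.
Let UI := block_isometric triple.
Let AL := adj_linear triple.

Definition ZA (x : H) : H := Zrow z (row_adj T x).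

Lemma ZA_linear (a : R[i]) x y : ZA (a *: x + y) = a *: ZA x + ZA y.
Proof.
rewrite /ZA /Zrow scaler_sumr -big_split; apply: eq_bigr => i _ /=.
by rewrite /row_adj AL scalerDr !scalerA mulrC.
Qed.

Lemma ZA_bound x : nm (ZA x) <= znorm z * nm x.
Proof. exact: row_bound (nm_ge0 x) (adj_contraction triple x). Qed.

Lemma resolvent_abs_bound q x d :
  \sum_(k <- mle d) nm (((rho q k)%:C * monom z k) *: adj_pow T k x)
    <= (1 - znorm z)^-1 ^+ q * nm x.
Proof.
have r1 : 0 <= znorm z < 1 by rewrite znorm_ge0 znorm_lt1.
have := big_rho_bound (@nm_ge0 R H) (adj_pow0 T)
  (adj_powE hT triple) (fun i => rabs_ge0 (coor z i)) r1
  (fun x => row_bound_real z (nm_ge0 x) (adj_contraction triple x)) q d x.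
apply: le_trans; apply: ler_sum => k _.
by rewrite nmZ rabsM rabsr ger0_norm ?rho_ge0 // rabs_monom mulrA.
Qed.

(** By [rho_pascal], I - ZT^* maps the series with weights rho_{q+1} to the one with weights rho_q.
    Since ZT^* raises the degree by one, truncation at d + 1 is compared with the image of
    truncation at d. *)
Lemma resolvent_step q (x y y' : H) :
  has_sum (fun k => ((rho q k)%:C * monom z k) *: adj_pow T k x) y ->
  has_sum (fun k => ((rho q.+1 k)%:C * monom z k) *: adj_pow T k x) y' ->
  y' - ZA y' = y.
Proof.
pose S q d := \sum_(k <- mle d) ((rho q k)%:C * monom z k) *: adj_pow T k x.
move=> /has_sum_cvg_mle yq /has_sum_cvg_mle yq'.
have h1 := linear_map_cvg ZA_linear ZA_bound (FG := eventually_filter) yq'.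
have shift : S q \o addn^~ 1%N @ \oo --> y.
  by apply: cvg_comp yq; apply: cvg_addnr.
have shift' : S q.+1 \o addn^~ 1%N @ \oo --> y'.
  by apply: cvg_comp yq'; apply: cvg_addnr.
apply/eqP; rewrite subr_eq; apply/eqP.
apply: (cvg_unique (@norm_hausdorff _ H) shift').
rewrite (_ : S q.+1 \o _ = (S q \o addn^~ 1%N) + (ZA \o S q.+1)); first exact: cvgD shift h1.
apply/funext => d; rewrite [RHS]/GRing.add /= addn1 /S.
rewrite (@big_rho_pascal R n H d q (fun c k => (c%:C * monom z k) *: adj_pow T k x)).
- congr (_ + _); rewrite /ZA /Zrow.
  under [RHS]eq_bigr => i _ do
    rewrite /row_adj (linear_map_sum (AL i)) scaler_sumr.
  rewrite [RHS]exchange_big; apply: eq_bigr => k _; apply: eq_bigr => i _.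
  by rewrite (adj_powS hT triple) scalerA monomD monom_unit mulrCA.
- by move=> k a b; rewrite rcD mulrDl scalerDl.
- by move=> k; rewrite mul0r scale0r.
Qed.

Lemma id_sub_ZA_inj x y : x - ZA x = y - ZA y -> x = y.
Proof.
move=> xy; apply/eqP; rewrite -subr_eq0 -nm_eq0; apply/eqP.
have e : x - y = ZA (x - y).
  rewrite (linear_mapB ZA_linear); move/eqP: xy.
  by rewrite subr_eq addrAC -addrA addrC -subr_eq => /eqP.
have := ZA_bound (x - y); rewrite -e => le1.
have := nm_ge0 (x - y); rewrite le_eqVlt => /orP[/eqP //|pos].
by move: le1; rewrite -ler_pdivrMr // divff ?gt_eqF // leNgt znorm_lt1.
Qed.

Lemma resolvent_exists q (x : H) :
  exists y : H, has_sum (fun k => ((rho q k)%:C * monom z k) *: adj_pow T k x) y.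
Proof. exact: has_sum_exists (resolvent_abs_bound q x). Qed.

Lemma resolvent_sum0 x :
  has_sum (fun k => ((rho 0 k)%:C * monom z k) *: adj_pow T k x) x.
Proof.
apply/has_sumP => e e0; exists 0%N => J J0.
rewrite (big_fsetD1 (mi0 n)) /=; last by apply: J0; rewrite mem_mle mdegree0.
rewrite rho_mi0 monom0 mul1r scale1r adj_pow0 big1_fset ?addr0 ?subrr ?nm0 //.
by move=> k; rewrite !inE => /andP[/negPf k0 _] _; rewrite rho0E k0 mul0r scale0r.
Qed.

Definition resolvent : H -> H := opinv (fun x => x - ZA x).

(** Surjectivity is the case q = 0 of [resolvent_step], the Neumann series, and injectivity comes
    from |z| < 1; so the choice made by [opinv] is a true inverse. *)
Lemma resolventK : cancel (fun x => x - ZA x) resolvent /\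
  cancel resolvent (fun x => x - ZA x).
Proof.
have surj x : exists y, y - ZA y = x.
  have [y yP] := resolvent_exists 1 x; exists y.
  exact: resolvent_step (@resolvent_sum0 x) yP.
have [g gP] := choice surj.
rewrite /resolvent /opinv; set P := [set A' | _].
suff : P (xget 0 P) by [].
by apply: xgetPex; exists g; split=> // x; apply: id_sub_ZA_inj; rewrite gP.
Qed.

Lemma resolvent_sum q x :
  has_sum (fun k => ((rho q k)%:C * monom z k) *: adj_pow T k x) (iter q resolvent x).
Proof.
elim: q => [|q IH]; first exact: resolvent_sum0.
have [y yP] := resolvent_exists q.+1 x.
by rewrite /= -(resolvent_step IH yP) (resolventK.1 y).
Qed.

Lemma resolvent_linear (a : R[i]) x y :
  resolvent (a *: x + y) = a *: resolvent x + resolvent y.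
Proof.
apply: id_sub_ZA_inj; rewrite (resolventK.2 _) ZA_linear opprD addrACA -scalerBr.
by rewrite !(resolventK.2 _).
Qed.

Lemma iter_resolvent_linear q (a : R[i]) x y :
  iter q resolvent (a *: x + y) = a *: iter q resolvent x + iter q resolvent y.
Proof. by elim: q => //= q ->; rewrite resolvent_linear. Qed.

Lemma defect_resolvent_linear (a : R[i]) x y :
  defect_resolvent T m z (a *: x + y)
    = a *: defect_resolvent T m z x + defect_resolvent T m z y.
Proof.
by rewrite /defect_resolvent iter_resolvent_linear (defect_linear triple).
Qed.

Let defect1 x : nm (defect T m x) <= 1 * nm x.
Proof. by rewrite mul1r (defect_contraction triple). Qed.

Lemma defect_iter_sum q x :
  has_sum (fun k => ((rho q k)%:C * monom z k) *: defect T m (adj_pow T k x))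
    (defect T m (iter q resolvent x)).
Proof.
exact: (linear_has_sum (defect_linear triple) defect1 (@resolvent_sum q x)).
Qed.

(* The terms of \Psi(z)(U u).2, where
   \Psi(z) a = \sum_k sqrt(\rho_{m-1}(k)) z^k a_k. *)
Definition transfer_term (u : H * E) (k : mi) : H :=
  ((Num.sqrt (rho p k))%:C * monom z k) *: (U u).2 k.

Local Notation w := (fun k => rho p k * rabs (monom z k) ^+ 2).
Local Notation c := ((1 - znorm z ^+ 2)^-1 ^+ p).

Lemma transfer_term_abs u (s : seq mi) : uniq s ->
  (\sum_(k <- s) nm (transfer_term u k)) ^+ 2
    <= (\sum_(k <- s) w k) * (nm u.1 ^+ 2 + nm u.2 ^+ 2).
Proof.
move=> us.
rewrite (eq_bigr (fun k => (Num.sqrt (rho p k) * rabs (monom z k)) * nm ((U u).2 k))); last first.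
  by move=> k _; rewrite nmZ rabsM rabsr ger0_norm ?sqrtr_ge0.
apply: le_trans (sum_mul_le_sqr _ _ _ _) _; apply: ler_pM.
- by apply: sumr_ge0 => k _; apply: sqr_ge0.
- by apply: sumr_ge0 => k _; apply: sqr_ge0.
- by under eq_bigr do rewrite exprMn sqr_sqrtr ?rho_ge0 //.
- apply: le_trans (ler_fset_msup _ (UI u).1 us) _ => [k|]; first exact: sqr_ge0.
  exact: msup_le (UI u).1.
Qed.

Lemma sqr_sum_le (a b : R) : 0 <= a -> 0 <= b -> a ^+ 2 + b ^+ 2 <= (a + b) ^+ 2.
Proof. by move=> a0 b0; rewrite sqrrD -addrA lerD2l lerDr mulrn_wge0 // mulr_ge0. Qed.

Lemma transfer_term_abs_sqrt u (s : seq mi) (b : R) : uniq s -> \sum_(k <- s) w k <= b ->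
  \sum_(k <- s) nm (transfer_term u k) <= Num.sqrt b * (nm u.1 + nm u.2).
Proof.
move=> us sb.
have w0 : 0 <= \sum_(k <- s) w k by apply: sumr_ge0 => k _; apply: rho_monom_ge0.
have b0 := le_trans w0 sb.
rewrite -(@ler_pXn2r _ 2) ?nnegrE ?mulr_ge0 ?addr_ge0 ?nm_ge0 ?sqrtr_ge0 //; last first.
  by apply: sumr_ge0 => k _; apply: nm_ge0.
apply: le_trans (transfer_term_abs u us) _; rewrite exprMn sqr_sqrtr //.
by apply: ler_pM => //; [rewrite addr_ge0 ?sqr_ge0|apply: sqr_sum_le; apply: nm_ge0].
Qed.

Let wC := rho_monom_bound z p.

Lemma transfer_term_exists u : exists s, has_sum (transfer_term u) s.
Proof.
by apply: has_sum_exists => d; apply: transfer_term_abs_sqrt (uniq_mle _ _) (wC d).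
Qed.

Definition transfer (u : H * E) : H := summability.sum (transfer_term u).

Lemma transfer_sum u : has_sum (transfer_term u) (transfer u).
Proof. by have [s us] := transfer_term_exists u; rewrite /transfer (has_sum_lim us). Qed.

(** The factor under the root depends on d but not on u: this uniformity is what allows [cvg_conv0]
    to be applied in [output_eval]. *)
Lemma transfer_tail u d :
  nm (transfer u - \sum_(k <- mle d) transfer_term u k)
    <= Num.sqrt (msup w - \sum_(k <- mle d) w k) * (nm u.1 + nm u.2).
Proof.
have cv : (fun d' => \sum_(k <- mle d') transfer_term u k
    - \sum_(k <- mle d) transfer_term u k) @ \oo
    --> transfer u - \sum_(k <- mle d) transfer_term u k.
  by apply: cvgB; [exact: has_sum_cvg_mle (@transfer_sum u)|exact: cvg_cst].
apply: (nm_le_lim _ cv); exists d => // d' /= dd'.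
rewrite (bigID (mem (mle d))) /= addrAC.
rewrite -[X in nm (X - _ + _)]big_filter [X in nm (X - _ + _)](perm_big (mle d)); last first.
  apply: uniq_perm => [||k]; [exact/filter_uniq/uniq_mle|exact: uniq_mle|].
  rewrite mem_filter; case: (boolP (k \in mle d)) => //= kd.
  exact: (sub_mle dd' kd).
rewrite subrr add0r; apply: le_trans (ler_nm_sum _ _ _) _; rewrite -[leLHS]big_filter.
apply: transfer_term_abs_sqrt; first exact/filter_uniq/uniq_mle.
apply: (tail_msup _ wC); first by move=> k; apply: rho_monom_ge0.
  exact/filter_uniq/uniq_mle.
by move=> k; rewrite mem_filter => /andP[].
Qed.

Lemma transfer_linear (a : R[i]) u v : transfer (a *: u + v) = a *: transfer u + transfer v.
Proof.
apply: has_sum_unique (@transfer_sum _) _.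
rewrite (_ : transfer_term _ = fun k => a *: transfer_term u k + transfer_term v k).
  exact: has_sumD (has_sumZ (@transfer_sum u)) (@transfer_sum v).
apply/funext => k; rewrite /transfer_term (collig2L UL) scalerDr !scalerA.
by congr (_ *: _ + _); rewrite mulrC.
Qed.

Lemma transfer_bound u : nm (transfer u) <= Num.sqrt c * (nm u.1 + nm u.2).
Proof.
apply: (nm_le_lim _ (has_sum_cvg_mle (@transfer_sum u))); apply: nearW => d.
apply: le_trans (ler_nm_sum _ _ _) _.
exact: transfer_term_abs_sqrt (uniq_mle _ _) (wC d).
Qed.

(** One factor sqrt(rho_{m-1}) comes from C and one from the transfer series; together they are the
    weights of the (m-1)-st power of the resolvent. *)
Lemma transfer_state x : transfer (x, 0) = defect T m (iter p resolvent x).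
Proof.
apply: has_sum_unique (@transfer_sum _) _.
have := @defect_iter_sum p x; congr has_sum; apply/funext => k.
rewrite /transfer_term (block2H triple) /Cmap scalerA; congr (_ *: _).
rewrite mulrAC -rcM -expr2 sqr_sqrtr ?rho_ge0 //.
Qed.

Lemma Phi_charE eta :
  Phi_char T m B D z eta = transfer (0, eta) + defect_resolvent T m z (Zrow z (B eta)).
Proof.
rewrite /Phi_char; congr (_ + _); congr summability.sum; apply/funext => k.
rewrite /transfer_term block2E /Cmap.
have -> : adj_pow T k 0 = 0.
  elim/mindex_unit_ind: k => [|k i IH]; first exact: adj_pow0.
  by rewrite (adj_powS hT triple) IH (linear_map0 (AL i)).
by rewrite (linear_map0 (defect_linear triple)) scaler0 add0r.
Qed.

Section OutputEvaluation.
Variables (h : H) (f : mi -> E) (fz : E) (C : R).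
Hypothesis fC : forall d, \sum_(k <- mle d) nm (f k) ^+ 2 / rho 1 k <= C.
Hypothesis fsum : has_sum (fun k => monom z k *: f k) fz.
Local Notation x := (state U h f).
Local Notation C1 := (Num.sqrt ((1 - znorm z ^+ 2)^-1 ^+ 1 * C)).

Lemma sum_U1_bound u :
  \sum_i rabs (coor z i) * nm ((U u).1 i) <= znorm z * (nm u.1 + nm u.2).
Proof.
apply: row_bound_real; first by rewrite addr_ge0 ?nm_ge0.
apply: le_trans (sqr_sum_le (nm_ge0 _) (nm_ge0 _)); rewrite -(UI u).2 lerDl.
exact: msup_ge0 (fun k => sqr_ge0 _) (UI u).1.
Qed.

(** The recursion gives S <= |h| + |z| (S + Sf) for the finite sum S, and |z| < 1 lets S be absorbed
    on the left. *)
Lemma state_abs d :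
  \sum_(k <- mle d) nm (monom z k *: x k) <= (nm h + C1) / (1 - znorm z).
Proof.
set S := \sum_(k <- _) _; set Sf := \sum_(k <- mle d) nm (monom z k *: f k).
have fb : Sf <= C1 by apply: eval_abs_bound fC d.
suff Sb : S <= nm h + znorm z * (S + Sf).
  rewrite ler_pdivlMr ?subr_gt0 ?znorm_lt1 //.
  have : znorm z * Sf <= C1.
    apply: le_trans fb; rewrite -[leRHS]mul1r.
    apply: ler_wpM2r; last exact/ltW/znorm_lt1.
    by apply: sumr_ge0 => k _; apply: nm_ge0.
  by move: Sb; lra.
pose G i l := rabs (coor z i) * (rabs (monom z l) * nm ((U (x l, f l)).1 i)).
apply: (@le_trans _ _ (\sum_(k <- mle d.+1) nm (monom z k *: x k))).
  apply: ler_big_subset; rewrite ?uniq_mle //; first exact/sub_mle/leqnSn.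
  by move=> k; apply: nm_ge0.
apply: (@le_trans _ _ (\sum_(k <- mle d.+1) ((if k == mi0 n then nm h else 0)
    + \sum_(i | mleq (munit i) k) G i (msub k (munit i))))).
  apply: ler_sum => k _; rewrite stateE scalerDr.
  apply: le_trans (ler_nmD _ _) (lerD _ _).
    by case: eqP => [->|_]; rewrite ?monom0 ?scale1r // scaler0 nm0.
  rewrite scaler_sumr; apply: le_trans (ler_nm_sum _ _ _) _.
  apply: ler_sum => i ik; rewrite nmZ /G.
  by rewrite -[in X in rabs (monom z X)](msubK ik) monomD monom_unit rabsM mulrA.
rewrite big_split big_mle0 /= big_mle_unit lerD2l /S /Sf -big_split mulr_sumr.
apply: ler_sum => l _ /=; rewrite /G !nmZ -mulrDr mulrCA.
rewrite (eq_bigr (fun i => rabs (monom z l) * (rabs (coor z i) * nm ((U (x l, f l)).1 i)))).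
  by rewrite -mulr_sumr ler_wpM2l ?rabs_ge0 // (sum_U1_bound (x l, f l)).
by move=> i _; rewrite mulrCA.
Qed.

Let B_linear (a : R[i]) e e' : Zrow z (B (a *: e + e')) = a *: Zrow z (B e) + Zrow z (B e').
Proof.
rewrite /Zrow scaler_sumr -big_split; apply: eq_bigr => i _ /=.
have [[[_ BL] _] _ _] := triple; rewrite (BL a e e' I I).
by rewrite -[X in _ *: X]/(a *: B e i + B e' i) scalerDr !scalerA mulrC.
Qed.

Let B_bound e : nm (Zrow z (B e)) <= znorm z * nm e.
Proof.
apply: row_bound (nm_ge0 e) _; have [_] := UI (0, e).
rewrite /= nm0 expr0n add0r => <-.
rewrite (eq_bigr (fun i => nm ((U (0, e)).1 i) ^+ 2)) => [|i _]; last first.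
  by rewrite block1E (linear_map0 (AL i)) add0r.
by rewrite lerDl (msup_ge0 (fun k => sqr_ge0 _) (UI (0, e)).1).
Qed.

Lemma state_eval_exists : exists X : H, has_sum (fun k => monom z k *: x k) X.
Proof. exact: has_sum_exists state_abs. Qed.

(** Summing the recursion against z^k gives X = h + ZT^* X + ZB f(z). *)
Lemma state_eval (X : H) : has_sum (fun k => monom z k *: x k) X ->
  X = resolvent (h + Zrow z (B fz)).
Proof.
move=> xsum; apply: id_sub_ZA_inj; rewrite (resolventK.2 _).
have cx := has_sum_cvg_mle xsum; have cf := has_sum_cvg_mle fsum.
have hA := linear_map_cvg ZA_linear ZA_bound (FG := eventually_filter) cx.
have hB := linear_map_cvg B_linear B_bound (FG := eventually_filter) cf.
have shift : (fun d => \sum_(k <- mle d) monom z k *: x k) \o addn^~ 1%N @ \oo --> X.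
  by apply: cvg_comp cx; apply: cvg_addnr.
apply/eqP; rewrite subr_eq -addrA [_ + ZA X]addrC; apply/eqP.
apply: (cvg_unique (@norm_hausdorff _ H) shift).
have hc : (fun _ : nat => h) @ \oo --> h by apply: cvg_cst.
rewrite (_ : _ \o _ = (fun=> h) + ((fun d => ZA (\sum_(k <- mle d) monom z k *: x k))
  + (fun d => Zrow z (B (\sum_(k <- mle d) monom z k *: f k))))).
  exact: cvgD hc (cvgD hA hB).
apply/funext => d; rewrite [RHS]/GRing.add /= [X in h + X]/GRing.add /= addn1.
pose G i l := coor z i *: (monom z l *: (U (x l, f l)).1 i).
transitivity (\sum_(k <- mle d.+1) ((if k == mi0 n then h else 0)
    + \sum_(i | mleq (munit i) k) G i (msub k (munit i)))).
  apply: eq_bigr => k _; rewrite stateE scalerDr; congr (_ + _).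
    by case: eqP => [->|_]; rewrite ?monom0 ?scale1r // scaler0.
  rewrite scaler_sumr; apply: eq_bigr => i ik; rewrite /G.
  by rewrite -[in X in monom z X *: _](msubK ik) monomD monom_unit scalerA.
rewrite big_split big_mle0 /= big_mle_unit; congr (_ + _).
rewrite (linear_map_sum ZA_linear) (linear_map_sum B_linear) -big_split.
apply: eq_bigr => l _ /=; rewrite -scalerDr /ZA /Zrow -big_split scaler_sumr.
apply: eq_bigr => i _ /=; rewrite /G block1E -scalerDr !scalerA mulrC.
by rewrite /row_adj.
Qed.

Lemma tail_sqrt_lt e : 0 < e -> exists j0, forall j, (j0 <= j)%N ->
  Num.sqrt (msup w - \sum_(k <- mle j) w k) < e.
Proof.
move=> e0; have [j0 j0P] := msup_adherent (wC) (exprn_gt0 2 e0).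
exists j0 => j j0j; rewrite -[e]gtr0_norm // -sqrtr_sqr ltr_sqrt ?exprn_gt0 //.
rewrite ltrBlDr -ltrBlDl; apply: lt_le_trans j0P _.
apply: ler_big_subset; rewrite ?uniq_mle //; first exact: sub_mle.
by move=> k; apply: rho_monom_ge0.
Qed.

(** The truncated output series runs over |l| + |k| <= d, whereas the approximation V of the limit
    runs over |l| <= d and all k. The difference is dominated by a convolution of the summable v
    with the tails of the transfer series. *)
Lemma output_eval :
  has_sum (fun K => monom z K *: output p U h f K)
    (Pi_dil T m h z + Phi_char T m B D z fz).
Proof.
have outC d : \sum_(K <- mle d) nm (output p U h f K) ^+ 2 / rho p.+1 K <= nm h ^+ 2 + C.
  apply: le_trans (output_contraction p UI h f d) _.
  by rewrite lerD2l.
have [s osum] := eval_exists z outC; have [X xsum] := state_eval_exists.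
suff <- : s = Pi_dil T m h z + Phi_char T m B D z fz by [].
(* X already contains one of the m resolvents; [transfer] supplies the other m - 1. *)
have -> : Pi_dil T m h z + Phi_char T m B D z fz = transfer (X, 0) + transfer (0, fz).
  rewrite Phi_charE addrCA [RHS]addrC; congr (_ + _).
  have := defect_resolvent_linear 1 h (Zrow z (B fz)); rewrite !scale1r => <-.
  rewrite /defect_resolvent transfer_state -/(ZA _) (state_eval xsum).
  by rewrite -iterSr prednK.
pose u l := (x l, f l).
pose V d := transfer (\sum_(l <- mle d) monom z l *: x l, 0)
  + transfer (0, \sum_(l <- mle d) monom z l *: f l).
have cx := has_sum_cvg_mle xsum; have cf := has_sum_cvg_mle fsum.
have tl1 (a : R[i]) (v v' : H) :
    transfer (a *: v + v', 0) = a *: transfer (v, 0) + transfer (v', 0).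
  rewrite -transfer_linear; congr transfer.
  by rewrite -[RHS]/(a *: v + v', a *: 0 + 0) scaler0 addr0.
have tl2 (a : R[i]) (v v' : E) :
    transfer (0, a *: v + v') = a *: transfer (0, v) + transfer (0, v').
  rewrite -transfer_linear; congr transfer.
  by rewrite -[RHS]/(a *: 0 + 0, a *: v + v') scaler0 addr0.
have tb1 (v : H) : nm (transfer (v, 0)) <= Num.sqrt c * nm v.
  by have := transfer_bound (v, 0); rewrite /= nm0 addr0.
have tb2 (v : E) : nm (transfer (0, v)) <= Num.sqrt c * nm v.
  by have := transfer_bound (0, v); rewrite /= nm0 add0r.
have cV : V @ \oo --> transfer (X, 0) + transfer (0, fz).
  exact: cvgD (linear_map_cvg tl1 tb1 cx) (linear_map_cvg tl2 tb2 cf).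
have VE d : V d = \sum_(l <- mle d) monom z l *: transfer (u l).
  rewrite /V (linear_map_sum tl1) (linear_map_sum tl2) -big_split.
  apply: eq_bigr => l _ /=; rewrite -scalerDr; congr (_ *: _).
  have := transfer_linear 1 (x l, 0) (0, f l); rewrite !scale1r => <-.
  by congr transfer; rewrite -[LHS]/(x l + 0, 0 + f l) addr0 add0r.
have SE d : \sum_(K <- mle d) monom z K *: output p U h f K
    = \sum_(l <- mle d) monom z l *: \sum_(k <- mle (d - mdegree l)) transfer_term (u l) k.
  pose G l k := monom z l *: transfer_term (u l) k.
  transitivity (\sum_(K <- mle d) \sum_(l <- below K) G l (msub K l)).
    apply: eq_bigr => K _; rewrite /output scaler_sumr; apply: eq_big_seq => l.
    rewrite mem_below => lK; rewrite /G /transfer_term !scalerA.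
    rewrite -[in X in monom z X](msubK lK) monomD; congr (_ *: _).
    by rewrite -mulrA [X in _ * X]mulrC.
  by rewrite big_mle_conv; apply: eq_bigr => l _; rewrite scaler_sumr.
apply: (cvg_unique (@norm_hausdorff _ H) (has_sum_cvg_mle osum)).
pose v l := rabs (monom z l) * (nm (x l) + nm (f l)).
have v0 l : 0 <= v l by rewrite mulr_ge0 ?rabs_ge0 ?addr_ge0 ?nm_ge0.
have vC d : \sum_(l <- mle d) v l <= (nm h + C1) / (1 - znorm z) + C1.
  rewrite (eq_bigr (fun l => nm (monom z l *: x l) + nm (monom z l *: f l))) => [|l _].
    by rewrite big_split lerD ?state_abs // eval_abs_bound.
  by rewrite /v mulrDr !nmZ.
have tauM j : 0 <= Num.sqrt (msup w - \sum_(k <- mle j) w k) <= Num.sqrt c.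
  rewrite sqrtr_ge0 /= ler_wsqrtr // lerBlDr; apply: le_trans (msup_le (wC)) _.
  by rewrite lerDl; apply: sumr_ge0 => k _; apply: rho_monom_ge0.
apply/nm_cvgP => e e0; have e2 : 0 < e / 2 by rewrite divr_gt0.
have [d0 d0P] := cvg_conv0 v0 vC tauM tail_sqrt_lt e2.
have /nm_cvgP/(_ _ e2)[d1 _ d1P] := cV.
exists (maxn d0 d1) => // d /=; rewrite geq_max => /andP[/d0P dd0 /d1P /= dd1].
rewrite -(subrK (V d) (transfer _ + _)) -addrA.
apply: le_lt_trans (ler_nmD _ _) _.
suff : nm (V d - \sum_(K <- mle d) monom z K *: output p U h f K) < e / 2.
  by move: dd1; lra.
apply: le_lt_trans dd0; rewrite VE SE -sumrB; apply: le_trans (ler_nm_sum _ _ _) _.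
apply: ler_sum => l _; rewrite -scalerBr nmZ /v -mulrA ler_wpM2l ?rabs_ge0 // mulrC.
exact: transfer_tail.
Qed.

End OutputEvaluation.

End Evaluation.

(** * The canonical dilation is isometric *)

Section CauchySchwarz.
Variables (R : realType) (H : hilbertType R).
Implicit Types x y : H.

Lemma dotZr a x y : dot x (a *: y) = Num.conj a * dot x y.
Proof. by rewrite dotC dotZl rmorphM /= -dotC. Qed.

Lemma rabs_dot_le x y : rabs (dot x y) <= nm x * nm y.
Proof.
have [->|y0] := eqVneq y 0; first by rewrite dot0r nm0 mulr0 /rabs normr0.
have ny : 0 < nm y by rewrite lt_neqAle nm_ge0 andbT eq_sym nm_eq0.
pose a := dot x y / (nm y ^+ 2)%:C.
have e : dot (x - a *: y) (x - a *: y)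
    = (nm x ^+ 2 - rabs (dot x y) ^+ 2 / nm y ^+ 2)%:C.
  rewrite dotBr dotBl dotZr dotBl !dotZl !dot_sqr.
  have -> : a * (nm y ^+ 2)%:C = dot x y.
    by rewrite /a mulfVK // -(rmorph0 (real_complex R)) (inj_eq (@complexI R)) sqrf_eq0 gt_eqF.
  rewrite subrr mulr0 subr0 [dot y x]dotC rcB; congr (_ - _).
  by rewrite /a mulrAC rcM rcV !rcX -rabsE -normCK.
rewrite -(@ler_pXn2r _ 2) ?nnegrE ?mulr_ge0 ?nm_ge0 ?rabs_ge0 // exprMn.
rewrite -ler_pdivrMr ?exprn_gt0 // -subr_ge0.
by have := dot_sqr (x - a *: y); rewrite e => /complexI ->; apply: sqr_ge0.
Qed.

End CauchySchwarz.

Section DilationNorm.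
Variables (R : realType) (m n : nat) (H E : hilbertType R) (T : 'I_n -> H -> H).
Variables (B : E -> 'I_n -> H) (D : E -> mindex n -> H).
Hypotheses (m0 : (0 < m)%N) (pureT : pure T).
Hypotheses (hT : commuting_tuple T) (triple : characteristic_triple T m B D).
Local Notation mi := (mindex n).
Local Notation rho := (@rho n R).
Local Notation mle := (@mle n).
Local Notation U := (block_op T m B D).
Local Notation A i := (adj (T i)).
Local Notation p := m.-1.

Let UL := block_linear triple.
Let UI := block_isometric triple.
Let AL := adj_linear triple.

Lemma state_H h k : state U h (fun=> 0) k = (rho 1 k)%:C *: adj_pow T k h.
Proof.
suff -> : state U h (fun=> 0) = fun k => (rho 1 k)%:C *: adj_pow T k h by [].
apply/esym/state_unique => {}k; rewrite rho_pascal rho0E rcD scalerDl; congr (_ + _).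
  by case: eqP => [->|_]; rewrite ?scale1r ?adj_pow0 ?scale0r.
rewrite rc_sum scaler_suml; apply: eq_bigr => i ik.
set j := msub k (munit i); rewrite (block1H triple).
have -> : adj_pow T k h = A i (adj_pow T j h) by rewrite -(adj_powS hT triple) msubK.
by have := AL i (rho 1 j)%:C (adj_pow T j h) 0; rewrite (linear_map0 (AL i)) !addr0 => ->.
Qed.

(** With zero input the convolution of rho_1 and rho_{m-1} produces rho_m, the weight in the Taylor
    coefficients of Pi_m h. *)
Lemma output_H h K : output p U h (fun=> 0) K
  = (rho m K)%:C *: defect T m (adj_pow T K h).
Proof.
have -> : rho m K = rho p.+1 K by rewrite prednK.
rewrite /output rho_conv rc_sum scaler_suml.
apply: eq_big_seq => l; rewrite mem_below => lK.
rewrite state_H (block2H triple).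
rewrite -[_ *: adj_pow T l h]addr0 (Cmap_linear triple).
have -> : Cmap T m 0 (msub K l) = 0.
  by have := Cmap_linear triple (-1) 0 0 (msub K l); rewrite scaler0 add0r scaleN1r addNr.
rewrite addr0 /Cmap -(adj_powD hT triple) maddC msubK // !scalerA -!rcM.
congr (_%:C *: _).
 set s := Num.sqrt _.
have <- : s ^+ 2 = rho p (msub K l) by rewrite sqr_sqrtr ?rho_ge0.
by ring.
Qed.

(** This is the sum over j <= d of <sigma_T^j(I) x, x>, so purity controls the increments of Q. *)
Let Q d x := \sum_(k <- mle d) rho 1 k * nm (adj_pow T k x) ^+ 2.

Lemma Q0 x : Q 0 x = nm x ^+ 2.
Proof.
rewrite /Q (eq_big_seq (fun k => if k == mi0 n then nm x ^+ 2 else 0)).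
  exact: big_mle0.
move=> k; rewrite mem_mle leqn0 mdegree_eq0 => /eqP ->.
by rewrite eqxx rho_mi0 mul1r adj_pow0.
Qed.

Lemma QS d x : Q d.+1 x = nm x ^+ 2 + \sum_i Q d (A i x).
Proof.
rewrite /Q (big_rho1 (fun k => nm (adj_pow T k x) ^+ 2)) adj_pow0; congr (_ + _).
rewrite exchange_big; apply: eq_bigr => l _ /=; rewrite mulr_sumr.
by apply: eq_bigr => i _; rewrite (adj_powE hT triple).
Qed.

Lemma sigma0 d : iter d (sigma T) id 0 = 0.
Proof.
elim: d => //= d IH; rewrite /sigma big1 // => i _.
by rewrite (linear_map0 (AL i)) IH (tuple_op0 hT).
Qed.

Lemma Q_sigma d x : (Q d.+1 x - Q d x)%:C = dot (iter d.+1 (sigma T) id x) x.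
Proof.
elim: d x => [|d IH] x.
  rewrite QS Q0 addrAC subrr add0r /= /sigma dot_suml rc_sum.
  by apply: eq_bigr => i _; rewrite Q0 (dot_tuple_adj hT) dot_sqr.
rewrite QS [Q d.+1 x]QS opprD addrACA subrr add0r -sumrB rc_sum.
rewrite [iter _ _ _]iterS {1}/sigma dot_suml; apply: eq_bigr => i _.
by rewrite IH (dot_tuple_adj2 hT) // sigma0.
Qed.

Lemma Q_increment_cvg x : Q d.+1 x - Q d x @[d --> \oo] --> (0 : R).
Proof.
have sx : iter d.+1 (sigma T) id x @[d --> \oo] --> (0 : H).
  have := pureT x; rewrite -(cvg_shiftS (fun d => iter d (sigma T) id x)).
  by [].
apply/cvgrPdist_lt => e e0.
have c0 : 0 < nm x + 1 by rewrite ltr_wpDl ?nm_ge0.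
have e1 : 0 < e / (nm x + 1) by rewrite divr_gt0.
move/nm_cvgP: sx => /(_ _ e1); apply: filterS => d; rewrite sub0r nmN => de.
rewrite sub0r normrN -rabsr Q_sigma; apply: le_lt_trans (rabs_dot_le _ _) _.
apply: (@le_lt_trans _ _ (nm (iter d.+1 (sigma T) id x) * (nm x + 1))).
  by rewrite ler_wpM2l ?nm_ge0 // lerDl.
by rewrite -ltr_pdivlMr.
Qed.

(* Unitarity gives |C A^l h|^2 = |A^l h|^2 - \sum_i |A_i A^l h|^2; weighted by
   \rho_1(l) the sum over l telescopes, and the remainder vanishes by purity. *)
Lemma dilation_norm_ge h (C : R) :
  (forall d, \sum_(K <- mle d) nm (output p U h (fun=> 0) K) ^+ 2 / rho m K <= C) ->
  nm h ^+ 2 <= C.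
Proof.
move=> hC; pose P l j := \sum_(k <- mle j) nm (Cmap T m (adj_pow T l h) k) ^+ 2.
pose S l := msup (fun k => nm (Cmap T m (adj_pow T l h) k) ^+ 2).
have nonneg l k : 0 <= nm (Cmap T m (adj_pow T l h) k) ^+ 2 by apply: sqr_ge0.
have sumE d : \sum_(K <- mle d) nm (output p U h (fun=> 0) K) ^+ 2 / rho m K
    = \sum_(l <- mle d) \sum_(k <- mle (d - mdegree l))
        rho 1 l * nm (Cmap T m (adj_pow T l h) k) ^+ 2.
  rewrite -(big_mle_conv d (fun l k => rho 1 l * nm (Cmap T m (adj_pow T l h) k) ^+ 2)).
  apply: eq_bigr => K _; rewrite output_H.
  rewrite (eq_big_seq (fun l => rho 1 l * rho p (msub K l) * nm (defect T m (adj_pow T K h)) ^+ 2)).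
    rewrite -mulr_suml -rho_conv prednK // nmZ rabsr ger0_norm ?rho_ge0 //.
    by field; rewrite -(prednK m0) gt_eqF ?rho_gt0.
  move=> l; rewrite mem_below => lK; rewrite /Cmap -(adj_powD hT triple) maddC msubK //.
  by rewrite nmZ rabsr ger0_norm ?sqrtr_ge0 // exprMn sqr_sqrtr ?rho_ge0 // mulrA.
(* The rectangle |l| <= d0, |k| <= j lies in the triangle |l| + |k| <= d0 + j. *)
have step d0 j : \sum_(l <- mle d0) rho 1 l * P l j <= C.
  apply: le_trans (hC (d0 + j)%N); rewrite sumE.
  apply: (@le_trans _ _ (\sum_(l <- mle (d0 + j) | l \in mle d0) rho 1 l * P l j)).
    rewrite -[leRHS]big_filter le_eqVlt; apply/orP; left; apply/eqP.
    apply: perm_big; apply: uniq_perm => [||k]; [exact: uniq_mle|exact/filter_uniq/uniq_mle|].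
    rewrite [RHS]mem_filter; case: (boolP (k \in mle d0)) => //= kd.
    by rewrite (sub_mle (leq_addr j d0) kd).
  rewrite [leRHS](bigID (mem (mle d0))) /= -[leLHS]addr0; apply: lerD.
    apply: ler_sum => l; rewrite mem_mle => ld; rewrite -mulr_sumr ler_wpM2l ?rho_ge0 //.
    apply: ler_big_subset; rewrite ?uniq_mle //; apply: sub_mle.
    by rewrite -addnBAC // leq_addl.
  apply: sumr_ge0 => l _; apply: sumr_ge0 => k _.
  by rewrite mulr_ge0 ?rho_ge0.
(* For fixed d0, letting j grow replaces P by the full squared norm S. *)
have stepS d0 : \sum_(l <- mle d0) rho 1 l * S l <= C.
  have cv : \sum_(l <- mle d0) rho 1 l * P l j @[j --> \oo]
      --> \sum_(l <- mle d0) rho 1 l * S l.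
    apply: cvg_sum_seq => l; apply: cvgMr.
    exact: cvg_msup (nonneg l) (Cmap_bound triple _).
  by apply: (cvgr_to_le cv); apply: nearW => j; apply: step.
have tele d0 : \sum_(l <- mle d0) rho 1 l * S l = nm h ^+ 2 - (Q d0.+1 h - Q d0 h).
  rewrite {1}/Q (big_rho1 (fun k => nm (adj_pow T k h) ^+ 2)) adj_pow0.
  rewrite (eq_bigr (fun l => rho 1 l * nm (adj_pow T l h) ^+ 2
    - rho 1 l * \sum_i nm (adj_pow T (madd (munit i) l) h) ^+ 2)).
    by rewrite sumrB -/(Q d0 h); ring.
  move=> l _; rewrite -mulrBr -(Cmap_norm triple (adj_pow T l h)); congr (_ * _).
  rewrite addrAC [X in _ - X + _](eq_bigr (fun i =>
    nm (A i (adj_pow T l h)) ^+ 2)) ?subrr ?add0r //.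
  by move=> i _; rewrite (adj_powS hT triple).
have cv : nm h ^+ 2 - (Q d.+1 h - Q d h) @[d --> \oo] --> nm h ^+ 2 - 0.
  by apply: cvgB; [exact: cvg_cst|exact: Q_increment_cvg].
rewrite -[leLHS]subr0; apply: (cvgr_to_le cv); apply: nearW => d.
by rewrite -tele.
Qed.

End DilationNorm.

(** * Uniqueness of power series coefficients *)

Lemma digits_inj n b (f g : 'I_n -> nat) :
  (forall i, f i < b)%N -> (forall i, g i < b)%N ->
  (\sum_i f i * b ^ i = \sum_i g i * b ^ i)%N -> f =1 g.
Proof.
elim: n f g => [|n IH] f g fb gb; first by move=> _ [].
rewrite !big_ord_recl /= !expn0 !muln1.
have tl (h : 'I_n.+1 -> nat) : (\sum_(i < n) h (lift ord0 i) * b ^ lift ord0 i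
    = (\sum_(i < n) h (lift ord0 i) * b ^ i) * b)%N.
  rewrite big_distrl; apply: eq_bigr => i _.
  by rewrite /= /bump /= add1n expnSr mulnA.
rewrite !tl => e.
have b0 : (0 < b)%N by apply: leq_ltn_trans (fb ord0).
have e0 : f ord0 = g ord0.
  move/(congr1 (modn^~ b)): e => /=.
  by rewrite ![(_ + _ * b)%N]addnC !modnMDl !modn_small.
move: e; rewrite e0 => /addnI/eqP; rewrite eqn_pmul2r // => /eqP e i.
case: (unliftP ord0 i) => [j ->|-> //].
by apply: (IH (fun j => f (lift ord0 j)) (fun j => g (lift ord0 j))).
Qed.

Section SeparatingWeight.
Variable n : nat.
Local Notation mi := (mindex n).

(* Positive weights for which a unique index of [S] has minimal total weight:
   the common summand forces minimal degree, and the powers of d + 1 separate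
   the indices of degree at most d. *)
Lemma separating_weight (S : mi -> Prop) : (exists k, S k) ->
  exists (wt : 'I_n -> nat) (k : mi), [/\ forall i, (0 < wt i)%N, S k &
    forall l, S l -> l <> k -> (\sum_i k i * wt i < \sum_i l i * wt i)%N].
Proof.
move=> [k1 Sk1].
have exd : exists d, `[< exists2 k, S k & mdegree k = d >].
  by exists (mdegree k1); apply/asboolP; exists k1.
case: (ex_minnP exd) => d /asboolP[k2 Sk2 k2d] dmin.
have Sd l : S l -> (d <= mdegree l)%N.
  by move=> Sl; apply: dmin; apply/asboolP; exists l.
pose N (k : mi) := (\sum_i k i * d.+1 ^ i)%N.
(* M exceeds N on all indices of degree at most d. So W is smaller on degree d than on any higher
   degree, and on degree d it is ordered by N, whose digits in base d + 1 determine the index. *)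
pose M := (\sum_(i < n) d * d.+1 ^ i).+1.
pose wt (i : 'I_n) := (M + d.+1 ^ i)%N.
pose W (k : mi) := (\sum_i k i * wt i)%N.
have WE k : W k = (M * mdegree k + N k)%N.
  rewrite /W /wt /N /mdegree big_distrr -big_split; apply: eq_bigr => i _ /=.
  by rewrite mulnDr mulnC.
have NM k : (mdegree k <= d)%N -> (N k < M)%N.
  move=> kd; rewrite ltnS; apply: leq_sum => i _; rewrite leq_mul2r.
  by rewrite (leq_trans (le_mdegree k i) kd) orbT.
have exW : exists w, `[< exists2 k, S k & W k = w >].
  by exists (W k2); apply/asboolP; exists k2.
case: (ex_minnP exW) => w /asboolP[k Sk kw] wmin.
have Wmin l : S l -> (W k <= W l)%N.
  by move=> Sl; rewrite kw; apply: wmin; apply/asboolP; exists l.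
have big l : (d < mdegree l)%N -> (M * d.+1 <= W l)%N.
  by move=> dl; rewrite WE (leq_trans _ (leq_addr _ _)) // leq_mul2l dl orbT.
have small l : mdegree l = d -> (W l < M * d.+1)%N.
  by move=> ld; rewrite WE ld mulnS addnC ltn_add2r NM // ld.
have kd : mdegree k = d.
  apply/eqP; rewrite eqn_leq Sd // andbT leqNgt; apply/negP => /big.
  by rewrite leqNgt (leq_ltn_trans (Wmin _ Sk2) (small _ k2d)).
exists wt, k; split=> // l Sl lk.
rewrite ltn_neqAle Wmin // andbT; apply/eqP => Wkl; apply: lk.
have ld : mdegree l = d.
  apply/eqP; rewrite eqn_leq Sd // andbT leqNgt; apply/negP => /big.
  by rewrite -[W l]Wkl leqNgt small.
apply/ffunP; apply: (@digits_inj n d.+1) => [i|i|].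
- by rewrite ltnS -ld le_mdegree.
- by rewrite ltnS -kd le_mdegree.
- by apply: (@addnI (M * d)); rewrite -{1}ld -{2}kd -!WE.
Qed.

End SeparatingWeight.

Section CoefUniqueness.
Variables (R : realType) (n : nat).
Local Notation mi := (mindex n).
Local Notation mle := (@mle n).

(** Finite sums away from the truncation d0 have modulus at most 2. Splitting real and imaginary
    parts by sign, the sum of moduli there is at most 8. *)
Lemma has_sum_abs_bounded (x : mi -> R[i]) (s : R[i]) :
  @has_sum R mi R[i]^o x s -> exists C, forall d, \sum_(k <- mle d) rabs (x k) <= C.
Proof.
move=> /has_sumP/(_ 1 ltr01)[d0 d0P].
have dis (r : seq mi) : uniq r -> {in r, forall k, k \notin mle d0} ->
    rabs (\sum_(k <- r) x k) <= 2.
  move=> ur rd; pose J := [fset k in mle d0 ++ r]%fset.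
  have J0 : {subset mle d0 <= J} by move=> k kd; rewrite !inE kd.
  have J1 : {subset mle d0 <= [fset k in mle d0]%fset} by move=> k; rewrite inE.
  have := d0P _ J0; have := d0P _ J1; rewrite big_fset_mle.
  have -> : \sum_(k <- J) x k = \sum_(k <- mle d0) x k + \sum_(k <- r) x k.
    rewrite -big_cat; apply: perm_big; apply: uniq_perm => [||k]; rewrite ?fset_uniq //.
      rewrite cat_uniq uniq_mle ur andbT /=; apply/hasPn => k /rd.
      by [].
    by rewrite mem_cat !inE.
  set u := \sum_(k <- _) _; set v := \sum_(k <- _) _ => h1 h2.
  rewrite -[v](_ : (s - u) - (s - (u + v)) = v); last by ring.
  have := @ler_nmD R R[i]^o (s - u) (- (s - (u + v))); rewrite nmN => h3.
  apply: le_trans h3 _; rewrite -[2]/(1 + 1).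
  by apply: lerD; apply: ltW.
have part (f : R[i] -> R) : {morph f : a b / a + b} -> f 0 = 0 ->
    (forall a, `|f a| <= rabs a) -> forall (r : seq mi), uniq r ->
    {in r, forall k, k \notin mle d0} -> \sum_(k <- r) `|f (x k)| <= 4.
  move=> fD f0 fle r ur rd.
  have sub (P : pred mi) : `|\sum_(k <- r | P k) f (x k)| <= 2.
    rewrite -(big_morph f fD f0) (le_trans (fle _)) // -big_filter.
    apply: dis; first exact: filter_uniq.
    by move=> k; rewrite mem_filter => /andP[_ /rd].
  rewrite (bigID (fun k => 0 <= f (x k))) /=.
  rewrite (eq_bigr (fun k => f (x k))); last by move=> k; apply: ger0_norm.
  rewrite [X in _ + X](eq_bigr (fun k => - f (x k))); last first.
    by move=> k; rewrite -ltNge => /ltW/ler0_norm.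
  rewrite sumrN (_ : 4 = 2 + 2 :> R); last by ring.
  apply: lerD; first exact: le_trans (ler_norm _) (sub _).
  by apply: le_trans (ler_norm _) _; rewrite normrN.
exists (\sum_(k <- mle d0) rabs (x k) + 8) => d.
rewrite (bigID (mem (mle d0))) /=; apply: lerD.
  rewrite -big_filter; apply: ler_big_subset; rewrite ?uniq_mle //.
  - exact/filter_uniq/uniq_mle.
  - by move=> k; rewrite mem_filter => /andP[].
  - by move=> k; apply: rabs_ge0.
rewrite -big_filter; set r := seq.filter _ _.
have ur : uniq r by exact/filter_uniq/uniq_mle.
have rd : {in r, forall k, k \notin mle d0} by move=> k; rewrite mem_filter => /andP[].
have sq (a : R[i]) : rabs a = Num.sqrt (complex.Re a ^+ 2 + complex.Im a ^+ 2).
  by apply: (@complexI R); rewrite -rabsE normc_def.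
have re : forall a : R[i], `|complex.Re a| <= rabs a.
  by move=> a; rewrite sq -sqrtr_sqr ler_sqrt ?lerDl ?sqr_ge0 // addr_ge0 ?sqr_ge0.
have im : forall a : R[i], `|complex.Im a| <= rabs a.
  by move=> a; rewrite sq -sqrtr_sqr ler_sqrt ?lerDr ?sqr_ge0 // addr_ge0 ?sqr_ge0.
have reD : {morph @complex.Re R : a b / a + b} by move=> [? ?] [? ?].
have imD : {morph @complex.Im R : a b / a + b} by move=> [? ?] [? ?].
have := lerD (part _ reD erefl re r ur rd) (part _ imD erefl im r ur rd).
rewrite -big_split (_ : 4 + 4 = 8 :> R); last by ring.
apply: le_trans; apply: ler_sum => k _ /=.
rewrite {1}[x k]complexE (le_trans (ler_rabsD _ _)) // rabsM !rabsr.
rewrite (_ : rabs 'i%C = 1) ?mul1r //.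
by rewrite sq /= expr0n add0r expr1n sqrtr1.
Qed.

Lemma dot_has_sum (H : hilbertType R) (a : mi -> R[i]) (x : mi -> H) s y :
  has_sum (fun k => a k *: x k) s ->
  @has_sum R mi R[i]^o (fun k => a k * dot (x k) y) (dot s y).
Proof.
apply: (@linear_has_sum R H R[i]^o (fun v => dot v y) (nm y)).
  by move=> c u v; rewrite dotPl.
by move=> u; rewrite mulrC; apply: rabs_dot_le.
Qed.

(** On the curve z_i = t^(wt i) the monomials become powers of t, and by [separating_weight] exactly
    one nonzero coefficient c_k has the least exponent. Pairing with c_k makes the series scalar,
    and its leading term must vanish as t tends to 0. *)
Lemma power_series_eq0 (H : hilbertType R) (c : mi -> H) :
  (forall z : cball n R, has_sum (fun k => monom z k *: c k) 0) -> c = fun=> 0.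
Proof.
move=> c0; apply: contrapT => cN.
have [|wt [k [wt0 ck kmin]]] := @separating_weight n (fun k => c k <> 0).
  apply: contrapT => nex; apply: cN; apply/funext => k; apply: contrapT => ck.
  by apply: nex; exists k.
pose W (l : mi) := (\sum_i l i * wt i)%N.
(* The n coordinates, each of squared modulus at most 1 / (n + 1), stay inside the ball. *)
pose t0 : R := n.+1%:R^-1.
have t00 : 0 < t0 by rewrite invr_gt0 ltr0n.
have ball_t (t : R) : 0 <= t <= t0 -> ball_pred (\row_i (t%:C ^+ wt i)).
  move=> /andP[tp tt0]; rewrite /ball_pred.
  have t01 : t0 <= 1 by rewrite invf_le1 ?ltr0n // ler1n.
  under eq_bigr do rewrite mxE normrX rabsE rabsr ger0_norm // -rcX -rcX.
  rewrite -rc_sum (ltcR _ 1).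
  apply: (@le_lt_trans _ _ (\sum_(i < n) t0)); last first.
    by rewrite sumr_const card_ord -mulr_natl ltr_pdivrMr ?ltr0n // mul1r ltr_nat.
  apply: ler_sum => i _; rewrite -exprM; apply: le_trans (_ : t <= _) => //.
  have w2 : (0 < wt i * 2)%N by rewrite muln_gt0 wt0.
  have := ler_wiXn2l tp (le_trans tt0 t01) w2; by rewrite expr1.
pose z t (tb : 0 <= t <= t0) : cball n R :=
  exist (fun v => is_true (ball_pred v)) _ (ball_t t tb).
have zE t (tb : 0 <= t <= t0) l : monom (z t tb) l = (t ^+ W l)%:C.
  rewrite /monom rcX /W expr_sum; apply: eq_bigr => i _.
  by rewrite /coor /= mxE -exprM mulnC.
pose x l := dot (c l) (c k).
have xs t (tb : 0 <= t <= t0) : @has_sum R mi R[i]^o (fun l => (t ^+ W l)%:C * x l) 0.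
  have := dot_has_sum (y := c k) (c0 (z t tb)); rewrite dot0l; congr has_sum.
  by apply/funext => l; rewrite zE.
have tb0 : 0 <= t0 <= t0 by rewrite lexx ltW.
have [C Cb] := has_sum_abs_bounded (xs t0 tb0).
(* At t = t0 s every other nonzero term gains at least the factor s^(W k + 1) over its value at t0,
   where the moduli sum to at most C; division by s^(W k) leaves s C. *)
have main (s : R) : 0 < s <= 1 -> t0 ^+ W k * rabs (x k) <= s * C.
  move=> /andP[s0 s1].
  have tb : 0 <= t0 * s <= t0.
    apply/andP; split; first by apply: mulr_ge0; apply: ltW.
    by apply: ler_piMr => //; apply: ltW.
  have ts l : 0 <= (t0 * s) ^+ W l by rewrite exprn_ge0 // mulr_ge0 // ltW.
  have t0l l : 0 <= t0 ^+ W l by rewrite exprn_ge0 // ltW.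
  have sW : 0 <= s ^+ (W k).+1 by rewrite exprn_ge0 // ltW.
  suff : rabs (((t0 * s) ^+ W k)%:C * x k) <= s ^+ (W k).+1 * C.
    rewrite rabsM rabsr ger0_norm // exprMn exprSr => le1.
    have b0 : 0 < s ^+ W k by rewrite exprn_gt0.
    rewrite -(ler_pM2l b0); apply: le_trans (_ : _ <= s ^+ W k * s * C) _.
      by apply: le_trans le1; rewrite mulrA [_ * t0 ^+ _]mulrC.
    by rewrite mulrA.
  apply/ler_addgt0Pr => e e0.
  have /nm_cvgP/(_ _ e0)[d0 _ d0P] := has_sum_cvg_mle (xs _ tb).
  pose d := maxn d0 (mdegree k); have := d0P d (leq_maxl _ _).
  have kd : (mdegree k <= d)%N by apply: leq_maxr.
  rewrite /= (big_rem k) ?mem_mle //= sub0r nmN.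
  set a := _ * x k; set r := \sum_(_ <- _) _ => ar.
  have := @ler_nmD R R[i]^o (a + r) (- r); rewrite addrK nmN => h.
  suff rb : @nm R R[i]^o r <= s ^+ (W k).+1 * C.
    by apply: le_trans h _; rewrite addrC; apply: lerD => //; apply: ltW.
  apply: le_trans (ler_nm_sum _ _ _) _.
  apply: (@le_trans _ _ (\sum_(l <- rem k (mle d))
      s ^+ (W k).+1 * rabs ((t0 ^+ W l)%:C * x l))).
    rewrite big_seq [leRHS]big_seq; apply: ler_sum => l.
    rewrite mem_rem_uniq ?uniq_mle // inE => /andP[/eqP lk _].
    rewrite [nm _]rabsM rabsM !rabsr !ger0_norm //.
    have [cl|cl] := pselect (c l = 0).
      by rewrite /x cl dot0l /rabs normr0 !mulr0.
    rewrite exprMn [leLHS]mulrAC mulrC; apply: ler_wpM2r.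
      by apply: mulr_ge0 => //; apply: rabs_ge0.
    by apply: ler_wiXn2l; [exact: ltW|by []|exact: kmin].
  rewrite -mulr_sumr; apply: ler_wpM2l => //.
  by apply: le_trans (Cb d); rewrite [leRHS](big_rem k) ?mem_mle //= lerDr rabs_ge0.
have xk : rabs (x k) = nm (c k) ^+ 2 by rewrite /x dot_sqr rabsr ger0_norm ?sqr_ge0.
have xk0 : 0 < t0 ^+ W k * rabs (x k).
  by rewrite mulr_gt0 ?exprn_gt0 // xk exprn_gt0 // lt_neqAle nm_ge0 andbT eq_sym
    nm_eq0; apply/eqP.
set L := t0 ^+ W k * _ in main xk0.
have LC : L <= C by have := main 1; rewrite ltr01 lexx mul1r; apply.
have C0 : 0 < C by apply: lt_le_trans LC.
have C2 : 0 < 2 * C by rewrite mulr_gt0.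
(* This s gives L <= L / 2, contradicting L > 0. *)
have := main (L / (2 * C)); rewrite divr_gt0 //=.
rewrite ler_pdivrMr // mul1r (_ : L / (2 * C) * C = L / 2); last first.
  by field; rewrite gt_eqF.
have -> : L <= 2 * C by lra.
by move=> /(_ isT); lra.
Qed.

End CoefUniqueness.

(** * Coisometries with an isometric block *)

Section InnerProduct.
Variable R : realType.
Implicit Types S : ipspace R.

(** An [ipspace] is bare data whose inner product is meaningful on the carrier only, so the inner
    product axioms are relativised to it. *)
Record is_inner S : Prop := IsInner {
  inner_carrier0 : @carrier R S 0 ;
  inner_carrierP : forall (a : R[i]) (x y : S),
    carrier x -> carrier y -> carrier (a *: x + y) ;
  innerPl : forall (a : R[i]) (x y z : S), carrier x -> carrier y -> carrier z ->
    ip (a *: x + y) z = a * ip x z + ip y z ;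
  innerC : forall x y : S, carrier x -> carrier y -> ip y x = Num.conj (ip x y) ;
  inner_ge0 : forall x : S, carrier x -> 0 <= ip x x ;
  inner_eq0 : forall x : S, carrier x -> ip x x = 0 -> x = 0 }.

Section Theory.
Variable S : ipspace R.
Hypothesis iS : is_inner S.
Implicit Types x y z : S.

Lemma inner0l z : carrier z -> ip (0 : S) z = 0.
Proof.
move=> cz; have c0 := inner_carrier0 iS.
by have := innerPl iS (-1) c0 c0 cz; rewrite scaler0 add0r mulN1r addNr.
Qed.

Lemma inner0r z : carrier z -> ip z (0 : S) = 0.
Proof.
by move=> cz; rewrite (innerC iS (inner_carrier0 iS) cz) inner0l // rmorph0.
Qed.

Lemma inner_carrierB x y : carrier x -> carrier y -> carrier (x - y).
Proof.
by move=> cx cy; rewrite addrC -scaleN1r; apply: (inner_carrierP iS).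
Qed.

Lemma innerBl x y z : carrier x -> carrier y -> carrier z ->
  ip (x - y) z = ip x z - ip y z.
Proof.
by move=> cx cy cz; rewrite addrC -scaleN1r (innerPl iS) // mulN1r addrC.
Qed.

Lemma inner_sqrD (c : R[i]) x y : carrier x -> carrier y ->
  ip (c *: x + y) (c *: x + y)
    = c * Num.conj c * ip x x + (c * ip x y + Num.conj (c * ip x y)) + ip y y.
Proof.
move=> cx cy; have cxy := inner_carrierP iS c cx cy.
rewrite (innerPl iS) // (innerC iS cxy cx) (innerC iS cxy cy) !(innerPl iS) //.
have xx := esym (innerC iS cx cx); have yy := esym (innerC iS cy cy).
rewrite (innerC iS cx cy) !rmorphD !rmorphM /= xx yy conjCK; ring.
Qed.

End Theory.

Lemma dsum_inner S1 S2 : is_inner S1 -> is_inner S2 -> is_inner (dsum S1 S2).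
Proof.
move=> i1 i2; split.
- by split; apply: inner_carrier0.
- by move=> a x y [x1 x2] [y1 y2]; split; apply: inner_carrierP.
- move=> a x y z [x1 x2] [y1 y2] [z1 z2] /=.
  by rewrite (innerPl i1) // (innerPl i2) // mulrDr addrACA.
- move=> x y [x1 x2] [y1 y2] /=.
  by rewrite (innerC i1 x1 y1) (innerC i2 x2 y2) rmorphD.
- by move=> x [x1 x2] /=; rewrite addr_ge0 ?(inner_ge0 i1) ?(inner_ge0 i2).
- move=> [x1 x2] [/= c1 c2] /eqP.
  rewrite paddr_eq0 ?(inner_ge0 i1) ?(inner_ge0 i2) // => /andP[/eqP e1 /eqP e2].
  by rewrite (inner_eq0 i1 c1 e1) (inner_eq0 i2 c2 e2).
Qed.

Lemma conj_nonneg (x : R[i]) : 0 <= x -> Num.conj x = x.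
Proof. by move=> x0; apply/CrealP; apply: ger0_real. Qed.

(* The inequality |V(u + c u')| <= |u + c u'| for all scalars c, with equality
   at c = 0, forces the first-order terms in c to agree. *)
Lemma contraction_adjoint S S2 (V : S -> S2) (u u' : S) :
  is_inner S -> is_inner S2 -> linear_op V ->
  (forall x, carrier x -> ip (V x) (V x) <= ip x x) ->
  carrier u -> carrier u' -> ip u u <= ip (V u) (V u) ->
  ip (V u') (V u) = ip u' u.
Proof.
move=> iS i2 [VF VL] Vc cu cu' uV.
pose delta := ip (V u') (V u) - ip u' u.
pose K := ip u' u' - ip (V u') (V u').
have K0 : 0 <= K by rewrite subr_ge0 Vc.
have quad (c : R[i]) : c * delta + Num.conj (c * delta) <= c * Num.conj c * K.
  have := Vc _ (inner_carrierP iS c cu' cu); rewrite VL //.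
  rewrite (inner_sqrD iS) // (inner_sqrD i2); [|exact: VF..].
  move=> le1; have := lerD le1 uV; rewrite -subr_ge0 => le2.
  rewrite -subr_ge0; apply: le_trans le2 _; rewrite le_eqVlt; apply/orP; left.
  by apply/eqP; rewrite /K /delta !mulrBr rmorphB; ring.
have K1 : 0 < K + 1 by rewrite ltr_wpDl.
pose N := delta * Num.conj delta.
have N0 : 0 <= N by rewrite mul_conjC_ge0.
(* With N = |delta|^2 this c yields 2 N <= N K / (K + 1), hence N = 0; K + 1 is positive even for K
   = 0. *)
have := quad (Num.conj delta / (K + 1)).
have cK : Num.conj (K + 1)^-1 = (K + 1)^-1.
  by rewrite conj_nonneg // invr_ge0 ltW.
rewrite !rmorphM /= conjCK cK => le1.
have {le1} : N * 2 <= N * (K / (K + 1)).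
  rewrite -(ler_pM2r (_ : 0 < (K + 1)^-1)) ?invr_gt0 //.
  apply: le_trans (le_trans le1 _); rewrite le_eqVlt;
    apply/orP; left; apply/eqP; rewrite /N; ring.
move=> le1; apply/eqP; rewrite -subr_eq0 -/delta -mul_conjC_eq0 -/N.
rewrite eq_le N0 andbT -(ler_pM2r (_ : 0 < 2 - K / (K + 1))).
  by rewrite mul0r mulrBr subr_le0.
rewrite subr_gt0; apply: le_lt_trans (_ : 1 < 2); last by rewrite ltr1n.
by rewrite ler_pdivrMr // mul1r lerDl.
Qed.

(** For V(h, f) = P h + M f, [adj] expresses V^* V u = u wherever V does not decrease the norm. At
    (h, 0) it gives orthogonal ranges; at lifts that do not increase the norm it gives the range of
    M and the complement of its kernel. *)
Lemma complement_of_isometry S0 S1 S2 (P : S0 -> S2) (M : S1 -> S2) :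
  is_inner S0 -> is_inner S1 -> is_inner S2 -> linear_op P -> linear_op M ->
  (forall h f, carrier h -> carrier f ->
    ip (P h + M f) (P h + M f) <= ip h h + ip f f) ->
  (forall g, carrier g -> exists h f, [/\ carrier h, carrier f, P h + M f = g
    & ip h h + ip f f <= ip g g]) ->
  (forall h, carrier h -> ip h h <= ip (P h) (P h)) ->
  partial_isometry M /\ orthominus (P @` carrier (i := S0)) = M @` carrier (i := S1).
Proof.
move=> i0 i1 i2 Plin Mlin contr onto iso.
have [PF PL] := Plin; have [MF ML] := Mlin.
have c00 := inner_carrier0 i0; have c10 := inner_carrier0 i1.
have P0 : P 0 = 0.
  by have := PL (-1) 0 0 c00 c00; rewrite scaler0 add0r scaleN1r addNr.
have M0 : M 0 = 0.
  by have := ML (-1) 0 0 c10 c10; rewrite scaler0 add0r scaleN1r addNr.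
pose V (u : dsum S0 S1) : S2 := P u.1 + M u.2.
have i01 := dsum_inner i0 i1.
have Vlin : linear_op V.
  split=> [u [u1 u2]|a u v [u1 u2] [v1 v2]].
    by rewrite /V -[P _]scale1r; apply: (inner_carrierP i2); [exact: PF|exact: MF].
  by rewrite /V PL // ML // scalerDr addrACA.
have Vc (u : dsum S0 S1) : carrier u -> ip (V u) (V u) <= ip u u.
  by move=> [u1 u2]; apply: contr.
have adj (h h' : S0) (f f' : S1) : carrier h -> carrier f -> carrier h' -> carrier f' ->
    ip h h + ip f f <= ip (P h + M f) (P h + M f) ->
    ip (P h' + M f') (P h + M f) = ip h' h + ip f' f.
  move=> ch cf ch' cf' le1.
  exact: (@contraction_adjoint (dsum S0 S1) S2 V (h, f) (h', f') i01 i2 Vlin Vc).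
have orth h f : carrier h -> carrier f -> ip (M f) (P h) = 0.
  move=> ch cf; have := adj h 0 0 f ch c10 c00 cf.
  rewrite P0 M0 addr0 add0r (inner0l i1) // addr0 (inner0l i0) // (inner0r i1) // addr0.
  by apply; apply: iso.
(* For g orthogonal to the range of P, the lift (h, f) satisfies <h, h> = <P h, g> = 0, so f alone
   maps to g. *)
have ranM g : carrier g -> (forall h, carrier h -> ip g (P h) = 0) ->
    exists f, [/\ carrier f, M f = g & ip f f <= ip g g].
  move=> cg gP; have [h [f [ch cf gE le1]]] := onto g cg.
  have := adj h h f 0 ch cf ch c10; rewrite gE => /(_ le1).
  rewrite M0 addr0 (inner0l i1) // addr0 (innerC i2 cg (PF _ ch)) gP // rmorph0 => /esym hh.
  have h0 := inner_eq0 i0 ch hh; exists f; split=> //.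
    by rewrite -gE h0 P0 add0r.
  by apply: le_trans le1; rewrite hh add0r.
split; last first.
  apply/seteqP; split=> [g [cg gP]|_ [f cf <-]].
    have [|f [cf fg _]] := ranM g cg; last by exists f.
    by move=> h ch; apply: gP; exists h.
  by split; [exact: MF|move=> _ [h ch <-]; apply: orth].
have Mc f : carrier f -> ip (M f) (M f) <= ip f f.
  by move=> cf; have := contr 0 f c00 cf; rewrite P0 add0r (inner0l i0) // add0r.
split; first by split=> //; exists 1 => f cf; rewrite expr1n mul1r; apply: Mc.
move=> f cf fker; apply/le_anti; rewrite Mc //=.
have cMf := MF _ cf.
(* Both f', by [adj], and f, by assumption, are orthogonal to f - f', which lies in the kernel of M;
   hence f = f'. *)
have [|f' [cf' ff' le1]] := ranM (M f) cMf; first by move=> h ch; apply: orth.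
have cd := inner_carrierB i1 cf cf'.
have Md : M (f - f') = 0.
  by rewrite addrC -scaleN1r ML // scaleN1r ff' addNr.
have o1 : ip (f - f') f' = 0.
  have := adj 0 0 f' (f - f') c00 cf' c00 cd.
  rewrite P0 !add0r Md (inner0l i0) // !add0r ff' => /(_ le1) <-.
  exact: (inner0l i2 cMf).
have o2 := fker _ cd Md.
have : f - f' = 0.
  apply: (inner_eq0 i1 cd); rewrite (innerBl i1) // o2 sub0r.
  by rewrite (innerC i1 cd cf') o1 rmorph0 oppr0.
by move=> /subr0_eq e; move: le1; rewrite -e.
Qed.

End InnerProduct.

(** * The characteristic function *)

Lemma whole_inner (R : realType) (H : hilbertType R) : is_inner (whole H).
Proof.
split=> //.
- by move=> a x y z _ _ _; apply: dotPl.
- by move=> x y _ _; apply: dotC.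
- by move=> x _; rewrite /= dot_sqr ler0c sqr_ge0.
- move=> x _; rewrite /= dot_sqr => /(@complexI R)/eqP.
  by rewrite sqrf_eq0 nm_eq0 => /eqP.
Qed.

(** * The function spaces H_p as inner product spaces *)

Section HpSpace.
Variables (R : realType) (n q : nat) (H : hilbertType R) (F : set H).
Local Notation mi := (mindex n).
Local Notation rho := (@rho n R).
Local Notation mle := (@mle n).
Hypothesis FL : forall (a : R[i]) x y, F x -> F y -> F (a *: x + y).
Hypothesis F0 : F 0.

Lemma is_power_series_linear (c : R[i]) (a b : mi -> H) f g :
  is_power_series a f -> is_power_series b g ->
  is_power_series (fun k => c *: a k + b k) (c *: f + g).
Proof.
move=> af bg z; have := has_sumD (has_sumZ (c := c) (af z)) (bg z).
by congr has_sum; apply/funext => k; rewrite scalerDr !scalerA mulrC.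
Qed.

(** This makes the coefficients chosen by [coefs], and with them the inner product of [Hp], well
    defined. *)
Lemma is_power_series_unique (a b : mi -> H) f :
  is_power_series a f -> is_power_series b f -> a = b.
Proof.
move=> af bf; suff e : (fun k => -1 *: b k + a k) = fun=> 0.
  apply/funext => k; apply/eqP; rewrite -subr_eq0; apply/eqP.
  by have := congr1 (@^~ k) e; rewrite /= scaleN1r addrC.
apply: power_series_eq0 => z; have := @is_power_series_linear (-1) _ _ _ _ bf af z.
by rewrite -[X in has_sum _ X]/(-1 *: f z + f z) scaleN1r addNr.
Qed.

Lemma coefsE (a : mi -> H) f : is_power_series a f -> coefs f = a.
Proof.
move=> af; apply: is_power_series_unique (af).
by apply: (xgetPex (0 : mi -> H) (P := [set a | is_power_series a f])); exists a.
Qed.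

Lemma HpP f : carrier (i := Hp n q.+1 F) f <->
  exists (a : mi -> H) (C : R), [/\ forall k, F (a k), is_power_series a f
    & forall d, \sum_(k <- mle d) nm (a k) ^+ 2 / rho q.+1 k <= C].
Proof.
have w0 (a : mi -> H) k : 0 <= nm (a k) ^+ 2 / rho q.+1 k.
  by rewrite divr_ge0 ?sqr_ge0 ?rho_ge0.
have eqw (a : mi -> H) : (fun k => (sqnorm (a k) / rho q.+1 k)%:E)
    = (fun k => (nm (a k) ^+ 2 / rho q.+1 k)%:E).
  by apply/funext => k; rewrite sqnormE.
split=> [[a [aF af]]|[a [C [aF af aC]]]].
  by rewrite eqw => /(summableP (w0 a))[C aC]; exists a, C.
by exists a; split=> //; rewrite eqw; apply/(summableP (w0 a)); exists C.
Qed.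

Lemma Hp_ip_sum (a b : mi -> H) f g (C C' : R) :
  is_power_series a f -> is_power_series b g ->
  (forall d, \sum_(k <- mle d) nm (a k) ^+ 2 / rho q.+1 k <= C) ->
  (forall d, \sum_(k <- mle d) nm (b k) ^+ 2 / rho q.+1 k <= C') ->
  @has_sum R mi R[i]^o (fun k => ((rho q.+1 k)^-1)%:C * dot (a k) (b k))
    (ip (i := Hp n q.+1 F) f g).
Proof.
move=> af bg aC bC; rewrite /= (coefsE af) (coefsE bg).
apply: (@has_csum R n _ (C + C')) => d.
apply: le_trans (lerD (aC d) (bC d)); rewrite -big_split; apply: ler_sum => k _ /=.
rewrite rabsM rabsr ger0_norm ?invr_ge0 ?rho_ge0 // mulrC -mulrDl.
rewrite ler_wpM2r ?invr_ge0 ?rho_ge0 // (le_trans (rabs_dot_le _ _)) //.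
have := sqr_ge0 (nm (a k) - nm (b k)).
have := mulr_ge0 (nm_ge0 (a k)) (nm_ge0 (b k)).
by rewrite sqrrB; lra.
Qed.

Lemma Hp_ip_sqr (a : mi -> H) f (C : R) : is_power_series a f ->
  (forall d, \sum_(k <- mle d) nm (a k) ^+ 2 / rho q.+1 k <= C) ->
  ip (i := Hp n q.+1 F) f f = (msup (fun k => nm (a k) ^+ 2 / rho q.+1 k))%:C.
Proof.
move=> af aC; apply: has_sum_unique (Hp_ip_sum af af aC aC) _.
have w0 k : 0 <= nm (a k) ^+ 2 / rho q.+1 k by rewrite divr_ge0 ?sqr_ge0 ?rho_ge0.
have := has_sum_msup w0 aC; congr has_sum; apply/funext => k.
by rewrite dot_sqr -rcM mulrC.
Qed.

Lemma weighted_sum_linear (c : R[i]) (a b : mi -> H) (C C' : R) :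
  (forall d, \sum_(k <- mle d) nm (a k) ^+ 2 / rho q.+1 k <= C) ->
  (forall d, \sum_(k <- mle d) nm (b k) ^+ 2 / rho q.+1 k <= C') ->
  forall d, \sum_(k <- mle d) nm (c *: a k + b k) ^+ 2 / rho q.+1 k
    <= 2 * (rabs c ^+ 2 * C + C').
Proof.
move=> aC bC d.
apply: (@le_trans _ _ (\sum_(k <- mle d) 2 * (rabs c ^+ 2 * (nm (a k) ^+ 2 / rho q.+1 k)
    + nm (b k) ^+ 2 / rho q.+1 k))).
  apply: ler_sum => k _; rewrite mulrA -mulrDl mulrA ler_wpM2r ?invr_ge0 ?rho_ge0 //.
  have := ler_nmD (c *: a k) (b k); rewrite nmZ => h.
  have := nm_ge0 (c *: a k + b k) => h0.
  apply: (@le_trans _ _ ((rabs c * nm (a k) + nm (b k)) ^+ 2)).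
    by rewrite ler_pXn2r ?nnegrE // (le_trans h0).
  rewrite -exprMn; have := sqr_ge0 (rabs c * nm (a k) - nm (b k)).
  by rewrite sqrrB sqrrD; lra.
rewrite -mulr_sumr big_split /= -mulr_sumr ler_wpM2l //.
by apply: lerD => //; apply: ler_wpM2l => //; apply: sqr_ge0.
Qed.

Lemma rabs_conj (x : R[i]) : rabs (Num.conj x) = rabs x.
Proof. by apply: (@complexI R); rewrite -!rabsE norm_conjC. Qed.

Lemma has_sum_conj (x : mi -> R[i]) (s : R[i]) : @has_sum R mi R[i]^o x s ->
  @has_sum R mi R[i]^o (fun k => Num.conj (x k)) (Num.conj s).
Proof.
move=> /has_sumP xs; apply/has_sumP => e /xs[d dP]; exists d => J /dP.
move=> h; rewrite -rmorph_sum -rmorphB; apply: le_lt_trans h.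
by rewrite [leLHS]rabs_conj.
Qed.

Lemma Hp_inner : is_inner (Hp n q.+1 F).
Proof.
have w0 (a : mi -> H) k : 0 <= nm (a k) ^+ 2 / rho q.+1 k.
  by rewrite divr_ge0 ?sqr_ge0 ?rho_ge0.
have zero_sum (z : cball n R) : has_sum (fun k => monom z k *: (0 : H)) 0.
  apply/has_sumP => e e0; exists 0%N => J _.
  by rewrite big1 ?subrr ?nm0 // => k _; rewrite scaler0.
split.
- apply/HpP; exists (fun=> 0), 0; split=> // d.
  by rewrite big1 // => k _; rewrite nm0 expr0n mul0r.
- move=> c f g /HpP[a [C [aF af aC]]] /HpP[b [C' [bF bg bC]]].
  apply/HpP; exists (fun k => c *: a k + b k).
  exists (2 * (rabs c ^+ 2 * C + C')); split=> [k||]; first exact: FL.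
    exact: is_power_series_linear.
  exact: weighted_sum_linear.
- move=> c f g h /HpP[a [C [_ af aC]]] /HpP[b [C' [_ bg bC]]] /HpP[d [C2 [_ dh dC]]].
  have s1 := Hp_ip_sum af dh aC dC; have s2 := Hp_ip_sum bg dh bC dC.
  have s3 := has_sumD (has_sumZ (c := c) s1) s2.
  have := Hp_ip_sum (is_power_series_linear (c := c) af bg) dh
    (weighted_sum_linear c aC bC) dC.
  move=> /has_sum_unique; apply; move: s3; congr has_sum; apply/funext => k.
  rewrite dotPl mulrDr; congr (_ + _).
  by rewrite -[LHS]/(c * (_ * _)) mulrCA.
- move=> f g /HpP[a [C [_ af aC]]] /HpP[b [C' [_ bg bC]]].
  apply: has_sum_unique (Hp_ip_sum bg af bC aC) _.
  have := has_sum_conj (Hp_ip_sum af bg aC bC); congr has_sum; apply/funext => k.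
  have rr : Num.conj ((rho q.+1 k)^-1)%:C = ((rho q.+1 k)^-1)%:C.
    by apply: conj_nonneg; rewrite ler0c invr_ge0 rho_ge0.
  by rewrite rmorphM (dotC (a k) (b k)); congr (_ * _); apply: rr.
- move=> f /HpP[a [C [_ af aC]]].
  by rewrite (Hp_ip_sqr af aC) ler0c (msup_ge0 (w0 a) aC).
- move=> f /HpP[a [C [_ af aC]]]; rewrite (Hp_ip_sqr af aC) => /complexI ms.
  suff a0 k : a k = 0.
    apply/funext => z; apply: has_sum_unique (af z) _.
    by move: (zero_sum z); congr has_sum; apply/funext => k; rewrite a0.
  apply/eqP; rewrite -nm_eq0 -sqrf_eq0 eq_le sqr_ge0 andbT.
  have := ler_fset_msup (w0 a) aC (isT : uniq [:: k]); rewrite big_seq1 ms.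
  by rewrite pmulr_lle0 // invr_gt0 rho_gt0.
Qed.

End HpSpace.

(** * Coefficients, bounds and range of the characteristic function *)

Section CharacteristicFunction.
Variables (R : realType) (p n : nat) (H E : hilbertType R) (T : 'I_n -> H -> H).
Variables (B : E -> 'I_n -> H) (D : E -> mindex n -> H).
Local Notation m := p.+1.
Hypotheses (pureT : pure T) (hT : commuting_tuple T).
Hypothesis triple : characteristic_triple T m B D.
Local Notation mi := (mindex n).
Local Notation rho := (@rho n R).
Local Notation mle := (@mle n).
Local Notation U := (block_op T m B D).
Local Notation F := (defect_space T m).
Local Notation Phi := (Phi_char T m B D).
Local Notation S1 := (Hp n 1 [set: E]).
Local Notation S2 := (Hp n m F).

Let UL := block_linear triple.
Let UI := block_isometric triple.
Let FL := defect_space_linear triple.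
Let F0 := defect_space0 triple.

Lemma Pi_dil_linear (a : R[i]) x y z :
  Pi_dil T m (a *: x + y) z = a *: Pi_dil T m x z + Pi_dil T m y z.
Proof. exact: defect_resolvent_linear hT triple z a x y. Qed.

Lemma Pi_dil0 z : Pi_dil T m 0 z = 0.
Proof. by have := Pi_dil_linear (-1) 0 0 z; rewrite scaler0 add0r scaleN1r addNr. Qed.

Definition const_coef (eta : E) (k : mi) : E := if k == mi0 n then eta else 0.

Lemma const_coef_linear (a : R[i]) x y :
  const_coef (a *: x + y) = fun k => a *: const_coef x k + const_coef y k.
Proof.
by apply/funext => k; rewrite /const_coef; case: ifP; rewrite ?scaler0 ?addr0.
Qed.

Lemma const_coef_sum z eta : has_sum (fun k => monom z k *: const_coef eta k) eta.
Proof.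
apply/has_sumP => e e0; exists 0%N => J J0.
rewrite (big_fsetD1 (mi0 n)) /=; last by apply: J0; rewrite mem_mle mdegree0.
rewrite /const_coef eqxx monom0 scale1r big1_fset ?addr0 ?subrr ?nm0 //.
by move=> k; rewrite !inE => /andP[/negPf -> _] _; rewrite scaler0.
Qed.

Lemma const_coef_norm eta d :
  \sum_(k <- mle d) nm (const_coef eta k) ^+ 2 / rho 1 k = nm eta ^+ 2.
Proof.
rewrite -[RHS](big_mle0 n d); apply: eq_bigr => k _; rewrite /const_coef.
by case: eqP => [->|_]; rewrite ?rho_mi0 ?divr1 // nm0 expr0n mul0r.
Qed.

(** By [output_eval], the outputs for zero initial vector and constant input eta are the Taylor
    coefficients of Phi(z) eta, so their bounds follow from the contraction. *)
Definition Phi_coef (k : mi) (eta : E) : H := output p U 0 (const_coef eta) k.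

Lemma Phi_sum z eta : has_sum (fun k => monom z k *: Phi_coef k eta) (Phi z eta).
Proof.
have eb d : \sum_(k <- mle d) nm (const_coef eta k) ^+ 2 / rho 1 k <= nm eta ^+ 2.
  by rewrite const_coef_norm.
have := output_eval (ltn0Sn p) hT triple (h := 0) eb (@const_coef_sum z eta).
by rewrite Pi_dil0 add0r.
Qed.

Lemma Phi_coef_linear k (a : R[i]) x y :
  Phi_coef k (a *: x + y) = a *: Phi_coef k x + Phi_coef k y.
Proof.
rewrite /Phi_coef const_coef_linear -(output_linear p UL); congr output.
by rewrite scaler0 addr0.
Qed.

Lemma Phi_coef_range k eta : F (Phi_coef k eta).
Proof. exact: block_output_range. Qed.

Lemma Phi_coef_bound eta d :
  \sum_(k <- mle d) nm (Phi_coef k eta) ^+ 2 / rho m k <= nm eta ^+ 2.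
Proof.
apply: le_trans (output_contraction p UI 0 (const_coef eta) d) _.
by rewrite const_coef_norm nm0 expr0n add0r.
Qed.

Lemma Phi_linear z (a : R[i]) x y : Phi z (a *: x + y) = a *: Phi z x + Phi z y.
Proof.
apply: has_sum_unique (@Phi_sum z (a *: x + y)) _.
have := has_sumD (has_sumZ (c := a) (@Phi_sum z x)) (@Phi_sum z y).
congr has_sum; apply/funext => k.
by rewrite Phi_coef_linear scalerDr !scalerA mulrC.
Qed.

Lemma Phi0 z : Phi z 0 = 0.
Proof. by have := Phi_linear z (-1) 0 0; rewrite scaler0 add0r scaleN1r addNr. Qed.

Lemma Phi_range z eta : F (Phi z eta).
Proof.
apply: (defect_space_lim _ (has_sum_cvg_mle (@Phi_sum z eta))) => d.
apply: (defect_space_sum triple) => k; exact: Phi_coef_range.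
Qed.

(** On the right eta enters only through its norm, so finite tails are controlled in operator norm
    by the kernel. *)
Lemma Phi_partial_bound z eta (s : seq mi) : uniq s ->
  nm (\sum_(k <- s) monom z k *: Phi_coef k eta) ^+ 2
    <= (\sum_(k <- s) rho m k * rabs (monom z k) ^+ 2) * nm eta ^+ 2.
Proof.
move=> us; apply: le_trans (eval_sqr_bound _ p _ _) _; apply: ler_wpM2l.
  by apply: sumr_ge0 => k _; apply: rho_monom_ge0.
have w0 k : 0 <= nm (Phi_coef k eta) ^+ 2 / rho m k.
  by rewrite divr_ge0 ?sqr_ge0 ?rho_ge0.
apply: le_trans (ler_fset_msup w0 (Phi_coef_bound eta) us) _.
exact: msup_le (Phi_coef_bound eta).
Qed.

Lemma Phi_bounded z : @bounded_op R (subsp [set: E]) (subsp F) (Phi z).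
Proof.
split; first by split=> [eta _|a x y _ _]; [exact: Phi_range|exact: Phi_linear].
pose c := (1 - znorm z ^+ 2)^-1 ^+ m.
have c0 : 0 <= c.
  by rewrite exprn_ge0 // invr_ge0 subr_ge0 expr_le1 ?znorm_ge0 // ltW // znorm_lt1.
exists (Num.sqrt c) => eta _; rewrite /= !dot_sqr -rcM lecR sqr_sqrtr //.
have ce : 0 <= c * nm eta ^+ 2 by rewrite mulr_ge0 ?sqr_ge0.
rewrite -[leRHS]sqr_sqrtr //.
apply: lerXn2r; rewrite ?nnegrE ?nm_ge0 ?sqrtr_ge0 //.
apply: (nm_le_lim _ (has_sum_cvg_mle (@Phi_sum z eta))); apply: nearW => d.
rewrite -(@ler_pXn2r _ 2) ?nnegrE ?nm_ge0 ?sqrtr_ge0 // sqr_sqrtr //.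
apply: le_trans (Phi_partial_bound _ _ (uniq_mle _ _)) _.
by rewrite ler_wpM2r ?sqr_ge0 // rho_monom_bound.
Qed.

Lemma Phi_analytic : @analytic_op R n (subsp [set: E]) (subsp F) Phi.
Proof.
exists Phi_coef => [k|z e e0].
  split; first by split=> [eta _|a x y _ _]; [exact: Phi_coef_range|exact: Phi_coef_linear].
  exists (Num.sqrt (rho m k)) => eta _; rewrite /= !dot_sqr -rcM lecR.
  rewrite sqr_sqrtr ?rho_ge0 // mulrC -ler_pdivrMr ?rho_gt0 //.
  have w0 l : 0 <= nm (Phi_coef l eta) ^+ 2 / rho m l.
    by rewrite divr_ge0 ?sqr_ge0 ?rho_ge0.
  have := ler_fset_msup w0 (Phi_coef_bound eta) (isT : uniq [:: k]).
  rewrite big_seq1 => h; apply: le_trans h _; exact: msup_le (Phi_coef_bound eta).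
pose w k := rho m k * rabs (monom z k) ^+ 2.
have w0 k : 0 <= w k by apply: rho_monom_ge0.
have wC := rho_monom_bound z m.
have [d dP] := msup_adherent wC (exprn_gt0 2 e0).
exists [fset k in mle d]%fset => // J /= dJ eta _.
have dJ' : {subset mle d <= J} by move=> k kd; apply: (fsubsetP dJ); rewrite inE.
rewrite !dot_sqr -rcM lecR -exprMn.
have en : 0 <= e * nm eta by rewrite mulr_ge0 ?nm_ge0 ?ltW.
apply: lerXn2r; rewrite ?nnegrE ?nm_ge0 //.
rewrite partial_sumE; apply/ler_addgt0Pr => e' e'0.
have /has_sumP/(_ _ e'0)[d' d'P] := @Phi_sum z eta.
(* Up to e', Phi z eta is replaced by a finite sum over a set containing J; the indices outside J
   lie outside the truncation d, where the kernel has mass below e^2. *)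
pose J' := (J `|` [fset k in mle d'])%fset.
have := d'P J' _; set s' := \sum_(_ <- J') _ => /(_ _)/ltW h1.
have {}h1 : nm (Phi z eta - s') <= e'.
  by apply: h1 => k kd; rewrite !inE kd orbT.
rewrite -(subrK s' (Phi z eta)) -addrA addrC (le_trans (ler_nmD _ _)) // lerD //.
have -> : s' - \sum_(k <- J) monom z k *: Phi_coef k eta
    = \sum_(k <- J' | k \notin J) monom z k *: Phi_coef k eta.
  rewrite /s' (bigID (mem J)) /= addrAC.
  rewrite -[X in X - _ + _]big_filter [X in X - _ + _](perm_big J) ?subrr ?add0r //=.
  apply: uniq_perm => [||k]; rewrite ?filter_uniq ?fset_uniq //.
  by rewrite mem_filter /J' !inE; case: (k \in J).
rewrite -big_filter; set r := seq.filter _ _.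
have ur : uniq r by rewrite filter_uniq ?fset_uniq.
rewrite -(@ler_pXn2r _ 2) ?nnegrE ?nm_ge0 //.
apply: le_trans (Phi_partial_bound _ _ ur) _; rewrite exprMn ler_wpM2r ?sqr_ge0 //.
apply: le_trans (tail_msup (d := d) w0 wC ur _) _.
  by move=> k; rewrite mem_filter => /andP[kJ _]; apply: contra kJ => /dJ'.
by rewrite lerBlDr addrC -lerBlDr ltW.
Qed.

Lemma dilation_series h (f : cball n R -> E) (b : mi -> E) (C : R) :
  is_power_series b f ->
  (forall d, \sum_(k <- mle d) nm (b k) ^+ 2 / rho 1 k <= C) ->
  is_power_series (output p U h b) (Pi_dil T m h + mulop Phi f).
Proof. by move=> bf bC z; apply: (output_eval (ltn0Sn p) hT triple bC (bf z)). Qed.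

Lemma dilation_bound h (b : mi -> E) (C : R) :
  (forall d, \sum_(k <- mle d) nm (b k) ^+ 2 / rho 1 k <= C) ->
  forall d, \sum_(k <- mle d) nm (output p U h b k) ^+ 2 / rho m k <= nm h ^+ 2 + C.
Proof.
by move=> bC d; apply: le_trans (output_contraction p UI h b d) _; rewrite lerD2l.
Qed.

Lemma zero_series : @is_power_series R n E (fun=> 0) 0.
Proof.
move=> z; apply/has_sumP => e e0; exists 0%N => J _.
by rewrite big1 ?subrr ?nm0 // => k _; rewrite scaler0.
Qed.

Lemma zero_bound d : \sum_(k <- mle d) nm (0 : E) ^+ 2 / rho 1 k <= 0.
Proof. by rewrite big1 // => k _; rewrite nm0 expr0n mul0r. Qed.

Lemma mulop0 : mulop Phi 0 = 0.
Proof. by apply/funext => z; apply: Phi0. Qed.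

Lemma Pi_dil_op : @linear_op R (whole H) S2 (Pi_dil T m).
Proof.
split=> [h _|a x y _ _]; last by apply/funext => z; apply: Pi_dil_linear.
apply/HpP; exists (output p U h (fun=> 0)), (nm h ^+ 2 + 0); split=> [k||].
- exact: block_output_range.
- by have := @dilation_series h _ _ _ zero_series zero_bound; rewrite mulop0 addr0.
- exact: dilation_bound zero_bound.
Qed.

Lemma mulop_op : @linear_op R S1 S2 (mulop Phi).
Proof.
split=> [f|a f g _ _]; last by apply/funext => z; apply: Phi_linear.
move=> /HpP[b [C [_ bf bC]]]; apply/HpP.
exists (output p U 0 b), (nm (0 : H) ^+ 2 + C); split=> [k||].
- exact: block_output_range.
- have := @dilation_series 0 _ _ _ bf bC; rewrite (_ : Pi_dil T m 0 = 0) ?add0r //.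
  by apply/funext => z; apply: Pi_dil0.
- exact: dilation_bound bC.
Qed.

Lemma Phi_partial_isometry :
  @partial_isometry R S1 S2 (mulop Phi) /\
  canonical_subspace T m = mulop Phi @` (@carrier R S1).
Proof.
have w0 q (G : hilbertType R) (b : mi -> G) k : 0 <= nm (b k) ^+ 2 / rho q.+1 k.
  by rewrite divr_ge0 ?sqr_ge0 ?rho_ge0.
apply: (@complement_of_isometry R (whole H) S1 S2 (Pi_dil T m) (mulop Phi)).
- exact: whole_inner.
- by apply: Hp_inner.
- by apply: Hp_inner.
- exact: Pi_dil_op.
- exact: mulop_op.
- move=> h f _ /HpP[b [C [_ bf bC]]].
  have oC : forall d, \sum_(k <- mle d) nm (output p U h b k) ^+ 2 / rho m k
      <= nm h ^+ 2 + msup (fun k => nm (b k) ^+ 2 / rho 1 k).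
    by apply: dilation_bound => d; apply: ler_msup bC d.
  rewrite (Hp_ip_sqr _ (@dilation_series h _ _ _ bf bC) oC) (Hp_ip_sqr _ bf bC).
  by rewrite /= dot_sqr -rcD lecR (msup_le oC).
- move=> g /HpP[c [C [cF cg cC]]].
  (* The bound passed is the exact squared norm of g rather than C, so that the lift does not
     increase the norm. *)
  have [h [b [bc hb]]] := output_onto UL UI FL F0 (block_surjective triple) cF
    (fun d => ler_msup cC d).
  have bC d : \sum_(k <- mle d) nm (b k) ^+ 2 / rho 1 k
      <= msup (fun k => nm (c k) ^+ 2 / rho m k) - nm h ^+ 2.
    by rewrite lerBrDl.
  have /choice[f bf] : forall z, exists s, has_sum (fun k => monom z k *: b k) s.
    by move=> z; apply: eval_exists bC.
  exists h, f; split=> //.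
  + by apply/HpP; exists b, (msup (fun k => nm (c k) ^+ 2 / rho m k) - nm h ^+ 2).
  + apply/funext => z; apply: has_sum_unique (cg z).
    by rewrite -bc; apply: @dilation_series h _ _ _ bf bC z.
  + rewrite (Hp_ip_sqr _ bf bC) (Hp_ip_sqr _ cg cC) /= dot_sqr -rcD lecR.
    by rewrite -lerBrDl (msup_le bC).
- move=> h _.
  have zs := @dilation_series h _ _ _ zero_series zero_bound.
  rewrite mulop0 addr0 in zs.
  have zC := dilation_bound h zero_bound.
  rewrite (Hp_ip_sqr _ zs zC) /= dot_sqr lecR.
  exact: (dilation_norm_ge (ltn0Sn p) pureT hT triple (fun d => ler_msup zC d)).
Qed.

End CharacteristicFunction.

Theorem theorem3p1 (R : realType) (m n : nat) (hm : (0 < m)%N) (hn : (0 < n)%N)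
    (H E : hilbertType R) (T : 'I_n -> H -> H)
    (hT : hypercontraction T m) (pureT : pure T)
    (B : E -> 'I_n -> H) (D : E -> mindex n -> H)
    (triple : characteristic_triple T m B D) :
  let F := defect_space T m in
  let Phi := Phi_char T m B D in
  [/\ multiplier m [set: E] F Phi,
      @partial_isometry R (Hp n 1 [set: E]) (Hp n m F) (mulop Phi)
    & canonical_subspace T m =
      mulop Phi @` (@carrier R (Hp n 1 [set: E]))].
Proof.
move=> F Phi; case: m hm hT triple @F @Phi => // p _ [cT _ _] triple F Phi.
have [pI rE] := Phi_partial_isometry pureT cT triple.
split=> //; split=> [z||f cf].
- exact: Phi_bounded cT triple z.
- exact: Phi_analytic cT triple.
- exact: (mulop_op cT triple).1 f cf.
Qed.
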